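(* Let $\Phi_0(x) = |x|^2/4$ on $\mathbf{C}^n$ and $Q(x) = \lambda |x|^2 + \frac{1}{2} \overline{c} \cdot x - \frac{1}{2} d \cdot \overline{x}$, with $c,d \in \mathbf{C}^n$ and $\lambda \in \mathbf{C}$, $\mathrm{Re}\, \lambda < 1/4$. The Toeplitz operator $\mathrm{Top}(e^Q): H_{\Phi_0}(\mathbf{C}^n) \rightarrow H_{\Phi_0}(\mathbf{C}^n)$ is bounded if and only if the Weyl symbol $a\in C^{\infty}(\Lambda_{\Phi_0})$ of $\mathrm{Top}(e^Q)$ satisfies $a\in L^{\infty}(\Lambda_{\Phi_0})$.
   Context: Here $a\cdot b=\sum_j a_jb_j$ (bilinear). $\Lambda_{\Phi_0} = \{(x,\frac{2}{i}\frac{\partial \Phi_0}{\partial x}(x)) : x\in \mathbf{C}^n\}$. $H_{\Phi_0}(\mathbf{C}^n) = L^2(\mathbf{C}^n, e^{-2\Phi_0} L(dx)) \cap \mathrm{Hol}(\mathbf{C}^n)$, $\Pi_{\Phi_0}$ is the orthogonal projection from $L^2(\mathbf{C}^n, e^{-2\Phi_0}L(dx))$ onto $H_{\Phi_0}(\mathbf{C}^n)$, and $\mathrm{Top}(e^Q)=\Pi_{\Phi_0}\circ e^Q\circ\Pi_{\Phi_0}$ with natural dense domain $\{u\in H_{\Phi_0}: e^Qu\in L^2(\mathbf{C}^n,e^{-2\Phi_0}L(dx))\}$; bounded means bounded on this domain. The Weyl symbol of $\mathrm{Top}(e^Q)$ (the function $a$ on $\Lambda_{\Phi_0}$ with $\mathrm{Top}(e^Q)=a^w(x,D_x)$)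 is given by $a(x,\frac{2}{i}\frac{\partial\Phi_0}{\partial x}(x)) = \left(\exp(\tfrac14\Delta)e^Q\right)(x)=\pi^{-n}\int_{\mathbf{C}^n}e^{-|x-y|^2}e^{Q(y)}\,L(dy)$, where $\Delta$ is the Laplacian on $\mathbf{C}^n\simeq\mathbf{R}^{2n}$. *)

(* Defs.v *)
From HB Require Import structures.
From mathcomp Require Import all_boot all_order all_algebra.
From mathcomp Require Import all_classical all_reals all_analysis.
From mathcomp Require Import complex.
Set Implicit Arguments.
Unset Strict Implicit.
Unset Printing Implicit Defensive.
Import Order.TTheory GRing.Theory Num.Theory.
Import numFieldNormedType.Exports.
Local Open Scope ring_scope.

Record MSpace (R : realType) := {
  ms_disp : measure_display;
  ms_car : measurableType ms_disp;
  ms_mes : {measure set ms_car -> \bar R} }.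

Definition lebR (R : realType) :
  {sigma_finite_measure set (measurableTypeR R) -> \bar R} := @lebesgue_measure R.

Fixpoint RnM (R : realType) (k : nat) : MSpace R :=
  match k with
  | 0 => {| ms_car := unit; ms_mes := @dirac _ unit tt R |}
  | S k => let M := RnM R k in
      {| ms_car := (ms_car M * measurableTypeR R)%type;
         ms_mes := (ms_mes M \x lebR R)%E |}
  end.

Fixpoint rcoord (R : realType) (k : nat) : ms_car (RnM R k) -> nat -> R :=
  match k return ms_car (RnM R k) -> nat -> R with
  | 0 => fun _ _ => 0
  | S k' => fun x j => if j == k' then x.2 else rcoord x.1 j
  end.

Fixpoint rupd (R : realType) (k : nat) : ms_car (RnM R k) -> nat -> R -> ms_car (RnM R k) :=
  match k return ms_car (RnM R k) -> nat -> R -> ms_car (RnM R k) with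
  | 0 => fun x _ _ => x
  | S k' => fun x j v => if j == k' then (x.1, v) else (rupd x.1 j v, x.2)
  end.

(** * C^n identified with R^(2n): the complex coordinate z_k is x_(2k) + i x_(2k+1) *)
Definition Cn (R : realType) (n : nat) := ms_car (RnM R (n + n)).

Definition lebC (R : realType) (n : nat) : {measure set Cn R n -> \bar R} :=
  ms_mes (RnM R (n + n)).

Definition zc (R : realType) (n : nat) (x : Cn R n) (k : nat) : R[i] :=
  Complex (rcoord x k.*2) (rcoord x k.*2.+1).

Definition zupd (R : realType) (n : nat) (x : Cn R n) (k : nat) (w : R[i]) : Cn R n :=
  rupd (rupd x k.*2 (complex.Re w)) k.*2.+1 (complex.Im w).

Definition sqnorm (R : realType) (n : nat) (x : Cn R n) : R :=
  \sum_(j < n + n) rcoord x j ^+ 2.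
Definition sqdist (R : realType) (n : nat) (x y : Cn R n) : R :=
  \sum_(j < n + n) (rcoord x j - rcoord y j) ^+ 2.

Definition cabs (R : realType) (z : R[i]) : R :=
  Num.sqrt (complex.Re z ^+ 2 + complex.Im z ^+ 2).

Definition cexp (R : realType) (z : R[i]) : R[i] :=
  Complex (expR (complex.Re z) * cos (complex.Im z))
          (expR (complex.Re z) * sin (complex.Im z)).

Definition Phi0 (R : realType) (n : nat) (x : Cn R n) : R := sqnorm x / 4.
Definition weight (R : realType) (n : nat) (x : Cn R n) : R := expR (- (2 * Phi0 x)).

(** * Holomorphy on C^n (Osgood): continuous and holomorphic in each variable *)
Definition ccontinuous (R : realType) (n : nat) (f : Cn R n -> R[i]) : Prop :=
  forall x (e : R), 0 < e -> exists2 r : R, 0 < r &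
    forall y, sqdist x y < r ^+ 2 -> cabs (f y - f x) < e.

Definition separately_holomorphic (R : realType) (n : nat) (f : Cn R n -> R[i]) : Prop :=
  forall x (k : nat), (k < n)%N -> exists L : R[i],
    forall e : R, 0 < e -> exists2 r : R, 0 < r &
      forall h : R[i], h != 0 -> cabs h < r ->
        cabs ((f (zupd x k (zc x k + h)) - f x) / h - L) < e.

Definition holomorphic (R : realType) (n : nat) (f : Cn R n -> R[i]) : Prop :=
  ccontinuous f /\ separately_holomorphic f.

Definition cmeasurable (R : realType) (n : nat) (f : Cn R n -> R[i]) : Prop :=
  measurable_fun setT (fun x => complex.Re (f x)) /\
  measurable_fun setT (fun x => complex.Im (f x)).

Definition wnorm2 (R : realType) (n : nat) (f : Cn R n -> R[i]) : \bar R :=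
  (\int[lebC R n]_x ((cabs (f x) ^+ 2 * weight x)%:E))%E.

Definition inL2 (R : realType) (n : nat) (f : Cn R n -> R[i]) : Prop :=
  cmeasurable f /\ (wnorm2 f < +oo)%E.

Definition wnorm (R : realType) (n : nat) (f : Cn R n -> R[i]) : R :=
  Num.sqrt (fine (wnorm2 f)).

Definition inH (R : realType) (n : nat) (f : Cn R n -> R[i]) : Prop :=
  holomorphic f /\ inL2 f.

Definition cintegral (R : realType) (n : nat) (f : Cn R n -> R[i]) : R[i] :=
  Complex (Rintegral (lebC R n) setT (fun x => complex.Re (f x)))
          (Rintegral (lebC R n) setT (fun x => complex.Im (f x))).

Definition winner (R : realType) (n : nat) (f g : Cn R n -> R[i]) : R[i] :=
  cintegral (fun x => f x * conjc (g x) * (weight x)%:C%C).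

Definition is_proj (R : realType) (n : nat) (w p : Cn R n -> R[i]) : Prop :=
  inH p /\ forall v, inH v -> winner (fun x => w x - p x) v = 0.

(** Top(e^Q) = Pi e^Q Pi is bounded on its natural domain
    { u in H_{Phi_0} : e^Q u in L^2(e^{-2 Phi_0} L(dx)) } *)
Definition Top_bounded (R : realType) (n : nat) (Q : Cn R n -> R[i]) : Prop :=
  exists C : R, forall u, inH u -> inL2 (fun x => cexp (Q x) * u x) ->
    forall p, is_proj (fun x => cexp (Q x) * u x) p -> wnorm p <= C * wnorm u.

(** The Weyl symbol of Top(e^Q), as a function of x (parametrizing Lambda_{Phi_0}):
    a(x) = pi^{-n} \int e^{-|x-y|^2} e^{Q(y)} L(dy) *)
Definition weyl_symbol (R : realType) (n : nat) (Q : Cn R n -> R[i]) (x : Cn R n) : R[i] :=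
  (pi ^- n)%:C%C * cintegral (fun y => (expR (- sqdist x y))%:C%C * cexp (Q y)).

(** a in L^infty(Lambda_{Phi_0}) (Lebesgue measure on Lambda_{Phi_0} pulled back to C^n) *)
Definition in_Linfty (R : realType) (n : nat) (a : Cn R n -> R[i]) : Prop :=
  cmeasurable a /\ exists M : R, {ae lebC R n, forall x, cabs (a x) <= M}.

Definition Qsymb (R : realType) (n : nat) (lam : R[i]) (c d : 'I_n -> R[i]) (x : Cn R n) : R[i] :=
  lam * (sqnorm x)%:C%C
  + 2^-1 * (\sum_(j < n) conjc (c j) * zc x j)
  - 2^-1 * (\sum_(j < n) d j * conjc (zc x j)).

(* Main.v *)
(** Write mu = 1 - 2 lam.  The reproducing property of the Gaussian,
      int f(y) exp (- al |y|^2 + b . conj y) dy = kappa(al)^n f(b / al)   (f entire, 0 < Re al),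
    gives both Top(e^Q) and its Weyl symbol in closed form.  Up to nonzero constants,
      Top(e^Q) u (z) = u((z - d) / mu) exp (conj c . (z - d) / (2 mu)),
    and the modulus of the symbol is the exponential of a real quadratic polynomial.  Testing
    Top(e^Q) on the reproducing kernels exp (z . conj w / 2), respectively changing variables to
    y = (z - d) / mu, shows that it is bounded iff another real quadratic polynomial is bounded
    above.  Each of the two polynomials is bounded above iff, for every j, |mu| > 1, or |mu| = 1
    and c_j mu = d_j.
    The one-variable reproducing property follows from the mean value property of entire functions
    on circles, by rotation invariance of the plane; since holomorphy is only pointwise complex
    differentiability, the mean value property is derived from Goursat's bisection argument applied
    to w |-> F(z e^w) on rectangles of height 2 pi.  Fubini's theorem and induction on the dimension
    give the general case. *)

Require Import Defs.
From HB Require Import structures.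
From mathcomp Require Import all_boot all_order all_algebra.
From mathcomp Require Import all_classical all_reals all_analysis.
From mathcomp Require Import complex.
From mathcomp Require Import measurable_realfun.
From mathcomp Require Import ring lra.
Import Order.TTheory GRing.Theory Num.Theory.
Import numFieldNormedType.Exports.
Set Implicit Arguments.
Unset Strict Implicit.
Unset Printing Implicit Defensive.
Local Open Scope ring_scope.

Local Notation Re := complex.Re.
Local Notation Im := complex.Im.

(** [Top_bounded] quantifies over every [p] with [is_proj], so the projection is handled differently
    in the two directions. For sufficiency [p] is given, and pairing it with the kernel at a point
    determines its value there. For necessity a projection has to be exhibited: for
    [w = conj mu x - c] it is an explicit multiple of the kernel at [x], which is checked by
    conjugating, since the conjugate of Q is again of the form of Q. The bound Re lam < 1/4 is what
    places e^Q times any kernel in L^2. Constants only affect the size of the bounds, provided that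
    they do not vanish. The delicate one is kappa(al) for complex al; its nonvanishing is obtained
    from the positivity of an integral. The linear conditions that arise are c mu = d, conj c = mu
    conj d and, with nu = 1 - lam, conj c / nu = conj (d / nu). They differ in general and agree
    once |mu| = 1, the only case in which the linear term matters. *)

Ltac cplx := repeat match goal with z : complex.complex _ |- _ => destruct z end;
  apply/eqP; rewrite eq_complex /=; apply/andP; split; apply/eqP.

(** * Modulus and exponential of complex numbers *)

Section ComplexModulus.
Context (R : realType).
Implicit Types (z w : R[i]).

Lemma cabsE z : cabs z = Normc.normc z.
Proof. by case: z. Qed.

Lemma cabsM z w : cabs (z * w) = cabs z * cabs w.
Proof. by rewrite !cabsE Normc.normcM. Qed.

Lemma cabsV z : cabs z^-1 = (cabs z)^-1.
Proof. by rewrite !cabsE Normc.normcV. Qed.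

Lemma cabsD z w : cabs (z + w) <= cabs z + cabs w.
Proof. by rewrite !cabsE le_normcD. Qed.

Lemma cabsN z : cabs (- z) = cabs z.
Proof. by rewrite !cabsE normcN. Qed.

Lemma cabs_ge0 z : 0 <= cabs z.
Proof. exact: sqrtr_ge0. Qed.

Lemma cabs0 : cabs (0 : R[i]) = 0.
Proof. by rewrite /cabs /= expr0n /= addr0 sqrtr0. Qed.

Lemma cabs1 : cabs (1 : R[i]) = 1.
Proof. by rewrite /cabs /= expr0n /= addr0 expr1n sqrtr1. Qed.

Lemma cabs_eq0 z : (cabs z == 0) = (z == 0).
Proof.
apply/eqP/eqP => [|->]; last exact: cabs0.
by rewrite cabsE; exact: Normc.eq0_normc.
Qed.

Lemma cabs_gt0 z : (0 < cabs z) = (z != 0).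
Proof. by rewrite lt_def cabs_eq0 cabs_ge0 andbT. Qed.

Lemma sqr_cabs z : cabs z ^+ 2 = Re z ^+ 2 + Im z ^+ 2.
Proof. by rewrite sqr_sqrtr// addr_ge0// sqr_ge0. Qed.

Lemma cabsR (x : R) : cabs x%:C%C = `|x|.
Proof. by rewrite /cabs /= expr0n /= addr0 sqrtr_sqr. Qed.

Lemma cabsJ z : cabs (conjc z) = cabs z.
Proof. by case: z => a b; rewrite /cabs /= sqrrN. Qed.

Lemma ReJ z : Re (conjc z) = Re z. Proof. by case: z. Qed.
Lemma ImJ z : Im (conjc z) = - Im z. Proof. by case: z. Qed.
Lemma ReDc z w : Re (z + w) = Re z + Re w. Proof. by case: z; case: w. Qed.
Lemma ImDc z w : Im (z + w) = Im z + Im w. Proof. by case: z; case: w. Qed.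
Lemma ReNc z : Re (- z) = - Re z. Proof. by case: z. Qed.
Lemma ImNc z : Im (- z) = - Im z. Proof. by case: z. Qed.
Lemma ReMc z w : Re (z * w) = Re z * Re w - Im z * Im w.
Proof. by case: z; case: w. Qed.
Lemma ImMc z w : Im (z * w) = Re z * Im w + Im z * Re w.
Proof. by case: z => a b; case: w => c d /=; rewrite addrC. Qed.

Lemma conjD z w : conjc (z + w) = conjc z + conjc w.
Proof. by cplx => //=; ring. Qed.
Lemma conjN z : conjc (- z) = - conjc z.
Proof. by cplx => //=; ring. Qed.
Lemma conjM z w : conjc (z * w) = conjc z * conjc w.
Proof. by cplx => //=; ring. Qed.
Lemma conjJ z : conjc (conjc z) = z.
Proof. by cplx => //=; ring. Qed.
Lemma conj2V : conjc (2^-1 : R[i]) = 2^-1.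
Proof. by rewrite conjc_inv (conjc_nat R 2). Qed.

Lemma mulJ z : z * conjc z = (cabs z ^+ 2)%:C%C.
Proof. by rewrite sqr_cabs; cplx => //=; ring. Qed.

Lemma Re_le_cabs z : `|Re z| <= cabs z.
Proof. by rewrite -sqrtr_sqr ler_wsqrtr// lerDl sqr_ge0. Qed.

Lemma Im_le_cabs z : `|Im z| <= cabs z.
Proof. by rewrite -sqrtr_sqr ler_wsqrtr// lerDr sqr_ge0. Qed.

Lemma cabs_le_ReIm z : cabs z <= `|Re z| + `|Im z|.
Proof.
rewrite -(@ler_pXn2r _ 2)// ?nnegrE ?cabs_ge0 ?addr_ge0//.
rewrite sqr_cabs sqrrD !real_normK ?num_real//.
by rewrite -addrA lerD2l lerDr pmulrn_lge0// mulr_ge0.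
Qed.

Lemma cexpD z w : cexp (z + w) = cexp z * cexp w.
Proof. by rewrite /cexp ReDc ImDc expRD cosD sinD; cplx => /=; ring. Qed.

Lemma cexp0 : cexp (0 : R[i]) = 1.
Proof. by rewrite /cexp /= expR0 cos0 sin0 mulr1 mulr0. Qed.

Lemma cabs_cexp z : cabs (cexp z) = expR (Re z).
Proof.
rewrite /cabs /cexp /= !exprMn -mulrDr cos2Dsin2 mulr1 sqrtr_sqr.
by rewrite ger0_norm// expR_ge0.
Qed.

Lemma cexp_neq0 z : cexp z != 0.
Proof. by rewrite -cabs_gt0 cabs_cexp expR_gt0. Qed.

Lemma conj_cexp z : conjc (cexp z) = cexp (conjc z).
Proof. by rewrite /cexp /= ReJ ImJ cosN sinN mulrN. Qed.

Lemma cexpR (x : R) : cexp x%:C%C = (expR x)%:C%C.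
Proof. by rewrite /cexp /= cos0 sin0 mulr1 mulr0. Qed.

Lemma sin_le_norm (x : R) : `|sin x| <= `|x|.
Proof.
wlog x0 : x / 0 < x.
  move=> h; have [x0|x0|->] := ltgtP x 0; last by rewrite sin0.
    by have := h (- x); rewrite sinN !normrN oppr_gt0; apply.
  exact: h.
have [c _] := @MVT _ (@sin R) (@cos R) 0 x x0 (fun y _ => is_derive_sin y)
  (continuous_subspaceT (@continuous_sin R)).
rewrite sin0 !subr0 => ->; rewrite normrM ler_piMl//.
by rewrite ler_norml cos_geN1 cos_le1.
Qed.

Lemma cosB1_le (x : R) : `|cos x - 1| <= x ^+ 2.
Proof.
have -> : cos x - 1 = - (2 * sin (x / 2) ^+ 2).
  by rewrite {1}[x](splitr x) cosD -!expr2 cos2sin2; ring.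
rewrite normrN normrM [`|2|]ger0_norm// normrX.
have := sin_le_norm (x / 2); rewrite normrM => h.
have h2 : `|sin (x / 2)| ^+ 2 <= (`|x| * `|2^-1|) ^+ 2.
  by rewrite ler_pXn2r// nnegrE.
rewrite exprMn [`|2^-1|]ger0_norm// [`|x| ^+ 2]real_normK ?num_real// in h2.
have := sqr_ge0 x; nra.
Qed.

Lemma sinB_le (x : R) : `|x| <= 1 -> `|sin x - x| <= x ^+ 2.
Proof.
wlog x0 : x / 0 < x.
  move=> h; have [x0|x0|->] := ltgtP x 0; [| |by rewrite sin0 subrr normr0 expr0n].
    by have := h (- x); rewrite sinN -opprD !normrN sqrrN oppr_gt0; apply.
  exact: h.
rewrite gtr0_norm// => x1.
have D (y : R) : is_derive y 1 (fun t => sin t - t) (cos y - 1).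
  by apply: is_deriveB.
have [|c] := @MVT _ (fun t : R => sin t - t) (fun y => cos y - 1) 0 x x0
  (fun y _ => D y).
  by apply: continuous_subspaceT => y; apply: cvgB; [exact: continuous_sin|exact: cvg_id].
rewrite in_itv /= => /andP[c0 cx]; rewrite sin0 !subr0 => ->.
rewrite normrM (gtr0_norm x0).
have := cosB1_le c; have := normr_ge0 (cos c - 1).
have : c ^+ 2 <= x ^+ 2 by rewrite ler_pXn2r ?nnegrE // ltW.
nra.
Qed.

(** The lower bound is the tangent inequality at [x]. The same inequality at [- x] gives e^x (1 - x)
    <= 1, hence e^x - 1 - x <= x^2 / (1 - x). *)
Lemma expRB_le (x : R) : `|x| <= 2^-1 -> `|expR x - 1 - x| <= 2 * x ^+ 2.
Proof.
rewrite ler_norml => /andP[h1 h2].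
have e1 := expR_ge1Dx x; have e2 := expR_ge1Dx (- x).
have e3 : expR x * expR (- x) = 1 by rewrite -expRD subrr expR0.
have e4 := expR_gt0 x; have e5 := expR_gt0 (- x).
rewrite ger0_norm; last by lra.
have : expR x * (1 - x) <= 1 by rewrite -[leRHS]e3 ler_pM2l.
nra.
Qed.

Lemma expRB1_le (x : R) : `|x| <= 2^-1 -> `|expR x - 1| <= 2 * `|x|.
Proof.
move=> h; have := expRB_le h.
have := ler_normD (expR x - 1 - x) x; rewrite subrK.
have : x ^+ 2 = `|x| * `|x| by rewrite -expr2 real_normK ?num_real.
have := normr_ge0 x; nra.
Qed.

(** A quadratic remainder with a crude constant suffices for the derivative of exp. The mixed term
    |a b| is absorbed into a^2 + b^2. *)
Lemma cexpB1_le z : cabs z <= 2^-1 -> cabs (cexp z - 1 - z) <= 8 * cabs z ^+ 2.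
Proof.
move=> hz; case: z hz => a b hz.
have ha := le_trans (Re_le_cabs _) hz; have hb := le_trans (Im_le_cabs _) hz.
rewrite /= in ha hb.
apply: le_trans (cabs_le_ReIm _) _; rewrite sqr_cabs /cexp /=.
have -> : expR a * cos b - 1 - a = (expR a - 1 - a) + expR a * (cos b - 1) by ring.
have -> : expR a * sin b - 0 - b = expR a * (sin b - b) + (expR a - 1) * b by ring.
have e1 := expRB_le ha; have e2 := expRB1_le ha; have e3 := cosB1_le b.
have e4 := @sinB_le b.
have e4' : `|sin b - b| <= b ^+ 2 by apply: e4; lra.
have e5 : `|expR a| <= 2.
  rewrite -[expR a](subrK 1); apply: (le_trans (ler_normD _ _)).
  by rewrite normr1; lra.
apply: (le_trans (lerD (ler_normD _ _) (ler_normD _ _))).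
rewrite !normrM.
have p1 : `|expR a| * `|cos b - 1| <= 2 * b ^+ 2 by apply: ler_pM.
have p2 : `|expR a| * `|sin b - b| <= 2 * b ^+ 2 by apply: ler_pM.
have p3 : `|expR a - 1| * `|b| <= 2 * `|a| * `|b| by apply: ler_pM.
have : 2 * `|a| * `|b| <= a ^+ 2 + b ^+ 2.
  rewrite -(real_normK (num_real a)) -(real_normK (num_real b)).
  have := sqr_ge0 (`|a| - `|b|); nra.
have := sqr_ge0 a; have := sqr_ge0 b; lra.
Qed.

End ComplexModulus.

(** * Pointwise complex differentiability *)

Section ComplexDifferentiability.
Context (R : realType).
Implicit Types (f g : R[i] -> R[i]) (z w : R[i]).

Definition ccont f z := forall e : R, 0 < e -> exists2 r : R, 0 < r &
  forall w, cabs (w - z) < r -> cabs (f w - f z) < e.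

(* Caratheodory's form of complex differentiability. *)
Definition cdiff f z := exists2 phi : R[i] -> R[i],
  forall w, f w = f z + phi w * (w - z) & ccont phi z.

Definition entire f := forall z, cdiff f z.

Lemma ccont_cst c z : ccont (fun=> c) z.
Proof. by move=> e e0; exists 1 => // w _; rewrite subrr cabs0. Qed.

Lemma ccont_id z : ccont id z.
Proof. by move=> e e0; exists e. Qed.

Lemma ccontD f g z : ccont f z -> ccont g z -> ccont (fun w => f w + g w) z.
Proof.
move=> hf hg e e0; have e2 : 0 < e / 2 by rewrite divr_gt0.
have [r r0 hr] := hf _ e2; have [s s0 hs] := hg _ e2.
exists (Num.min r s); first by rewrite lt_min r0.
move=> w; rewrite lt_min => /andP[/hr wr /hs ws].
have -> : f w + g w - (f z + g z) = (f w - f z) + (g w - g z) by ring.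
by apply: (le_lt_trans (cabsD _ _)); lra.
Qed.

Lemma ccontM f g z : ccont f z -> ccont g z -> ccont (fun w => f w * g w) z.
Proof.
move=> hf hg e e0.
set M := cabs (f z) + cabs (g z) + 1.
have M0 : 0 < M by rewrite ltr_wpDl// addr_ge0// cabs_ge0.
(* Since d <= 1, the product of the two increments is at most d, and the total change is at most d *
   M <= e / 2. *)
pose d := Num.min 1 (e / (2 * M)).
have d0 : 0 < d by rewrite lt_min ltr01 divr_gt0// mulr_gt0.
have [r r0 hr] := hf _ d0; have [s s0 hs] := hg _ d0.
exists (Num.min r s); first by rewrite lt_min r0.
move=> w; rewrite lt_min => /andP[/hr wr /hs ws].
have -> : f w * g w - f z * g z =
  (f w - f z) * (g w - g z) + f z * (g w - g z) + (f w - f z) * g z by ring.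
apply: (le_lt_trans (cabsD _ _)); rewrite !cabsM.
apply: (le_lt_trans (lerD (cabsD _ _) (lexx _))); rewrite !cabsM.
have d1 : d <= 1 by rewrite ge_min lexx.
have dM : d * (2 * M) <= e.
  by rewrite -ler_pdivlMr ?mulr_gt0// ge_min lexx orbT.
have a0 := cabs_ge0 (f w - f z); have b0 := cabs_ge0 (g w - g z).
have fz := cabs_ge0 (f z); have gz := cabs_ge0 (g z).
have : cabs (f w - f z) * cabs (g w - g z) <= d * 1.
  by apply: ler_pM => //; [exact: ltW|apply: ltW; apply: (lt_le_trans ws)].
have : cabs (f z) * cabs (g w - g z) <= cabs (f z) * d.
  by rewrite ler_wpM2l// ltW.
have : cabs (f w - f z) * cabs (g z) <= d * cabs (g z).
  by rewrite ler_wpM2r// ltW.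
rewrite /M in dM *; nra.
Qed.

Lemma ccont_comp f g z : ccont g z -> ccont f (g z) -> ccont (fun w => f (g w)) z.
Proof.
move=> hg hf e e0; have [r r0 hr] := hf _ e0; have [s s0 hs] := hg _ r0.
by exists s => // w /hs/hr.
Qed.

Lemma cdiff_ccont {f z} : cdiff f z -> ccont f z.
Proof.
move=> [phi hf hc].
have h : ccont (fun w => f z + phi w * (w - z)) z.
  apply: ccontD; first exact: ccont_cst.
  by apply: ccontM => //; apply: ccontD; [exact: ccont_id|exact: ccont_cst].
by move=> e /h[r r0 hr]; exists r => // w /hr; rewrite -!hf.
Qed.

Lemma cdiff_cst c z : cdiff (fun=> c) z.
Proof. by exists (fun=> 0); [move=> w; rewrite mul0r addr0|exact: ccont_cst]. Qed.

Lemma cdiff_id z : cdiff id z.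
Proof. by exists (fun=> 1); [move=> w; rewrite mul1r addrC subrK|exact: ccont_cst]. Qed.

Lemma cdiffD f g z : cdiff f z -> cdiff g z -> cdiff (fun w => f w + g w) z.
Proof.
move=> [p hp cp] [q hq cq]; exists (fun w => p w + q w); last exact: ccontD.
by move=> w; rewrite hp hq; ring.
Qed.

Lemma cdiffM f g z : cdiff f z -> cdiff g z -> cdiff (fun w => f w * g w) z.
Proof.
move=> df dg; have cg := cdiff_ccont dg; case: df dg => p hp cp [q hq cq].
exists (fun w => p w * g w + f z * q w).
  by move=> w; rewrite (hp w) (hq w); ring.
by apply: ccontD; apply: ccontM => //; exact: ccont_cst.
Qed.

Lemma cdiff_comp f g z : cdiff g z -> cdiff f (g z) -> cdiff (fun w => f (g w)) z.
Proof.
move=> dg [p hp cp]; have cg := cdiff_ccont dg; case: dg => q hq cq.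
exists (fun w => p (g w) * q w).
  by move=> w; rewrite hp {2}(hq w); ring.
by apply: ccontM => //; exact: ccont_comp.
Qed.

(** Links Caratheodory's form to the limit in [separately_holomorphic]: [phi] is the difference
    quotient, completed at z by the derivative L. *)
Lemma cdiffP f z : (exists L : R[i], forall e : R, 0 < e -> exists2 r : R, 0 < r &
   forall h : R[i], h != 0 -> cabs h < r ->
     cabs ((f (z + h) - f z) / h - L) < e) <-> cdiff f z.
Proof.
split=> [[L hL]|[phi hf hc]].
  exists (fun w => if w == z then L else (f w - f z) / (w - z)).
    move=> w; case: eqVneq => [->|wz]; first by rewrite subrr mulr0 addr0.
    by rewrite divfK ?subr_eq0// addrC subrK.
  move=> e e0; have [r r0 hr] := hL _ e0; exists r => // w wr; rewrite eqxx.
  case: eqVneq => [_|wz]; first by rewrite subrr cabs0.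
  by have := hr (w - z); rewrite subr_eq0 [z + _]addrC subrK; apply.
exists (phi z) => e /hc[r r0 hr]; exists r => // h h0 hhr.
rewrite (hf (z + h)) addrAC subrr add0r addrAC subrr add0r mulfK//.
by apply: hr; rewrite addrAC subrr add0r.
Qed.

Lemma cdiff_cexp z : cdiff (@cexp R) z.
Proof.
apply/cdiffP; exists (cexp z) => e e0.
pose K := cabs (cexp z).
have K0 : 0 < K by rewrite cabs_gt0 cexp_neq0.
(* 1/2 is the range of [cexpB1_le]; the second bound makes the remainder 8 K |h| smaller than e. *)
exists (Num.min 2^-1 (e / (8 * K))).
  by rewrite lt_min invr_gt0 ltr0n divr_gt0// mulr_gt0.
move=> h h0; rewrite lt_min ltr_pdivlMr ?mulr_gt0// => /andP[h1 h2].
have -> : (cexp (z + h) - cexp z) / h - cexp z = cexp z * (cexp h - 1 - h) / h.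
  by rewrite cexpD; field.
have hp : 0 < cabs h by rewrite cabs_gt0.
rewrite !cabsM cabsV ltr_pdivrMr//.
have := cexpB1_le (ltW h1); rewrite -/K; nra.
Qed.

(* The Cauchy-Riemann equations are built in: the differential is multiplication by A + iB. *)
Lemma cdiff_real f z : cdiff f z -> exists A B : R, forall e : R, 0 < e ->
  exists2 r : R, 0 < r & forall w, cabs (w - z) < r ->
   `|Re (f w) - Re (f z) - (A * (Re w - Re z) - B * (Im w - Im z))| <= e * cabs (w - z) /\
   `|Im (f w) - Im (f z) - (B * (Re w - Re z) + A * (Im w - Im z))| <= e * cabs (w - z).
Proof.
move=> [phi hf hc]; exists (Re (phi z)), (Im (phi z)) => e /hc[r r0 hr].
exists r => // w wr; set D := (phi w - phi z) * (w - z).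
have hD : cabs D <= e * cabs (w - z).
  by rewrite cabsM ler_wpM2r ?cabs_ge0// ltW// hr.
have fE : f w - f z - phi z * (w - z) = D by rewrite hf /D; ring.
split; apply: (le_trans _ hD).
  rewrite (le_trans _ (Re_le_cabs _))// -fE !(ReDc, ReNc, ReMc, ImDc, ImNc).
  by rewrite le_eqVlt; apply/orP; left; apply/eqP; congr `|_|; ring.
rewrite (le_trans _ (Im_le_cabs _))// -fE !(ReDc, ReNc, ImMc, ImDc, ImNc).
by rewrite le_eqVlt; apply/orP; left; apply/eqP; congr `|_|; ring.
Qed.

End ComplexDifferentiability.

(** * Integrals of continuous functions over segments *)

Section IntervalIntegral.
Context (R : realType).
Local Notation leb := (@lebesgue_measure R).
Implicit Types (f g : R -> R) (a b m : R).

Definition itvint f a b : R := (\int[leb]_(x in `[a, b]) f x)%R.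

Lemma cont_integrable f a b : continuous f ->
  leb.-integrable `[a, b] (EFin \o f).
Proof.
move=> cf; apply: continuous_compact_integrable; first exact: segment_compact.
exact: continuous_subspaceT.
Qed.

Lemma itvint_add f a m b : continuous f -> a <= m -> m <= b ->
  itvint f a b = itvint f a m + itvint f m b.
Proof.
move=> cf am mb; rewrite /itvint.
have := @Rintegral_itvB R f (BLeft a) (BRight b) m (@cont_integrable f a b cf).
rewrite !bnd_simp => /(_ am mb) h.
have imb : leb.-integrable `]m, b] (EFin \o f).
  apply: (integrableS _ _ _ (@cont_integrable f m b cf)) => //.
  by apply: subset_itvr; rewrite bnd_simp.
by rewrite -(Rintegral_itv_obnd_cbnd imb) -h addrC subrK.
Qed.

Lemma itvintB f g a b : continuous f -> continuous g ->
  itvint (fun x => f x - g x) a b = itvint f a b - itvint g a b.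
Proof.
by move=> cf cg; rewrite /itvint RintegralB//; exact: cont_integrable.
Qed.

Lemma itvint_cst (r : R) a b : a <= b -> itvint (fun=> r) a b = r * (b - a).
Proof.
move=> ab; rewrite /itvint Rintegral_cst//; congr (_ * _).
transitivity (fine (leb `[a, b]%classic)); first by [].
rewrite lebesgue_measure_itv /= lte_fin.
case: ltP => //= ba; have -> : a = b by apply/le_anti; rewrite ab.
by rewrite subrr.
Qed.

Lemma itvint_bound f a b (M : R) : continuous f -> a <= b ->
  (forall x, a <= x <= b -> `|f x| <= M) -> `|itvint f a b| <= M * (b - a).
Proof.
move=> cf ab h; apply: le_trans (le_normr_Rintegral _ _) _ => //.
  exact: cont_integrable.
rewrite -(itvint_cst _ ab); apply: le_Rintegral => //.
- by apply: (@cont_integrable (fun x => `|f x|)) => x; apply: cvg_norm; exact: cf.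
- by apply: (@cont_integrable (fun=> M)) => x; exact: cvg_cst.
Qed.

End IntervalIntegral.

(** * Goursat's theorem for closed 1-forms on rectangles *)

Section Goursat.
Context (R : realType).

(** Every right endpoint bounds all left endpoints from above, so the supremum of the left endpoints
    lies in every interval. *)
Lemma nested_intervals (a : nat -> R) (L : R) : 0 <= L ->
  (forall k, a k <= a k.+1 /\ a k.+1 + L / 2 ^+ k.+1 <= a k + L / 2 ^+ k) ->
  exists x, forall k, a k <= x <= a k + L / 2 ^+ k.
Proof.
move=> L0 h.
have L2 k : 0 <= L / 2 ^+ k by rewrite divr_ge0// exprn_ge0.
have up j k : (j <= k)%N -> a j <= a k.
  elim: k => [|k IH]; first by rewrite leqn0 => /eqP->.
  rewrite leq_eqVlt => /orP[/eqP->//|]; rewrite ltnS => /IH jk.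
  by apply: (le_trans jk); case: (h k).
have dn j k : (j <= k)%N -> a k + L / 2 ^+ k <= a j + L / 2 ^+ j.
  elim: k => [|k IH]; first by rewrite leqn0 => /eqP->.
  rewrite leq_eqVlt => /orP[/eqP->//|]; rewrite ltnS => /IH jk.
  by apply: (le_trans _ jk); case: (h k).
have ub k : ubound (range a) (a k + L / 2 ^+ k).
  move=> _ [j _ <-]; have [jk|/ltnW kj] := leqP j k.
    by apply: (le_trans (up _ _ jk)); rewrite lerDl.
  by apply: (le_trans _ (dn _ _ kj)); rewrite lerDl.
exists (sup (range a)) => k; apply/andP; split.
  by apply: ub_le_sup; [exists (a 0%N + L / 2 ^+ 0); exact: ub|exists k].
by apply: ge_sup; [exists (a k); exists k|exact: ub].
Qed.

Lemma ex_half_lt (C r : R) : 0 <= C -> 0 < r -> exists k, C / 2 ^+ k < r.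
Proof.
move=> C0 r0; exists (Num.bound (C / r)).
rewrite ltr_pdivrMr ?exprn_gt0// mulrC -ltr_pdivrMr//.
apply: lt_trans (archi_boundP _) _; first by rewrite divr_ge0// ltW.
by rewrite -natrX ltr_nat ltn_expl.
Qed.

Variables P Q : R -> R -> R.
Hypothesis cP : forall y, continuous (P ^~ y).
Hypothesis cQ : forall x, continuous (Q x).
(* q1 = p2 at each point: the 1-form P dx + Q dy is closed. *)
Hypothesis closedPQ : forall x0 y0, exists p1 p2 q2 : R, forall e, 0 < e ->
  exists2 r, 0 < r & forall x y, `|x - x0| + `|y - y0| < r ->
   `|P x y - P x0 y0 - (p1 * (x - x0) + p2 * (y - y0))|
      <= e * (`|x - x0| + `|y - y0|) /\
   `|Q x y - Q x0 y0 - (p2 * (x - x0) + q2 * (y - y0))|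
      <= e * (`|x - x0| + `|y - y0|).

(** The integral of P dx + Q dy counterclockwise around the boundary of [a, b] x [c, d], with
    opposite edges paired. *)
Let J a b c d := itvint (fun x => P x c - P x d) a b +
                 itvint (fun y => Q b y - Q a y) c d.

Let cPB c d : continuous (fun x => P x c - P x d).
Proof. by move=> x; apply: cvgB; exact: cP. Qed.

Let cQB a b : continuous (fun y => Q b y - Q a y).
Proof. by move=> x; apply: cvgB; exact: cQ. Qed.

(** The inner edges are traversed twice, in opposite directions, and cancel. *)
Let J_split a m b c k d : a <= m -> m <= b -> c <= k -> k <= d ->
  J a b c d = J a m c k + J m b c k + J a m k d + J m b k d.
Proof.
move=> am mb ck kd; rewrite /J !itvintB//; try exact: cP; try exact: cQ.
have e1 y := @itvint_add R (P ^~ y) a m b (cP (y := y)) am mb.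
have e2 x := @itvint_add R (Q x) c k d (cQ (x := x)) ck kd.
rewrite !e1 !e2; ring.
Qed.

(** The bound is quadratic in the half-perimeter, so halving both sides divides it by 4, exactly as
    cutting into four quarters divides the circulation. *)
Let bad (e : R) a b c d := e * ((b - a) + (d - c)) ^+ 2 < `|J a b c d|.

(** If all four quarters obeyed the bound, adding the four estimates would give it for the whole
    rectangle. *)
Let bad_quarter e a c w h : 0 <= w -> 0 <= h -> bad e a (a + w) c (c + h) ->
  exists q : R * R, bad e q.1 (q.1 + w / 2) q.2 (q.2 + h / 2) /\
   [/\ a <= q.1, q.1 + w / 2 <= a + w, c <= q.2 & q.2 + h / 2 <= c + h].
Proof.
move=> w0 h0 hb.
have w2 : 0 <= w / 2 by rewrite divr_ge0.
have h2 : 0 <= h / 2 by rewrite divr_ge0.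
have ea : a + w / 2 + w / 2 = a + w by rewrite -addrA -splitr.
have ec : c + h / 2 + h / 2 = c + h by rewrite -addrA -splitr.
apply: contrapT => nex.
have nb q1 q2 : a <= q1 -> q1 + w / 2 <= a + w -> c <= q2 -> q2 + h / 2 <= c + h ->
    `|J q1 (q1 + w / 2) q2 (q2 + h / 2)| <= e * (w / 2 + h / 2) ^+ 2.
  move=> ? ? ? ?; rewrite leNgt; apply/negP => hlt; apply: nex.
  exists (q1, q2); split => //; rewrite /bad /=.
  suff -> : q1 + w / 2 - q1 + (q2 + h / 2 - q2) = w / 2 + h / 2 by [].
  ring.
have la : a <= a + w / 2 by rewrite lerDl.
have lc : c <= c + h / 2 by rewrite lerDl.
have lw : a + w / 2 <= a + w by rewrite -ea lerDl.
have lh : c + h / 2 <= c + h by rewrite -ec lerDl.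
have lw' : a + w / 2 + w / 2 <= a + w by rewrite ea.
have lh' : c + h / 2 + h / 2 <= c + h by rewrite ec.
move: (nb a c (lexx _) lw (lexx _) lh) (nb _ c la lw' (lexx _) lh)
  (nb a _ (lexx _) lw lc lh') (nb _ _ la lw' lc lh').
move: hb; rewrite /bad -ea -ec (@J_split _ (a + w / 2) _ _ (c + h / 2)) ?lerDl//.
set j1 := J _ _ _ _; set j2 := J _ _ _ _; set j3 := J _ _ _ _; set j4 := J _ _ _ _.
move=> + b1 b2 b3 b4; apply/negP; rewrite -leNgt.
have -> : a + w / 2 + w / 2 - a + (c + h / 2 + h / 2 - c) = 2 * (w / 2 + h / 2).
  by field.
rewrite exprMn; apply: (le_trans (ler_normD _ _)).
have := ler_normD (j1 + j2) j3; have := ler_normD j1 j2.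
move: b1 b2 b3 b4; set s := (_ + _) ^+ 2; lra.
Qed.

(** The affine part of a closed form has circulation zero: its contributions - p2 h w and p2 w h
    cancel. They are subtracted from the integrands, and what remains is a difference of two errors
    at opposite edges, each at most e (w + h). *)
Let flat e a c w h x0 y0 p1 p2 q2 : 0 <= w -> 0 <= h ->
  a <= x0 <= a + w -> c <= y0 <= c + h ->
  (forall x y, `|x - x0| + `|y - y0| <= w + h ->
   `|P x y - P x0 y0 - (p1 * (x - x0) + p2 * (y - y0))| <= e * (w + h) /\
   `|Q x y - Q x0 y0 - (p2 * (x - x0) + q2 * (y - y0))| <= e * (w + h)) ->
  `|J a (a + w) c (c + h)| <= (2 * e) * (w + h) ^+ 2.
Proof.
move=> w0 h0 /andP[x1 x2] /andP[y1 y2] hPQ.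
have aw : a <= a + w by lra.
have ch : c <= c + h by lra.
have -> : J a (a + w) c (c + h) =
  itvint (fun x => P x c - P x (c + h) - - (p2 * h)) a (a + w) +
  itvint (fun y => Q (a + w) y - Q a y - p2 * w) c (c + h).
  have cc (r : R) : continuous (fun _ : R => r) by move=> x; exact: cvg_cst.
  rewrite (@itvintB R (fun x => P x c - P x (c + h)) (fun=> - (p2 * h)))//.
  rewrite (@itvintB R (fun y => Q (a + w) y - Q a y) (fun=> p2 * w))//.
  by rewrite !itvint_cst// /J; ring.
apply: (le_trans (ler_normD _ _)).
have cc (f : R -> R) (r : R) : continuous f -> continuous (fun x => f x - r).
  by move=> cf x; apply: cvgB; [exact: cf|exact: cvg_cst].
have b1 : `|itvint (fun x => P x c - P x (c + h) - - (p2 * h)) a (a + w)|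
    <= (2 * e * (w + h)) * (a + w - a).
  apply: itvint_bound => //; first exact: (cc (fun x => P x c - P x (c + h))).
  move=> x /andP[xa xw].
  have ax : `|x - x0| <= w by rewrite ler_norml; apply/andP; split; lra.
  have [|h1 _] := hPQ x c.
    by apply: lerD => //; rewrite ler_norml; apply/andP; split; lra.
  have [|h2 _] := hPQ x (c + h).
    by apply: lerD => //; rewrite ler_norml; apply/andP; split; lra.
  have -> : P x c - P x (c + h) - - (p2 * h) =
    (P x c - P x0 y0 - (p1 * (x - x0) + p2 * (c - y0))) -
    (P x (c + h) - P x0 y0 - (p1 * (x - x0) + p2 * (c + h - y0))) by ring.
  apply: (le_trans (ler_normB _ _)); lra.
have b2 : `|itvint (fun y => Q (a + w) y - Q a y - p2 * w) c (c + h)|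
    <= (2 * e * (w + h)) * (c + h - c).
  apply: itvint_bound => //; first exact: (cc (fun y => Q (a + w) y - Q a y)).
  move=> y /andP[ya yw].
  have ay : `|y - y0| <= h by rewrite ler_norml; apply/andP; split; lra.
  have [|_ h1] := hPQ (a + w) y.
    by apply: lerD => //; rewrite ler_norml; apply/andP; split; lra.
  have [|_ h2] := hPQ a y.
    by apply: lerD => //; rewrite ler_norml; apply/andP; split; lra.
  have -> : Q (a + w) y - Q a y - p2 * w =
    (Q (a + w) y - Q x0 y0 - (p2 * (a + w - x0) + q2 * (y - y0))) -
    (Q a y - Q x0 y0 - (p2 * (a - x0) + q2 * (y - y0))) by ring.
  apply: (le_trans (ler_normB _ _)); lra.
have -> : 2 * e * (w + h) ^+ 2 =
  (2 * e * (w + h)) * (a + w - a) + (2 * e * (w + h)) * (c + h - c) by ring.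
exact: lerD.
Qed.

Lemma goursat_rect a c w h : 0 <= w -> 0 <= h ->
  itvint (fun x => P x c - P x (c + h)) a (a + w) +
  itvint (fun y => Q (a + w) y - Q a y) c (c + h) = 0.
Proof.
move=> w0 h0; rewrite -[LHS]/(J a (a + w) c (c + h)).
apply/eqP; apply: contrapT => /negP J0.
(* Chosen so that the initial rectangle is bad; the [+ 1] keeps the denominator positive for a
   degenerate rectangle. *)
pose e := `|J a (a + w) c (c + h)| / (2 * ((w + h) ^+ 2 + 1)).
have J0' : 0 < `|J a (a + w) c (c + h)| by rewrite normr_gt0.
have s0 := sqr_ge0 (w + h).
have e0 : 0 < e by rewrite divr_gt0// mulr_gt0// ltr_wpDl.
have he : e * (2 * ((w + h) ^+ 2 + 1)) = `|J a (a + w) c (c + h)|.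
  by rewrite /e divfK// lt0r_neq0// mulr_gt0// ltr_wpDl.
have bad0 : bad e a (a + w) c (c + h).
  rewrite /bad -he; have -> : a + w - a + (c + h - c) = w + h by ring.
  nra.
pose W k := w / 2 ^+ k; pose H k := h / 2 ^+ k.
have WS k : W k.+1 = W k / 2.
  by rewrite /W exprS invfM [2^-1 * _]mulrC mulrA.
have HS k : H k.+1 = H k / 2.
  by rewrite /H exprS invfM [2^-1 * _]mulrC mulrA.
have W0 k : 0 <= W k by rewrite divr_ge0// exprn_ge0.
have H0 k : 0 <= H k by rewrite divr_ge0// exprn_ge0.
pose B k (p : R * R) := bad e p.1 (p.1 + W k) p.2 (p.2 + H k).
(* The choice function takes the depth k along with the corner, as the side lengths [W k] and [H k]
   depend on it. *)
have /choice[step hstep] : forall kp : nat * (R * R), exists q : R * R,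
    B kp.1 kp.2 -> B kp.1.+1 q /\ [/\ kp.2.1 <= q.1,
      q.1 + W kp.1.+1 <= kp.2.1 + W kp.1, kp.2.2 <= q.2 &
      q.2 + H kp.1.+1 <= kp.2.2 + H kp.1].
  move=> [k p] /=; have [Bp|nB] := pselect (B k p); last by exists p.
  have [q [Bq hq]] := bad_quarter (W0 k) (H0 k) Bp.
  by exists q => _; rewrite /B WS HS.
pose S := fix S k : R * R := if k is k'.+1 then step (k', S k') else (a, c).
have BS k : B k (S k).
  elim: k => [|k IH] /=; first by rewrite /B /W /H /= expr0 !divr1.
  by have [] := hstep (k, S k) IH.
have sS k := (hstep (k, S k) (BS k)).2.
have [x0 hx] : exists x, forall k, (S k).1 <= x <= (S k).1 + w / 2 ^+ k.
  by apply: (@nested_intervals (fun k => (S k).1)) => // k; case: (sS k).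
have [y0 hy] : exists x, forall k, (S k).2 <= x <= (S k).2 + h / 2 ^+ k.
  by apply: (@nested_intervals (fun k => (S k).2)) => // k; case: (sS k).
have [p1 [p2 [q2 D]]] := closedPQ x0 y0.
(* [flat] doubles the error, so e / 2 yields exactly the bound that contradicts badness. *)
have e2 : 0 < e / 2 by rewrite divr_gt0.
have [r r0 hr] := D _ e2.
have [k hk] := @ex_half_lt (w + h) r (addr_ge0 w0 h0) r0.
rewrite mulrDl -/(W k) -/(H k) in hk.
have := @flat (e / 2) (S k).1 (S k).2 (W k) (H k) x0 y0 p1 p2 q2 (W0 k) (H0 k)
  (hx k) (hy k).
have := BS k; rewrite /B /bad.
have -> : (S k).1 + W k - (S k).1 + ((S k).2 + H k - (S k).2) = W k + H k by ring.
have -> : 2 * (e / 2) = e by field.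
move=> lt1 le1; apply/negP: lt1; rewrite -leNgt; apply: le1 => x y hxy.
have [hP hQ] := hr x y (le_lt_trans hxy hk).
have e2' := ltW e2.
by split; [apply: (le_trans hP)|apply: (le_trans hQ)]; rewrite ler_wpM2l.
Qed.

End Goursat.

(** * Mean value property on circles *)

Section CircleMean.
Context (R : realType).

Lemma ccont_continuous (f : R[i] -> R[i]) (u v : R -> R) :
  (forall z, ccont f z) -> continuous u -> continuous v ->
  continuous (fun t => Re (f (Complex (u t) (v t)))).
Proof.
move=> cf cu cv t; apply/cvgrPdist_lt => e e0.
have [r r0 hr] := cf (Complex (u t) (v t)) _ e0.
have r2 : 0 < r / 2 by rewrite divr_gt0.
have := cu t; move/cvgrPdist_lt => /(_ _ r2) hu.
have := cv t; move/cvgrPdist_lt => /(_ _ r2) hv.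
near=> s.
rewrite distrC -ReNc -ReDc; apply: (le_lt_trans (Re_le_cabs _)); apply: hr.
apply: (le_lt_trans (cabs_le_ReIm _)); rewrite /= [`|u _ - _|]distrC [`|v _ - _|]distrC.
rewrite [r]splitr; apply: ltrD; near: s; [exact: hu|exact: hv].
Unshelve. all: by end_near.
Qed.

(** In the coordinate w the real part is the logarithm of the radius up to a shift. Goursat makes
    the mean independent of it, and as it tends to minus infinity the circle shrinks to 0, where
    continuity of F gives the value. *)
Lemma circle_mean_Re (F : R[i] -> R[i]) (z : R[i]) : entire F ->
  itvint (fun t => Re (F (z * cexp (Complex 0 t)))) 0 (pi *+ 2) =
  (pi *+ 2) * Re (F 0).
Proof.
move=> eF.
pose G w := F (z * cexp w).
have eG : entire G.
  move=> w; apply: cdiff_comp; last exact: eF.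
  by apply: cdiffM; [exact: cdiff_cst|exact: cdiff_cexp].
have cG w : ccont G w := cdiff_ccont (eG w).
(* Im G = Re (- i G), so that results on real parts also cover imaginary parts. *)
pose G' w := (- 'i%C) * G w.
have cG' w : ccont G' w by apply: ccontM => //; exact: ccont_cst.
have ImG w : Im (G w) = Re (G' w) by rewrite /G' ReMc /= ; ring.
have cid : continuous (fun x : R => x) by move=> x; exact: cvg_id.
have ccst (r : R) : continuous (fun _ : R => r) by move=> x; exact: cvg_cst.
pose U x y := Re (G (Complex x y)); pose V x y := Im (G (Complex x y)).
have pi2 : 0 <= (pi : R) *+ 2 by rewrite mulrn_wge0// pi_ge0.
have cU x : continuous (U x) by exact: ccont_continuous.
have cV y : continuous (V ^~ y).
  by rewrite /V; under eq_fun do rewrite ImG; exact: ccont_continuous.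
(* The horizontal edges cancel by the 2 pi i periodicity of exp. *)
have Vz : (fun t => V t 0 - V t (pi *+ 2)) = fun=> 0.
  apply/funext => t; rewrite /V /G /cexp /= cos0 sin0.
  by rewrite -[_ *+ 2]add0r cosD2pi sinD2pi cos0 sin0 subrr.
(* The imaginary part of G dw is V dx + U dy, and it is closed by the Cauchy-Riemann equation V_y =
   U_x = A. *)
have closedVU x0 y0 : exists p1 p2 q2 : R, forall e, 0 < e ->
  exists2 r, 0 < r & forall x y, `|x - x0| + `|y - y0| < r ->
   `|V x y - V x0 y0 - (p1 * (x - x0) + p2 * (y - y0))|
      <= e * (`|x - x0| + `|y - y0|) /\
   `|U x y - U x0 y0 - (p2 * (x - x0) + q2 * (y - y0))|
      <= e * (`|x - x0| + `|y - y0|).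
  have [A [B hAB]] := cdiff_real (eG (Complex x0 y0)).
  exists B, A, (- B) => e e0; have [r r0 hr] := hAB _ e0.
  exists r => // x1 y1 hxy.
  have hd : cabs (Complex x1 y1 - Complex x0 y0) <= `|x1 - x0| + `|y1 - y0|.
    exact: cabs_le_ReIm.
  have [h1 h2] := hr _ (le_lt_trans hd hxy); have {}e0 := ltW e0.
  split; first by apply: (le_trans h2); rewrite ler_wpM2l.
  by rewrite mulNr; apply: (le_trans h1); rewrite ler_wpM2l.
have mean_cst x w : 0 <= w ->
    itvint (U (x + w)) 0 (pi *+ 2) = itvint (U x) 0 (pi *+ 2).
  move=> w0; have xw : x <= x + w by rewrite lerDl.
  have := @goursat_rect R V U cV cU closedVU x 0 w (pi *+ 2) w0 pi2.
  rewrite add0r Vz (itvint_cst 0 xw) mul0r add0r (itvintB _ _ (cU (x + w)) (cU x)).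
  by move/eqP; rewrite subr_eq0 => /eqP.
have -> : itvint (fun t => Re (F (z * cexp (Complex 0 t)))) 0 (pi *+ 2) =
  itvint (U 0) 0 (pi *+ 2) by [].
apply/eqP; rewrite -subr_eq0 -normr_le0; apply/ler_addgt0Pr => e e0; rewrite add0r.
pose e' := e / (pi *+ 2 + 1).
have e'0 : 0 < e' by rewrite divr_gt0// ltr_wpDl.
have [r r0 hr] := cdiff_ccont (eF 0) e'0.
(* For s large the circle of radius |z| e^(-s) lies in the disc of radius r. *)
have [s s0 hs] : exists2 s : R, 0 <= s & cabs z * expR (- s) < r.
  exists (cabs z / r); first by rewrite divr_ge0 ?cabs_ge0// ltW.
  rewrite expRN -ltr_pdivlMr ?invr_gt0 ?expR_gt0// invrK mulrC -ltr_pdivrMr//.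
  by apply: lt_le_trans (expR_ge1Dx _); rewrite ltrDr.
have -> : itvint (U 0) 0 (pi *+ 2) = itvint (U (- s)) 0 (pi *+ 2).
  by have := mean_cst (- s) s s0; rewrite addNr.
have -> : (pi *+ 2) * Re (F 0) = itvint (fun=> Re (F 0)) 0 (pi *+ 2).
  by rewrite itvint_cst// subr0 mulrC.
rewrite -(itvintB _ _ (cU (- s)) (ccst (Re (F 0)))).
apply: le_trans (itvint_bound (M := e') _ pi2 _) _.
- by move=> x; apply: cvgB; [exact: cU|exact: cvg_cst].
- move=> t _; rewrite /U -ReNc -ReDc; apply: (le_trans (Re_le_cabs _)).
  apply: ltW; apply: hr; rewrite subr0 cabsM cabs_cexp //=.
- have d : (pi : R) *+ 2 / (pi *+ 2 + 1) <= 1.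
    by rewrite ler_pdivrMr ?ltr_wpDl// mul1r lerDl.
  by rewrite subr0 /e' -mulrA [_^-1 * _]mulrC -[leRHS]mulr1 ler_wpM2l// ltW.
Qed.

End CircleMean.

(** * Measurability of complex functions *)

Section ComplexMeasurable.
Context d (T : measurableType d) (R : realType).
Implicit Types (f g : T -> R[i]).

(** [cmeasurable] over an arbitrary measurable space, since slices and products occur as well as
    [Cn]. *)
Definition cmeas f := measurable_fun setT (fun x => Re (f x)) /\
  measurable_fun setT (fun x => Im (f x)).

Lemma cmeas_cst c : cmeas (fun=> c).
Proof. by split; exact: measurable_cst. Qed.

Lemma cmeasD f g : cmeas f -> cmeas g -> cmeas (fun x => f x + g x).
Proof.
move=> [f1 f2] [g1 g2]; split.
  by under eq_fun do rewrite ReDc; exact: measurable_funD.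
by under eq_fun do rewrite ImDc; exact: measurable_funD.
Qed.

Lemma cmeasM f g : cmeas f -> cmeas g -> cmeas (fun x => f x * g x).
Proof.
move=> [f1 f2] [g1 g2]; split.
  by under eq_fun do rewrite ReMc; apply: measurable_funB; exact: measurable_funM.
by under eq_fun do rewrite ImMc; apply: measurable_funD; exact: measurable_funM.
Qed.

Lemma cmeasN f : cmeas f -> cmeas (fun x => - f x).
Proof.
move=> [f1 f2]; split.
  by under eq_fun do rewrite ReNc; exact: measurableT_comp.
by under eq_fun do rewrite ImNc; exact: measurableT_comp.
Qed.

Lemma cmeasJ f : cmeas f -> cmeas (fun x => conjc (f x)).
Proof.
move=> [f1 f2]; split; first by under eq_fun do rewrite ReJ.
by under eq_fun do rewrite ImJ; exact: measurableT_comp.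
Qed.

Lemma cmeasR (f : T -> R) : measurable_fun setT f -> cmeas (fun x => (f x)%:C%C).
Proof. by move=> mf; split => //; exact: measurable_cst. Qed.

Lemma cmeas_complex (u v : T -> R) : measurable_fun setT u -> measurable_fun setT v ->
  cmeas (fun x => Complex (u x) (v x)).
Proof. by []. Qed.

Lemma cmeas_cexp f : cmeas f -> cmeas (fun x => cexp (f x)).
Proof.
move=> [f1 f2]; split; rewrite /cexp /=; apply: measurable_funM.
- exact: measurableT_comp f1.
- exact: measurableT_comp (continuous_measurable_fun (@continuous_cos R)) f2.
- exact: measurableT_comp f1.
- exact: measurableT_comp (continuous_measurable_fun (@continuous_sin R)) f2.
Qed.

Lemma cmeas_sum (I : Type) (r : seq I) (F : I -> T -> R[i]) :
  (forall i, cmeas (F i)) -> cmeas (fun x => \sum_(i <- r) F i x).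
Proof.
move=> h; elim: r => [|i r IH].
  by under eq_fun do rewrite big_nil; exact: cmeas_cst.
by under eq_fun do rewrite big_cons; exact: cmeasD.
Qed.

Lemma measurable_cabs f : cmeas f -> measurable_fun setT (fun x => cabs (f x)).
Proof.
move=> [f1 f2]; apply: (measurableT_comp (continuous_measurable_fun (@sqrt_continuous R))).
by apply: measurable_funD; exact: measurable_funX.
Qed.

End ComplexMeasurable.

Lemma cmeas_comp d d' (T : measurableType d) (T' : measurableType d') (R : realType)
  (f : T' -> R[i]) (phi : T -> T') : measurable_fun setT phi -> cmeas f ->
  cmeas (fun x => f (phi x)).
Proof.
by move=> mphi [f1 f2]; split; [exact: measurableT_comp f1 mphi|exact: measurableT_comp f2 mphi].
Qed.

(** * Integration of complex functions *)

Section ComplexIntegral.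
Context d (T : measurableType d) (R : realType) (mu : {measure set T -> \bar R}).
Implicit Types (f g : T -> R[i]).

Definition cint f : R[i] := Complex (Rintegral mu setT (fun x => Re (f x)))
   (Rintegral mu setT (fun x => Im (f x))).

Definition cintble f := mu.-integrable setT (EFin \o (fun x => Re (f x))) /\
  mu.-integrable setT (EFin \o (fun x => Im (f x))).

Lemma cintble_meas f : cintble f -> cmeas f.
Proof.
by move=> [/measurable_int f1 /measurable_int f2]; split; apply/measurable_EFinP.
Qed.

Lemma cintbleP f : cmeas f ->
  cintble f <-> (\int[mu]_x (cabs (f x))%:E < +oo)%E.
Proof.
move=> mf; have mc := measurable_cabs mf; case: (mf) => f1 f2; split.
  move=> [i1 i2].
  have i3 : mu.-integrable setT (EFin \o (fun x => `|Re (f x)| + `|Im (f x)|)).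
    rewrite (_ : EFin \o _ = (abse \o (EFin \o (fun x => Re (f x)))) \+
                             (abse \o (EFin \o (fun x => Im (f x)))))%E //.
    by apply: integrableD => //; exact: integrable_abse.
  have /integrableP[_] : mu.-integrable setT (EFin \o (fun x => cabs (f x))).
    apply: le_integrable i3 => //; first exact/measurable_EFinP.
    move=> x _ /=; rewrite lee_fin ger0_norm ?cabs_ge0//.
    by rewrite ger0_norm ?addr_ge0// cabs_le_ReIm.
  by under eq_integral do rewrite /= ger0_norm ?cabs_ge0//.
move=> h.
have i : mu.-integrable setT (EFin \o (fun x => cabs (f x))).
  apply/integrableP; split; first exact/measurable_EFinP.
  by under eq_integral do rewrite /= ger0_norm ?cabs_ge0//.
split; apply: le_integrable i => //; try exact/measurable_EFinP.
  by move=> x _ /=; rewrite lee_fin [leRHS]ger0_norm ?cabs_ge0// Re_le_cabs.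
by move=> x _ /=; rewrite lee_fin [leRHS]ger0_norm ?cabs_ge0// Im_le_cabs.
Qed.

Lemma cintble_le f (g : T -> R) : cmeas f -> mu.-integrable setT (EFin \o g) ->
  (forall x, cabs (f x) <= g x) -> cintble f.
Proof.
move=> mf ig h; apply/cintbleP => //.
have /integrableP[_] : mu.-integrable setT (EFin \o (fun x => cabs (f x))).
  apply: le_integrable ig => //; first exact/measurable_EFinP/measurable_cabs.
  move=> x _ /=; rewrite lee_fin ger0_norm ?cabs_ge0//.
  by apply: (le_trans (h x)); exact: ler_norm.
by under eq_integral do rewrite /= ger0_norm ?cabs_ge0//.
Qed.

Lemma cintble_le_cabs f g : cmeas f -> cintble g ->
  (forall x, cabs (f x) <= cabs (g x)) -> cintble f.
Proof.
move=> mf ig h; have mg := cintble_meas ig.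
apply/cintbleP => //; apply: le_lt_trans ((cintbleP mg).1 ig).
apply: ge0_le_integral => //.
- by move=> x _; rewrite lee_fin cabs_ge0.
- exact/measurable_EFinP/measurable_cabs.
- exact/measurable_EFinP/measurable_cabs.
- by move=> x _; rewrite lee_fin.
Qed.

Lemma eq_cint f g : f =1 g -> cint f = cint g.
Proof. by move=> /funext->. Qed.

Lemma cintD f g : cintble f -> cintble g ->
  cint (fun x => f x + g x) = cint f + cint g.
Proof.
move=> [f1 f2] [g1 g2]; rewrite /cint.
under eq_Rintegral do rewrite ReDc.
under [X in Complex _ X]eq_Rintegral do rewrite ImDc.
by rewrite !RintegralD.
Qed.

Lemma cintbleZ c f : cintble f -> cintble (fun x => c * f x).
Proof.
move=> i; have m := cintble_meas i; apply/cintbleP.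
  by apply: cmeasM => //; exact: cmeas_cst.
under eq_integral do rewrite cabsM EFinM.
rewrite ge0_integralZl_EFin ?cabs_ge0//.
- by rewrite lte_mul_pinfty// ?lee_fin ?cabs_ge0//; exact: (cintbleP m).1.
- by move=> x _; rewrite lee_fin cabs_ge0.
- exact/measurable_EFinP/measurable_cabs.
Qed.

Lemma cintZ c f : cintble f -> cint (fun x => c * f x) = c * cint f.
Proof.
move=> [f1 f2]; rewrite /cint.
under eq_Rintegral do rewrite ReMc.
under [X in Complex _ X]eq_Rintegral do rewrite ImMc.
have i1 (r : R) (h : T -> R) : mu.-integrable setT (EFin \o h) ->
    mu.-integrable setT (EFin \o (fun x => r * h x)).
  move=> ih; rewrite (_ : EFin \o _ = (fun x => r%:E * (EFin \o h) x)%E) //.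
  exact: integrableZl.
rewrite RintegralB ?RintegralD ?RintegralZl//; try exact: i1.
by case: c => a b; cplx => //=; ring.
Qed.

Lemma cintbleN f : cintble f -> cintble (fun x => - f x).
Proof.
by move=> /(cintbleZ (-1)); under eq_fun do rewrite mulN1r.
Qed.

Lemma cintB f g : cintble f -> cintble g ->
  cint (fun x => f x - g x) = cint f - cint g.
Proof.
move=> fi gi; rewrite (cintD fi (cintbleN gi)); congr (_ + _).
rewrite -[RHS]mulN1r -cintZ//; apply: eq_cint => x; by rewrite mulN1r.
Qed.

Lemma cint_conj f : cintble f -> cint (fun x => conjc (f x)) = conjc (cint f).
Proof.
move=> [f1 f2]; rewrite /cint /=.
under eq_Rintegral do rewrite ReJ.
under [X in Complex _ X]eq_Rintegral do rewrite ImJ -mulN1r.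
by rewrite RintegralZl// mulN1r.
Qed.

Lemma cintbleJ f : cintble f -> cintble (fun x => conjc (f x)).
Proof.
move=> fi; have mf := cintble_meas fi; apply/cintbleP; first exact: cmeasJ.
by under eq_integral do rewrite cabsJ; exact: (cintbleP mf).1.
Qed.

Lemma ae_eq_cint f g : cmeas f -> cmeas g -> {ae mu, forall x, f x = g x} ->
  cint f = cint g.
Proof.
move=> [f1 f2] [g1 g2] fg; rewrite /cint /Rintegral; congr (Complex (fine _) (fine _));
  apply: ae_eq_integral => //; try exact/measurable_EFinP.
  by apply: filterS fg => x /= -> _.
by apply: filterS fg => x /= -> _.
Qed.

End ComplexIntegral.

(** * Fubini's theorem for complex functions *)

Section ComplexFubini.
Context d1 d2 (T1 : measurableType d1) (T2 : measurableType d2) (R : realType).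
Variable m1 : {sigma_finite_measure set T1 -> \bar R}.
Variable m2 : {sigma_finite_measure set T2 -> \bar R}.
Variable f : T1 * T2 -> R[i].
Hypothesis fi : cintble (m1 \x m2)%E f.

Lemma ae_cintble1 : {ae m1, forall x, cintble m2 (fun y => f (x, y))}.
Proof.
case: fi => i1 i2.
have h1 := ae_integrable1 i1; have h2 := ae_integrable1 i2.
by apply: filterS2 h1 h2 => x; split.
Qed.

(** Partial integrals are finite only almost everywhere. [fine] replaces infinite values by 0, which
    alters the function on a null set and keeps it dominated by |F|. *)
Let fine_ae d (T : measurableType d) (m : {measure set T -> \bar R}) (F : T -> \bar R) :
  m.-integrable setT F -> m.-integrable setT (EFin \o (fun x => fine (F x))) /\
  Rintegral m setT (fun x => fine (F x)) = fine (\int[m]_x F x)%E.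
Proof.
move=> Fi; have mF := measurable_int _ Fi.
have mfF : measurable_fun setT (EFin \o (fun x => fine (F x))).
  by apply/measurable_EFinP; exact: measurableT_comp.
split.
  apply: le_integrable Fi => // x _ /=.
  by case: (F x) => [r| |] //=; rewrite normr0 leey.
congr fine; apply: ae_eq_integral => //.
have := integrable_ae measurableT Fi; apply: filterS => x /= /(_ I) Fx _.
by rewrite fineK.
Qed.

Lemma cint_fubini1 : cintble m1 (fun x => cint m2 (fun y => f (x, y))) /\
  cint (m1 \x m2)%E f = cint m1 (fun x => cint m2 (fun y => f (x, y))).
Proof.
case: fi => i1 i2.
have [a1 a2] := fine_ae (integrable_fubini_F i1).
have [b1 b2] := fine_ae (integrable_fubini_F i2).
split; first by split.
rewrite /cint /= [X in _ = Complex X _]a2 [X in _ = Complex _ X]b2.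
by rewrite !integral12_prod_meas1.
Qed.

Lemma cint_fubini2 : cintble m2 (fun y => cint m1 (fun x => f (x, y))) /\
  cint (m1 \x m2)%E f = cint m2 (fun y => cint m1 (fun x => f (x, y))).
Proof.
case: fi => i1 i2.
have sw (g : T1 * T2 -> \bar R) : (m1 \x m2)%E.-integrable setT g ->
    (m2 \x m1)%E.-integrable setT (fun p => g (p.2, p.1)).
  move=> gi; have mg := measurable_int _ gi; apply/integrable12ltyP => /=.
    by apply: (measurableT_comp mg); exact: measurable_fun_pair.
  exact: ((integrable21ltyP m1 m2 mg).1 gi).
have [a1 a2] := fine_ae (integrable_fubini_F (sw _ i1)).
have [b1 b2] := fine_ae (integrable_fubini_F (sw _ i2)).
split; first by split.
rewrite /cint /= [X in _ = Complex X _]a2 [X in _ = Complex _ X]b2.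
by rewrite /Rintegral -(integral21_prod_meas1 i1) -(integral21_prod_meas1 i2).
Qed.

End ComplexFubini.

(** * Changes of variables with constant Jacobian *)

Section Rescaling.
Context (R : realType).

(** A is the inverse of the absolute Jacobian determinant. Testing on nonnegative functions makes
    the notion stable under composition and, by Tonelli, under products; integrable functions follow
    by positive and negative parts. *)
Definition rescales d d' (T : measurableType d) (T' : measurableType d')
  (mu : {measure set T -> \bar R}) (mu' : {measure set T' -> \bar R})
  (phi : T -> T') (A : R) := [/\ 0 < A, measurable_fun setT phi &
  forall g : T' -> \bar R, measurable_fun setT g -> (forall x, 0 <= g x)%E ->
   (\int[mu]_x g (phi x) = A%:E * \int[mu']_x g x)%E].

Lemma rescales_comp d d' d'' (T : measurableType d) (T' : measurableType d')
  (T'' : measurableType d'')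
  (mu : {measure set T -> \bar R}) (mu' : {measure set T' -> \bar R})
  (mu'' : {measure set T'' -> \bar R}) phi psi A B :
  rescales mu mu' phi A -> rescales mu' mu'' psi B ->
  rescales mu mu'' (psi \o phi) (A * B).
Proof.
move=> [A0 mphi h1] [B0 mpsi h2]; split; first exact: mulr_gt0.
  exact: measurableT_comp.
move=> g mg g0; rewrite EFinM -muleA -h2// -h1//.
exact: measurableT_comp.
Qed.

Section Apply.
Context d d' (T : measurableType d) (T' : measurableType d').
Variables (mu : {measure set T -> \bar R}) (mu' : {measure set T' -> \bar R}).
Variables (phi : T -> T') (A : R).
Hypothesis h : rescales mu mu' phi A.

Lemma rescales_cintble f : cmeas f -> cintble mu (fun x => f (phi x)) <-> cintble mu' f.
Proof.
case: h => A0 mphi hA mf.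
have e : (\int[mu]_x (cabs (f (phi x)))%:E = A%:E * \int[mu']_x (cabs (f x))%:E)%E.
  apply: (hA (fun x => (cabs (f x))%:E)); last by move=> x; rewrite lee_fin cabs_ge0.
  exact/measurable_EFinP/measurable_cabs.
rewrite !cintbleP//; last exact: cmeas_comp.
rewrite e; split; last by move=> ?; rewrite lte_mul_pinfty// lee_fin ltW.
have : (0 <= \int[mu']_x (cabs (f x))%:E)%E.
  by apply: integral_ge0 => x _; rewrite lee_fin cabs_ge0.
by case: (\int[mu']_x _)%E => [r| |] // _; rewrite ?ltry// gt0_muley ?lte_fin.
Qed.

Let rescales_Rint (u : T' -> R) : mu'.-integrable setT (EFin \o u) ->
  Rintegral mu setT (fun x => u (phi x)) = A * Rintegral mu' setT u.
Proof.
case: h => A0 mphi hA iu.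
have mu0 := measurable_int _ iu.
have mup := measurable_funepos mu0; have mun := measurable_funeneg mu0.
rewrite /Rintegral.
have fp := integrable_fin_num measurableT (integrable_funepos measurableT iu).
have fn := integrable_fin_num measurableT (integrable_funeneg measurableT iu).
rewrite integralE [in RHS]integralE.
rewrite (_ : (\int[mu]_x ((fun x => (u (phi x))%:E)^\+%E x) = A%:E * \int[mu']_x ((EFin \o u)^\+%E x))%E).
  rewrite (_ : (\int[mu]_x ((fun x => (u (phi x))%:E)^\-%E x) = A%:E * \int[mu']_x ((EFin \o u)^\-%E x))%E).
    rewrite -muleBr// ?fineM//; first by rewrite fin_numB fp.
    by rewrite fin_num_adde_defl// fin_numN.
  by rewrite -hA//; apply: eq_integral => x _; rewrite !funenegE.
by rewrite -hA//; apply: eq_integral => x _; rewrite !funeposE.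
Qed.

Lemma rescales_cint f : cintble mu' f ->
  cint mu (fun x => f (phi x)) = A%:C%C * cint mu' f.
Proof.
move=> [i1 i2]; rewrite /cint (rescales_Rint i1) (rescales_Rint i2).
by cplx => /=; ring.
Qed.

End Apply.

End Rescaling.

(** * Sigma-finite measures and their products *)

Section SigmaFinitePack.
Context d (T : measurableType d) (R : realType) (m : {measure set T -> \bar R}).

Definition sfm & sigma_finite setT m : set T -> \bar R := m.

Variable h : sigma_finite setT m.
HB.instance Definition _ := Measure.copy (sfm h) m.
HB.instance Definition _ := Measure_isSigmaFinite.Build d T R (sfm h) h.

End SigmaFinitePack.

(** [ms_mes] is a bare measure, whereas Fubini's theorem is stated for the sigma-finite structure.
    Rewriting with an equal packed measure supplies that structure. *)
Lemma sigma_finite_pack d (T : measurableType d) (R : realType)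
  (m : {measure set T -> \bar R}) : sigma_finite setT m ->
  exists m' : {sigma_finite_measure set T -> \bar R}, m = m'.
Proof. by move=> h; exists (@sfm _ _ _ _ h); case: m h => f [a b] h. Qed.

Section ProductMeasures.

Lemma sigma_finite_prod d1 d2 (T1 : measurableType d1) (T2 : measurableType d2)
  (R : realType) (m1 : {sigma_finite_measure set T1 -> \bar R})
  (m2 : {sigma_finite_measure set T2 -> \bar R}) : sigma_finite setT (m1 \x m2)%E.
Proof.
have [A uA hA] := sigma_finiteT m1; have [B uB hB] := sigma_finiteT m2.
(* The products A i x B j are enumerated by a coding of pairs, with the empty set at integers that
   code no pair. *)
exists (fun k => if unpickle k is Some (i, j) then A i `*` B j else set0)%classic.
  apply/seteqP; split => // -[x y] _.
  have [i _ Ai] : (\bigcup_k A k)%classic x by rewrite -uA.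
  have [j _ Bj] : (\bigcup_k B k)%classic y by rewrite -uB.
  by exists (pickle (i, j)) => //; rewrite pickleK.
move=> k; case: unpickle => [[i j]|]; last by rewrite measure0; split.
have [mA lA] := hA i; have [mB lB] := hB j.
split; first exact: measurableX.
rewrite [X in (X < _)%E](product_measure1E _ _ mA mB).
by apply: lte_mul_pinfty => //; rewrite ge0_fin_numE.
Qed.

Context d1 d2 (T1 : measurableType d1) (T2 : measurableType d2) (R : realType).
Variables (m1 : {sigma_finite_measure set T1 -> \bar R})
  (m2 : {sigma_finite_measure set T2 -> \bar R}).

Lemma ge0_integral_prod (u : T1 -> R) (v : T2 -> R) (A B : R) :
  measurable_fun setT u -> measurable_fun setT v ->
  (forall x, 0 <= u x) -> (forall y, 0 <= v y) ->
  (\int[m1]_x (u x)%:E = A%:E)%E -> (\int[m2]_x (v x)%:E = B%:E)%E ->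
  (\int[m1 \x m2]_p (u p.1 * v p.2)%:E = (A * B)%:E)%E.
Proof.
move=> mu mv u0 v0 hA hB; have B0 : (0 <= B%:E :> \bar R)%E.
  by rewrite -hB; apply: integral_ge0 => x _; rewrite lee_fin.
rewrite fubini_tonelli1 /=; last by move=> p; rewrite lee_fin mulr_ge0.
  rewrite /fubini_F /=; transitivity (\int[m1]_x ((u x)%:E * B%:E))%E.
    apply: eq_integral => x _; rewrite -hB -ge0_integralZl_EFin//.
    - by move=> y _; rewrite lee_fin.
    - exact/measurable_EFinP.
  by rewrite ge0_integralZr ?hA//; [exact/measurable_EFinP|move=> *; rewrite lee_fin].
apply/measurable_EFinP; apply: measurable_funM.
  exact: measurableT_comp mu measurable_fst.
exact: measurableT_comp mv measurable_snd.
Qed.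

Lemma cint_prod (u : T1 -> R[i]) (v : T2 -> R[i]) :
  cintble (m1 \x m2)%E (fun p => u p.1 * v p.2) ->
  cintble m1 u -> cintble m2 v ->
  cint (m1 \x m2)%E (fun p => u p.1 * v p.2) = cint m1 u * cint m2 v.
Proof.
move=> i iu iv; rewrite (cint_fubini1 i).2 /=.
under eq_cint do rewrite cintZ// mulrC.
by rewrite cintZ// mulrC.
Qed.

Lemma cintble_prod (u : T1 -> R[i]) (v : T2 -> R[i]) :
  cintble m1 u -> cintble m2 v ->
  cintble (m1 \x m2)%E (fun p => u p.1 * v p.2).
Proof.
move=> iu iv; have mu := cintble_meas iu; have mv := cintble_meas iv.
apply/cintbleP.
  by apply: cmeasM; [exact: cmeas_comp measurable_fst mu|exact: cmeas_comp measurable_snd mv].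
have fin d (T : measurableType d) (m : {measure set T -> \bar R}) (w : T -> R[i]) :
    cintble m w -> exists A, (\int[m]_x (cabs (w x))%:E = A%:E)%E.
  move=> iw; have mw := cintble_meas iw; exists (fine (\int[m]_x (cabs (w x))%:E)).
  rewrite fineK// ge0_fin_numE; first exact: ((cintbleP m mw).1 iw).
  by apply: integral_ge0 => x _; rewrite lee_fin cabs_ge0.
have [A hA] := fin _ _ _ _ iu; have [B hB] := fin _ _ _ _ iv.
under eq_integral do rewrite cabsM.
rewrite (@ge0_integral_prod (fun x => cabs (u x)) (fun x => cabs (v x)) A B) ?ltry//.
- exact: measurable_cabs.
- exact: measurable_cabs.
- by move=> x; exact: cabs_ge0.
- by move=> x; exact: cabs_ge0.
Qed.

End ProductMeasures.

(** * Affine maps of the line and of the complex plane *)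

Section RescalingMaps.
Context (R : realType).
Local Notation leb := (lebR R).
Local Notation pl := (lebR R \x lebR R)%E.

Lemma rescalesP d d' (T : measurableType d) (T' : measurableType d')
  (mu : {measure set T -> \bar R}) (mu' : {measure set T' -> \bar R})
  (phi : T -> T') (c : R) : 0 < c -> measurable_fun setT phi ->
  (forall X, measurable X -> mu (phi @^-1` X)%classic = (c%:E * mu' X)%E) ->
  rescales mu mu' phi c.
Proof.
move=> c0 mphi h; split => // g mg g0.
have := @ge0_integral_pushforward _ _ _ _ R phi mphi mu setT g measurableT mg (fun x _ => g0 x).
rewrite preimage_setT => <-.
have -> : c%:E = ((NngNum (ltW c0))%:num)%:E by [].
rewrite -ge0_integral_mscale//.
apply: eq_measure_integral => A mA _; exact: h.
Qed.

Lemma eq_rescales d d' (T : measurableType d) (T' : measurableType d')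
  (mu : {measure set T -> \bar R}) (mu' : {measure set T' -> \bar R})
  (phi psi : T -> T') (c c' : R) : phi =1 psi -> c = c' ->
  rescales mu mu' phi c -> rescales mu mu' psi c'.
Proof. by move=> /funext-> ->. Qed.

(** For positive slope, s times the pushforward of Lebesgue measure gives each ]a, b] its length,
    hence is Lebesgue measure by uniqueness. Negative slopes are composed with the reflection. *)
Lemma rescales_line (s t : R) : s != 0 ->
  rescales leb leb (fun x : measurableTypeR R => s * x + t : measurableTypeR R) `|s|^-1.
Proof.
have maff (s' t' : R) : measurable_fun setT (fun x : measurableTypeR R => s' * x + t' : measurableTypeR R).
  by apply: measurable_funD => //; exact: measurable_funM.
have pos (s' : R) : 0 < s' ->
    rescales leb leb (fun x : measurableTypeR R => s' * x + t : measurableTypeR R) s'^-1.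
  move=> s0; have m := maff s' t.
  apply: rescalesP => //; first by rewrite invr_gt0.
  have [pm hpm] : exists pm : {measure set (measurableTypeR R) -> \bar R}, forall A,
     pm A = leb ((fun x : measurableTypeR R => s' * x + t : measurableTypeR R) @^-1` A)%classic.
    unshelve eexists.
      refine [the {measure set (measurableTypeR R) -> \bar R} of
        pushforward leb (fun x : measurableTypeR R => s' * x + t : measurableTypeR R)].
      exact: m.
    by [].
  have key := @lebesgue_measure_unique R (mscale (NngNum (ltW s0)) pm).
  move=> X mX; have e : lebesgue_measure X = (s'%:E * pm X)%E.
    apply: key => // _ [[a b]] _ <-.
    rewrite -[RHS]/(s'%:E * pm `]a, b]%classic)%E hpm.
    have -> : ((fun x : measurableTypeR R => s' * x + t : measurableTypeR R) @^-1`
       `]a, b])%classic = `](a - t) / s', (b - t) / s']%classic.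
      apply/seteqP; split => x /=; rewrite !in_itv /= ltr_pdivrMr// ler_pdivlMr//;
        rewrite ltrBlDr lerBrDr [x * _]mulrC//.
    transitivity (s'%:E * lebesgue_measure
      (`]((a - t) / s')%R, ((b - t) / s')%R]%classic : set R))%E; last by [].
    rewrite !lebesgue_measure_itv /= !lte_fin ltr_pM2r ?invr_gt0// ltrD2r.
    case: ifP => _; last by rewrite mule0.
    rewrite -!EFinB -EFinM; congr EFin; field; exact: lt0r_neq0.
  transitivity (s'^-1%:E * (s'%:E * pm X))%E.
    rewrite hpm.
    by rewrite muleA -EFinM mulVf ?mul1e// lt0r_neq0.
  by congr (_ * _)%E; rewrite -e.
rewrite neq_lt => /orP[s0|s0]; last by rewrite gtr0_norm//; exact: pos.
have neg : rescales leb leb (fun x : measurableTypeR R => - x : measurableTypeR R) 1.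
  apply: rescalesP => //.
    by have := maff (-1) 0; under eq_fun do rewrite mulN1r addr0.
  move=> X mX; transitivity (lebesgue_measure X).
    exact: lebesgue_measureN.
  exact/esym/mul1e.
have s0' : 0 < - s by rewrite oppr_gt0.
apply: eq_rescales (rescales_comp neg (pos _ s0')).
  by move=> x /=; rewrite mulrNN.
by rewrite mul1r ltr0_norm.
Qed.

(** Tonelli integrates the modified coordinate first; with the other one frozen, the map is affine
    on a line. *)
Lemma rescales_shear1 (s k t : R) : s != 0 ->
  rescales pl pl (fun p : measurableTypeR R * measurableTypeR R =>
     (s * p.1 + k * p.2 + t : measurableTypeR R, p.2)) `|s|^-1.
Proof.
move=> s0; split; first by rewrite invr_gt0 normr_gt0.
  apply: measurable_fun_pair => //; apply: measurable_funD => //.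
  by apply: measurable_funD => //; exact: measurable_funM.
move=> g mg g0.
have m : measurable_fun setT (fun p : measurableTypeR R * measurableTypeR R =>
     (s * p.1 + k * p.2 + t : measurableTypeR R, p.2)).
  apply: measurable_fun_pair => //; apply: measurable_funD => //.
  by apply: measurable_funD => //; exact: measurable_funM.
rewrite fubini_tonelli2//; last exact: (measurableT_comp mg m).
rewrite [in RHS]fubini_tonelli2// /fubini_G /=.
rewrite -ge0_integralZl_EFin ?invr_ge0//; last 2 first.
- by move=> y _; apply: integral_ge0.
- exact: (measurable_fun_fubini_tonelli_G _ mg).
apply: eq_integral => y _.
have [_ _ h] := rescales_line (k * y + t) s0.
rewrite -(h (fun x => g (x, y)))//; last exact: measurableT_comp.
by apply: eq_integral => x _; rewrite addrA.
Qed.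

Lemma rescales_shear2 (s k t : R) : s != 0 ->
  rescales pl pl (fun p : measurableTypeR R * measurableTypeR R =>
     (p.1, s * p.2 + k * p.1 + t : measurableTypeR R)) `|s|^-1.
Proof.
move=> s0; split; first by rewrite invr_gt0 normr_gt0.
  apply: measurable_fun_pair => //; apply: measurable_funD => //.
  by apply: measurable_funD => //; exact: measurable_funM.
move=> g mg g0.
have m : measurable_fun setT (fun p : measurableTypeR R * measurableTypeR R =>
     (p.1, s * p.2 + k * p.1 + t : measurableTypeR R)).
  apply: measurable_fun_pair => //; apply: measurable_funD => //.
  by apply: measurable_funD => //; exact: measurable_funM.
rewrite fubini_tonelli1//; last exact: (measurableT_comp mg m).
rewrite [in RHS]fubini_tonelli1// /fubini_F /=.
rewrite -ge0_integralZl_EFin ?invr_ge0//; last 2 first.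
- by move=> y _; apply: integral_ge0.
- exact: (measurable_fun_fubini_tonelli_F _ mg).
apply: eq_integral => x _.
have [_ _ h] := rescales_line (k * x + t) s0.
rewrite -(h (fun y => g (x, y)))//; last exact: measurableT_comp.
by apply: eq_integral => y _; rewrite addrA.
Qed.

Definition caff (ga de : R[i]) (p : measurableTypeR R * measurableTypeR R) :
  measurableTypeR R * measurableTypeR R :=
  let z := ga * Complex (p.1 : R) (p.2 : R) + de in (Re z, Im z).

(** Multiplication by a + ib with a nonzero is a product of two shears, of factors a and a + b^2 /
    a, whose product is a^2 + b^2. When the real part vanishes, the multiplier is written as (ga /
    (1 + i)) (1 + i), both factors having nonzero real part. *)
Lemma rescales_caff ga de : ga != 0 -> rescales pl pl (caff ga de) (cabs ga ^- 2).
Proof.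
have gen (g e : R[i]) : Re g != 0 -> rescales pl pl (caff g e) (cabs g ^- 2).
  case: g => a b; case: e => e1 e2 /= a0.
  have n0 : a + b ^+ 2 / a != 0.
    rewrite (_ : _ + _ = (a ^+ 2 + b ^+ 2) / a); last by field.
    rewrite mulf_neq0 ?invr_eq0// paddr_eq0 ?sqr_ge0//.
    by rewrite sqrf_eq0 (negbTE a0).
  apply: eq_rescales (rescales_comp (rescales_shear1 (- b) e1 a0)
    (rescales_shear2 (b / a) (e2 - b * e1 / a) n0)).
    by move=> [x y]; rewrite /caff /=; congr pair; [ring|field].
  rewrite -invfM -normrM (_ : a * _ = a ^+ 2 + b ^+ 2); last by field.
  by rewrite ger0_norm ?addr_ge0 ?sqr_ge0// -(sqr_cabs (Complex a b)).
move=> ga0; have [r0|] := eqVneq (Re ga) 0; last exact: gen.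
pose g1 : R[i] := Complex 1 1.
have g10 : g1 != 0 by rewrite eq_complex /= oner_eq0.
have r1 : Re (ga / g1) != 0.
  move: ga0 r0; case: ga => a b; rewrite eq_complex /= => + a0.
  rewrite a0 eqxx /= => b0; rewrite mul0r expr1n sub0r mulrN opprK.
  by rewrite mulf_neq0// mul1r invr_eq0.
apply: eq_rescales (rescales_comp (gen _ 0 r1) (gen g1 de (oner_neq0 _))); last first.
  by rewrite -invfM -exprMn -cabsM divfK.
move=> [x y]; rewrite /caff /= /caff; set z := ga / g1 * _ + 0; have -> : Complex (Re z) (Im z) = z by case: (z).
by rewrite (_ : g1 * z = ga * Complex (x : R) (y : R))// /z addr0 mulrCA mulrA divfK.
Qed.

End RescalingMaps.

(** * Gaussian integrals and rotation averaging *)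

Section Gaussian.
Context (R : realType).
Local Notation leb := (lebR R).
Local Notation pl := (lebR R \x lebR R)%E.
Implicit Types (a b : R) (al be : R[i]).

Definition gauss_mass a : R := Num.sqrt pi / Num.sqrt a.

Lemma gauss_mass_gt0 a : 0 < a -> 0 < gauss_mass a.
Proof. by move=> a0; rewrite divr_gt0// sqrtr_gt0// pi_gt0. Qed.

Lemma measurable_gauss a b :
  measurable_fun setT (fun x : measurableTypeR R => expR (- a * x ^+ 2 + b * x)).
Proof.
apply: measurableT_comp => //; apply: measurable_funD; apply: measurable_funM => //.
Qed.

Lemma integral_gauss a b : 0 < a ->
  (\int[leb]_x (expR (- a * x ^+ 2 + b * x))%:E =
   (gauss_mass a * expR (b ^+ 2 / (4 * a)))%:E)%E.
Proof.
move=> a0; have s0 : Num.sqrt a != 0 by rewrite sqrtr_eq0 -ltNge.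
have ss : Num.sqrt a ^+ 2 = a by rewrite sqr_sqrtr// ltW.
have [_ _ h] := rescales_line (- b / (2 * Num.sqrt a)) s0.
pose g (x : measurableTypeR R) := (gauss_fun x)%:E.
have mg : measurable_fun setT g.
  by apply/measurable_EFinP; exact: measurable_gauss_fun.
have g0 x : (0 <= g x)%E by rewrite lee_fin gauss_fun_ge0.
have := h g mg g0.
rewrite (_ : (\int[leb]_x g x)%E = (Num.sqrt pi)%:E); last exact: integralT_gauss.
rewrite ger0_norm ?sqrtr_ge0// => hg.
transitivity (\int[leb]_x ((expR (b ^+ 2 / (4 * a)))%:E *
    g (Num.sqrt a * x + - b / (2 * Num.sqrt a))%R))%E.
  apply: eq_integral => x _; rewrite /g /gauss_fun -EFinM -expRD; congr (expR _)%:E.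
  rewrite -{1 2}ss; field; exact: s0.
rewrite ge0_integralZl_EFin ?expR_ge0//.
  by rewrite hg -!EFinM; congr EFin; rewrite /gauss_mass; ring.
apply: (measurableT_comp mg).
by apply: measurable_funD => //; exact: measurable_funM.
Qed.

Lemma integrable_gauss a b : 0 < a ->
  leb.-integrable setT (EFin \o (fun x : measurableTypeR R => expR (- a * x ^+ 2 + b * x))).
Proof.
move=> a0; apply/integrableP; split; first by apply/measurable_EFinP; exact: measurable_gauss.
under eq_integral do rewrite /= ger0_norm ?expR_ge0//.
by rewrite integral_gauss// ltry.
Qed.

Definition gau al be (x : measurableTypeR R) : R[i] :=
  cexp (- al * (x ^+ 2)%:C%C + be * (x : R)%:C%C).

Lemma cmeas_id : cmeas (fun x : measurableTypeR R => (x : R)%:C%C).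
Proof. exact: cmeasR. Qed.

Lemma cmeas_gau al be : cmeas (gau al be).
Proof.
apply: cmeas_cexp; apply: cmeasD; apply: cmeasM; try exact: cmeas_cst.
  by apply: cmeasR; exact: measurable_funX.
exact: cmeas_id.
Qed.

Lemma cintble_gau al be : 0 < Re al -> cintble leb (gau al be).
Proof.
move=> a0; apply: cintble_le (cmeas_gau al be) (integrable_gauss (Re be) a0) _ => x.
rewrite cabs_cexp ReDc !ReMc ReNc /=; rewrite le_eqVlt; apply/orP; left; apply/eqP.
by congr expR; ring.
Qed.

Definition gc al : R[i] := cint leb (gau al 0).

Lemma gc_real a : 0 < a -> gc a%:C%C = (gauss_mass a)%:C%C.
Proof.
move=> a0; have gauE (x : measurableTypeR R) : gau a%:C%C 0 x = (expR (- a * x ^+ 2 + 0 * x))%:C%C.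
  rewrite /gau mul0r addr0 (_ : - a%:C%C * (x ^+ 2)%:C%C = (- a * x ^+ 2 + 0 * x)%:C%C) ?cexpR//.
  by cplx => /=; ring.
rewrite /gc /cint; congr Complex.
  rewrite /Rintegral; under eq_integral do rewrite gauE.
  by rewrite integral_gauss//= expr0n/= mul0r expR0 mulr1.
rewrite /Rintegral; under eq_integral do rewrite gauE.
by rewrite integral0.
Qed.

Definition toC (p : measurableTypeR R * measurableTypeR R) : R[i] :=
  Complex (p.1 : R) (p.2 : R).

Lemma cmeas_toC : cmeas toC.
Proof. by apply: cmeas_complex; [exact: measurable_fst|exact: measurable_snd]. Qed.

Definition gau2 al (z : R[i]) : R[i] := cexp (- al * (z * conjc z)).

Lemma gau2E al p : gau2 al (toC p) = gau al 0 p.1 * gau al 0 p.2.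
Proof.
rewrite /gau2 /gau -cexpD; congr cexp; case: al => a b; case: p => x y.
by rewrite /toC /=; cplx => /=; ring.
Qed.

Lemma cintble_gau2 al : 0 < Re al -> cintble pl (fun p => gau2 al (toC p)).
Proof.
move=> a0; under eq_fun do rewrite gau2E.
by apply: cintble_prod; exact: cintble_gau.
Qed.

(** The constant pi / al, kept as an integral; its nonvanishing is what matters later. *)
Definition kappa al : R[i] := cint pl (fun p => gau2 al (toC p)).

Lemma kappaE al : 0 < Re al -> kappa al = gc al ^+ 2.
Proof.
move=> a0; rewrite /kappa; under eq_cint do rewrite gau2E.
by rewrite cint_prod//; [exact: cintble_prod (cintble_gau _ _) (cintble_gau _ _)|
  exact: cintble_gau|exact: cintble_gau].
Qed.

Lemma toC_caff ga de p : toC (caff ga de p) = ga * toC p + de.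
Proof. by rewrite /toC /caff /=; case: (ga * _ + de). Qed.

(** An indicator turns the segment integral into one over the whole line, to which Fubini's theorem
    on a product applies. *)
Lemma cint_itv (h : R -> R[i]) (a b : R) :
  cint leb (fun t => (\1_(`[a, b]%classic : set R) t)%:C%C * h t) =
  Complex (itvint (fun t => Re (h t)) a b) (itvint (fun t => Im (h t)) a b).
Proof.
have key (u : R -> R) : itvint u a b =
    Rintegral leb setT (fun t => \1_(`[a, b]%classic : set R) t * u t).
  rewrite /itvint Rintegral_mkcond; apply: eq_Rintegral => t _.
  by rewrite patchE indicE; case: ifP => _; rewrite ?mul1r ?mul0r.
rewrite !key /cint; congr Complex; apply: eq_Rintegral => t _.
  by rewrite ReMc /= mul0r subr0.
by rewrite ImMc /= mul0r addr0.
Qed.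

Lemma circle_mean (F : R[i] -> R[i]) z : entire F ->
  cint leb (fun t => (\1_(`[0, pi *+ 2]%classic : set R) t)%:C%C *
     F (z * cexp (Complex 0 t))) = (pi *+ 2)%:C%C * F 0.
Proof.
move=> eF; rewrite cint_itv circle_mean_Re//.
have eF' : entire (fun w => - 'i%C * F w).
  by move=> w; apply: cdiffM; [exact: cdiff_cst|exact: eF].
have := circle_mean_Re z eF'.
have ReI w : Re (- 'i%C * w) = Im w by case: w => x y /=; ring.
under [X in itvint X]eq_fun do rewrite ReI.
rewrite ReI => ->; case: (F 0) => x y; by cplx => /=; ring.
Qed.

Lemma measurable_angle : cmeas (fun t : measurableTypeR R => cexp (Complex 0 (t : R))).
Proof. by apply: cmeas_cexp; apply: cmeas_complex => //; exact: measurable_cst. Qed.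

(** The function [H] of a point p and an angle t is F(p e^(it)) W(p) on [0, 2 pi]. Integrating over
    p first gives 2 pi times the left-hand side by rotation invariance; integrating over t first
    gives 2 pi F(0) W(p) by the mean value property. [pm] stands for the packed plane measure, so
    its invariance is a hypothesis. *)
Let mean_value_aux (pm : {sigma_finite_measure set
    (measurableTypeR R * measurableTypeR R)%type -> \bar R}) (F W : R[i] -> R[i]) :
  (forall t : R, rescales pm pm (caff (cexp (Complex 0 t)) 0) 1) -> entire F ->
  (forall z t, W (z * cexp (Complex 0 t)) = W z) ->
  cmeas (fun p => F (toC p)) -> cintble pm (fun p => W (toC p)) ->
  cintble pm (fun p => F (toC p) * W (toC p)) ->
  cint pm (fun p => F (toC p) * W (toC p)) = F 0 * cint pm (fun p => W (toC p)).
Proof.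
move=> ro_resc eF rad mF iW iFW.
have mW := cintble_meas iW; have mFW := cintble_meas iFW.
pose I := cint pm (fun p => F (toC p) * W (toC p)).
pose ind (t : R) := \1_(`[0, pi *+ 2]%classic : set R) t : R.
pose ro (t : R) := caff (cexp (Complex 0 t)) 0.
have roE t p : toC (ro t p) = toC p * cexp (Complex 0 t).
  by rewrite toC_caff addr0 mulrC.
pose H (q : (measurableTypeR R * measurableTypeR R) * measurableTypeR R) : R[i] :=
  (ind q.2)%:C%C * (F (toC q.1 * cexp (Complex 0 (q.2 : R))) * W (toC q.1)).
have mind : measurable_fun setT (fun t : measurableTypeR R => ind t).
  by apply: measurable_indic; exact: measurable_itv.
have mH : cmeas H.
  apply: cmeasM; first by apply: cmeasR; exact: measurableT_comp mind measurable_snd.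
  apply: cmeasM; last exact: cmeas_comp measurable_fst mW.
  have hro : measurable_fun setT
      (fun q : (measurableTypeR R * measurableTypeR R) * measurableTypeR R => ro q.2 q.1).
    have [m1 m2] : cmeas (fun q : (measurableTypeR R * measurableTypeR R) * measurableTypeR R =>
       cexp (Complex 0 (q.2 : R)) * toC q.1 + 0).
      apply: cmeasD; last exact: cmeas_cst.
      apply: cmeasM; last exact: cmeas_comp measurable_fst cmeas_toC.
      exact: cmeas_comp measurable_snd measurable_angle.
    exact: measurable_fun_pair.
  have h := cmeas_comp hro mF.
  rewrite (_ : (fun q => F _) = (fun q => F (toC (ro q.2 q.1)))); first exact: h.
  by apply/funext => q; rewrite roE.
have HE p t : H (p, t) = (ind t)%:C%C * (F (toC (ro t p)) * W (toC (ro t p))).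
  by rewrite /H /= roE rad.
have iind : cintble leb (fun t => (ind t)%:C%C).
  split; last first.
    rewrite (_ : EFin \o _ = cst 0%E)//; exact: integrable0.
  exact: integrable_indic_itv.
(* By Tonelli: rotation invariance makes the inner integral of |H| a constant times the indicator of
   a bounded interval. *)
have iH : cintble (pm \x leb)%E H.
  have mcH : measurable_fun setT (fun q => (cabs (H q))%:E).
    exact/measurable_EFinP/measurable_cabs.
  have cH0 q : (0 <= (cabs (H q))%:E)%E by rewrite lee_fin cabs_ge0.
  apply/(cintbleP _ mH).
  have -> := @fubini_tonelli2 _ _ _ _ R pm leb _ mcH cH0.
  rewrite /fubini_G.
  have fin : (\int[pm]_p (cabs (F (toC p) * W (toC p)))%:E)%E \is a fin_num.
    rewrite ge0_fin_numE; first exact: ((cintbleP _ mFW).1 iFW).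
    by apply: integral_ge0 => x _; rewrite lee_fin cabs_ge0.
  have mc : measurable_fun setT (fun p => (cabs (F (toC p) * W (toC p)))%:E).
    exact/measurable_EFinP/measurable_cabs.
  have c0 p : (0 <= (cabs (F (toC p) * W (toC p)))%:E)%E by rewrite lee_fin cabs_ge0.
  have inner t : (\int[pm]_p (cabs (H (p, t)))%:E =
      (cabs (ind t)%:C%C)%:E * \int[pm]_p (cabs (F (toC p) * W (toC p)))%:E)%E.
    have [_ mro h] := ro_resc t.
    have := h _ mc c0; rewrite mul1e => <-.
    rewrite -ge0_integralZl_EFin ?cabs_ge0//; last exact: (measurableT_comp mc mro).
    by apply: eq_integral => p _; rewrite HE cabsM EFinM.
  under eq_integral do rewrite inner.
  rewrite -(fineK fin) ge0_integralZr ?lee_fin; last 3 first.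
  - by apply/measurable_EFinP; apply: measurable_cabs; apply: cmeasR.
  - by move=> t _; rewrite lee_fin cabs_ge0.
  - by apply: fine_ge0; apply: integral_ge0 => x _; rewrite lee_fin cabs_ge0.
  apply: lte_mul_pinfty => //.
  - by apply: integral_ge0 => x _; rewrite lee_fin cabs_ge0.
  - rewrite ge0_fin_numE; first exact: ((cintbleP _ (cintble_meas iind)).1 iind).
    by apply: integral_ge0 => x _; rewrite lee_fin cabs_ge0.
  - exact: ltry.
  - exact: measurableT.
have pi0 : ((pi *+ 2)%:C%C : R[i]) != 0.
  by rewrite eq_complex /= eqxx andbT mulrn_eq0 /= gt_eqF// pi_gt0.
(* The length of the interval, read off from the circle mean of the constant 1. *)
have indI : cint leb (fun t => (ind t)%:C%C) = (pi *+ 2)%:C%C.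
  have := circle_mean (0 : R[i]) (fun z => cdiff_cst (1 : R[i]) z).
  by under eq_cint do rewrite mulr1; rewrite mulr1.
suff: (pi *+ 2)%:C%C * I = (pi *+ 2)%:C%C * (F 0 * cint pm (fun p => W (toC p))).
  by move/(mulfI pi0).
have e1 : cint (pm \x leb)%E H = (pi *+ 2)%:C%C * I.
  rewrite (cint_fubini2 iH).2 -indI mulrC -cintZ//; apply: eq_cint => t.
  under eq_cint do rewrite HE.
  rewrite cintZ; last by apply/(rescales_cintble (ro_resc t) mFW).
  by rewrite (rescales_cint (ro_resc t) iFW) mul1r mulrC.
rewrite -e1 (cint_fubini1 iH).2 mulrA -cintZ//; apply: eq_cint => p.
have eF' : entire (fun w => W (toC p) * F w).
  by move=> w; apply: cdiffM; [exact: cdiff_cst|exact: eF].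
rewrite -mulrA [F 0 * _]mulrC -(circle_mean (toC p) eF').
by apply: eq_cint => t; rewrite /H [W _ * _]mulrC.
Qed.

Lemma mean_value (F W : R[i] -> R[i]) : entire F ->
  (forall z t, W (z * cexp (Complex 0 t)) = W z) ->
  cmeas (fun p => F (toC p)) -> cintble pl (fun p => W (toC p)) ->
  cintble pl (fun p => F (toC p) * W (toC p)) ->
  cint pl (fun p => F (toC p) * W (toC p)) = F 0 * cint pl (fun p => W (toC p)).
Proof.
have [pm e] := sigma_finite_pack (sigma_finite_prod leb leb).
rewrite e; apply: mean_value_aux => t; rewrite -e.
apply: eq_rescales (rescales_caff 0 (cexp_neq0 (Complex 0 t))) => //.
by rewrite cabs_cexp /= expR0 expr1n invr1.
Qed.

End Gaussian.

(** * The reproducing property in one variable *)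

Section ReproducingPlane.
Context (R : realType).
Local Notation leb := (lebR R).
Local Notation pl := (lebR R \x lebR R)%E.
Implicit Types (a b : R) (al be : R[i]).

Lemma Re_gt0_neq0 al : 0 < Re al -> al != 0.
Proof. by move=> h; apply/eqP => al0; rewrite al0 ltxx in h. Qed.

Definition ker1 al be (z : R[i]) : R[i] := cexp (- al * (z * conjc z) + be * conjc z).

Lemma cmeas_ker1 al be : cmeas (fun p => ker1 al be (toC p)).
Proof.
have mJ : cmeas (fun p : measurableTypeR R * measurableTypeR R => conjc (toC p)).
  by apply: cmeasJ; exact: cmeas_toC.
apply: cmeas_cexp; apply: cmeasD; apply: cmeasM => //; try exact: cmeas_cst.
by apply: cmeasM => //; exact: cmeas_toC.
Qed.

Lemma entire_cexp_linear be : entire (fun z => cexp (be * z)).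
Proof.
move=> z; apply: (@cdiff_comp _ (@cexp R)); last exact: cdiff_cexp.
by apply: cdiffM; [exact: cdiff_cst|exact: cdiff_id].
Qed.

(* Recentring the Gaussian at be / al completes the square; what is left is the mean value property. *)
Lemma reproducing1 (f : R[i] -> R[i]) al be : 0 < Re al -> entire f ->
  cmeas (fun p => f (toC p)) ->
  cintble pl (fun p => f (toC p) * ker1 al be (toC p)) ->
  cint pl (fun p => f (toC p) * ker1 al be (toC p)) = kappa al * f (be / al).
Proof.
move=> al0 ef mf; have aln := Re_gt0_neq0 al0.
set bt := be / al; have -> : be = al * bt by rewrite /bt mulrC divfK.
set G := fun p => f (toC p) * ker1 al (al * bt) (toC p) => iG.
have sc := rescales_caff bt (oner_neq0 R[i]).
have mphi : measurable_fun setT (caff (1 : R[i]) bt) by case: sc.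
pose F z := f (z + bt) * cexp (- al * conjc bt * z).
have GE p : G (caff 1 bt p) = F (toC p) * gau2 al (toC p).
  rewrite /G /F toC_caff mul1r /ker1 /gau2 -[RHS]mulrA -cexpD; congr (_ * cexp _).
  by rewrite conjD; ring.
have := rescales_cint sc iG; rewrite cabs1 expr1n invr1 mul1r => <-.
under eq_cint do rewrite GE.
rewrite mean_value.
- by rewrite /F add0r mulr0 cexp0 mulr1 mulrC.
- move=> z; apply: cdiffM; last exact: entire_cexp_linear.
  apply: cdiff_comp; last exact: ef.
  by apply: cdiffD; [exact: cdiff_id|exact: cdiff_cst].
- move=> z t; rewrite /gau2 conjM conj_cexp; congr cexp; congr (_ * _).
  rewrite mulrACA -cexpD (_ : _ + _ = 0) ?cexp0 ?mulr1//.
  by cplx => /=; ring.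
- have h := cmeas_comp mphi mf.
  apply: cmeasM.
    rewrite (_ : (fun x => f _) = (fun x => f (toC (caff 1 bt x)))) //.
    by apply/funext => p; rewrite toC_caff mul1r.
  by apply: cmeas_cexp; apply: cmeasM; [exact: cmeas_cst|exact: cmeas_toC].
- exact: cintble_gau2.
- have : cintble pl (fun p => G (caff 1 bt p)).
    exact: ((rescales_cintble sc (cintble_meas iG)).2 iG).
  by rewrite (funext GE).
Qed.

(** Apply [reproducing1] to f(z) = exp(be z) with be = iq / 2. As be z + be conj z = iqx, the
    integrand splits into a Fourier integral in x and a pure Gaussian in y, while the right-hand
    side is gc(a)^2 exp(be^2 / a). Dividing by gc(a) leaves the claim. *)
Lemma gc_fourier a (q : R) : 0 < a ->
  cint leb (gau a%:C%C (Complex 0 q)) =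
  (gauss_mass a * expR (- q ^+ 2 / (4 * a)))%:C%C.
Proof.
move=> a0; have a0' : 0 < Re (a%:C%C : R[i]) by [].
pose be : R[i] := Complex 0 (q / 2).
have e p : cexp (be * toC p) * ker1 a%:C%C be (toC p) =
    gau a%:C%C (Complex 0 q) p.1 * gau a%:C%C 0 p.2.
  rewrite /ker1 /gau -!cexpD; congr cexp; case: p => x y; rewrite /toC /be /=.
  by cplx => /=; field.
have i1 := cintble_gau (Complex 0 q) a0'; have i2 := cintble_gau 0 a0'.
have ip := cintble_prod i1 i2.
have := @reproducing1 (fun z => cexp (be * z)) a%:C%C be a0' (entire_cexp_linear be).
rewrite (_ : (fun p => cexp (be * toC p) * _) =
  fun p => gau a%:C%C (Complex 0 q) p.1 * gau a%:C%C 0 p.2); last exact/funext.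
rewrite (cint_prod ip i1 i2) (kappaE a0') => h.
have gn : gc (a%:C%C : R[i]) != 0.
  by rewrite gc_real// eq_complex /= eqxx andbT gt_eqF// gauss_mass_gt0.
have h2 : cint leb (gau a%:C%C (Complex 0 q)) * gc a%:C%C =
  gc a%:C%C ^+ 2 * cexp (be * (be / a%:C%C)).
  apply: h => //; apply: cmeas_cexp; apply: cmeasM; first exact: cmeas_cst.
  exact: cmeas_toC.
have -> : cint leb (gau a%:C%C (Complex 0 q)) = gc a%:C%C * cexp (be * (be / a%:C%C)).
  by apply: (mulIf gn); rewrite h2; ring.
rewrite gc_real// (_ : be * (be / a%:C%C) = (- q ^+ 2 / (4 * a))%:C%C).
  by rewrite cexpR; cplx => /=; ring.
rewrite /be; have an := lt0r_neq0 a0.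
apply: (mulIf (Re_gt0_neq0 a0')); rewrite mulrA divfK ?Re_gt0_neq0//.
by cplx => /=; field.
Qed.

(* |gc al|^2 is a Gaussian integral over the plane which, rotated by 45 degrees, becomes the
   integral of a Fourier transform of real Gaussians, hence positive. *)
Lemma gc_neq0 al : 0 < Re al -> gc al != 0.
Proof.
move=> al0; have al0' : 0 < Re (conjc al) by rewrite ReJ.
pose a := Re al; pose b := Im al.
have a2 : 0 < 2 * a by rewrite mulr_gt0.
have a2' : 0 < Re ((2 * a)%:C%C : R[i]) by [].
(* The coefficient of - y^2 left after the x-integration: the Fourier transform at frequency 4 b y
   adds (4 b)^2 / (8 a) to 2 a. *)
have c0 : 0 < 2 * a + 2 * b ^+ 2 / a.
  by rewrite ltr_wpDr// divr_ge0 ?(ltW al0)// mulr_ge0 ?sqr_ge0.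
pose E p : R[i] := gau al 0 p.1 * gau (conjc al) 0 p.2.
have i1 := cintble_gau 0 al0; have i2 := cintble_gau 0 al0'.
have iE : cintble pl E := cintble_prod i1 i2.
have EE : cint pl E = gc al * gc (conjc al) := cint_prod iE i1 i2.
pose g1 : R[i] := Complex 1 1.
have g10 : g1 != 0 by rewrite eq_complex /= oner_eq0.
have sc := rescales_caff 0 g10.
have E' p : E (caff g1 0 p) = gau (2 * a)%:C%C (Complex 0 (4 * b * p.2)) p.1 *
   gau (2 * a)%:C%C 0 p.2.
  rewrite /E /gau -!cexpD; congr cexp; case: p => x y; rewrite /caff /a /b /g1 /=.
  by cplx => /=; ring.
have iE' : cintble pl (fun p => E (caff g1 0 p)).
  exact: ((rescales_cintble sc (cintble_meas iE)).2 iE).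
apply/eqP => gc0; have := rescales_cint sc iE; rewrite EE gc0 mul0r mulr0.
rewrite (cint_fubini2 iE').2.
rewrite (_ : cint leb _ = (gauss_mass (2 * a) * gauss_mass (2 * a + 2 * b ^+ 2 / a))%:C%C).
  by move=> -[] /eqP; rewrite mulf_eq0 !gt_eqF ?gauss_mass_gt0.
rewrite rmorphM /= -(gc_real c0) -cintZ; last exact: cintble_gau.
apply: eq_cint => y.
under eq_cint do rewrite E' /= mulrC.
rewrite cintZ; last exact: cintble_gau.
rewrite gc_fourier// /gau !mul0r !addr0.
rewrite (_ : - (2 * a)%:C%C * (y ^+ 2)%:C%C = (- (2 * a) * y ^+ 2)%:C%C); last first.
  by cplx => /=; ring.
rewrite (_ : - (2 * a + 2 * b ^+ 2 / a)%:C%C * (y ^+ 2)%:C%C =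
  (- (2 * a + 2 * b ^+ 2 / a) * y ^+ 2)%:C%C); last by cplx => /=; ring.
rewrite !cexpR -!rmorphM /= mulrCA -expRD; congr ((_ * expR _)%:C%C).
have an := lt0r_neq0 al0; rewrite -/a in an.
field; exact: an.
Qed.

Lemma kappa_neq0 al : 0 < Re al -> kappa al != 0.
Proof. by move=> al0; rewrite kappaE// expf_neq0// gc_neq0. Qed.

End ReproducingPlane.

(** * Real and complex coordinates *)

Section Coordinates.
Context (R : realType).

Fixpoint mkpt (k : nat) (r : nat -> R) : ms_car (RnM R k) :=
  match k return ms_car (RnM R k) with
  | 0 => tt
  | S k' => (mkpt k' r, r k')
  end.

Lemma rcoord_mkpt k r j : (j < k)%N -> rcoord (mkpt k r) j = r j.
Proof.
elim: k => //= k IH; rewrite ltnS leq_eqVlt.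
by case: eqVneq => [->//|jk] /= /IH.
Qed.

Lemma eq_mkpt k (r r' : nat -> R) : (forall j, (j < k)%N -> r j = r' j) ->
  mkpt k r = mkpt k r'.
Proof. by elim: k => //= k IH h; rewrite IH ?h// => j jk; apply: h; exact: ltnW. Qed.

Lemma mkpt_rcoord k (x : ms_car (RnM R k)) : mkpt k (rcoord x) = x.
Proof.
elim: k x => [[]|k IH] //= [x v] /=; rewrite eqxx; congr pair.
rewrite -[RHS]IH; apply: eq_mkpt => j jk; by rewrite ltn_eqF.
Qed.

Lemma eq_rcoord k (x y : ms_car (RnM R k)) :
  (forall j, (j < k)%N -> rcoord x j = rcoord y j) -> x = y.
Proof. by move=> h; rewrite -[x]mkpt_rcoord -[y]mkpt_rcoord; exact: eq_mkpt. Qed.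

Lemma rcoord_rupd k (x : ms_car (RnM R k)) i v j : (j < k)%N ->
  rcoord (rupd x i v) j = if j == i then v else rcoord x j.
Proof.
elim: k x => // k IH [x u]; rewrite ltnS leq_eqVlt /=.
have [->|jk] /= := eqVneq j k.
  by move=> _; case: (eqVneq i k) => /= _; rewrite ?eqxx.
move=> {}/IH IH; have [->|ik] /= := eqVneq i k; by rewrite ?(negbTE jk) //.
Qed.

(** [zc] for an arbitrary real dimension k. The inductions use k = m.*2, where one more complex
    variable turns k into [k.+2] by computation; [n + n] does not unfold that way. *)
Definition zk (k : nat) (x : ms_car (RnM R k)) (j : nat) : R[i] :=
  Complex (rcoord x j.*2) (rcoord x j.*2.+1).

Definition zup (k : nat) (x : ms_car (RnM R k)) (j : nat) (w : R[i]) :=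
  rupd (rupd x j.*2 (Re w)) j.*2.+1 (Im w).

Definition ptc (k : nat) (w : nat -> R[i]) : ms_car (RnM R k) :=
  mkpt k (fun i => if odd i then Im (w i./2) else Re (w i./2)).

Lemma double_lt (k m j : nat) : k = m.*2 -> (j < m)%N ->
  (j.*2 < k)%N /\ (j.*2.+1 < k)%N.
Proof.
by move=> -> jm; rewrite ltn_double jm -doubleS leq_double.
Qed.

Lemma zk_ptc k m w j : k = m.*2 -> (j < m)%N -> zk (ptc k w) j = w j.
Proof.
move=> km jm; have [h1 h2] := double_lt km jm.
rewrite /zk /ptc !rcoord_mkpt//= odd_double /= doubleK uphalf_double.
by case: (w j).
Qed.

Lemma eq_zk k m (x y : ms_car (RnM R k)) : k = m.*2 ->
  (forall j, (j < m)%N -> zk x j = zk y j) -> x = y.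
Proof.
move=> km h; apply: eq_rcoord => i ik.
have im : (i./2 < m)%N by rewrite ltn_half_double -km.
have [h1 h2] := h _ im.
by have := odd_double_half i; case: (odd i) => e; rewrite -e.
Qed.

Lemma zk_zup k m (x : ms_car (RnM R k)) i w j : k = m.*2 -> (j < m)%N ->
  zk (zup x i w) j = if j == i then w else zk x j.
Proof.
move=> km jm; have [h1 h2] := double_lt km jm.
rewrite /zk /zup !rcoord_rupd// eqSS.
have -> : (j.*2 == i.*2.+1) = false.
  by apply/eqP => /(congr1 odd); rewrite /= !odd_double.
have -> : (j.*2.+1 == i.*2) = false.
  by apply/eqP => /(congr1 odd); rewrite /= !odd_double.
by rewrite (inj_eq double_inj); case: eqP => // _; case: w.
Qed.

Definition sqn (k : nat) (x : ms_car (RnM R k)) : R := \sum_(j < k) rcoord x j ^+ 2.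

Definition sep_entire (k m : nat) (f : ms_car (RnM R k) -> R[i]) :=
  forall x j, (j < m)%N -> entire (fun w => f (zup x j w)).

Lemma sum_double (F : nat -> R) m :
  \sum_(j < m.*2) F j = \sum_(j < m) (F j.*2 + F j.*2.+1).
Proof.
elim: m => [|m IH]; first by rewrite !big_ord0.
by rewrite doubleS !big_ord_recr /= IH addrA.
Qed.

Lemma sum_zk k m (x : ms_car (RnM R k)) : k = m.*2 ->
  sqn x = \sum_(j < m) cabs (zk x j) ^+ 2.
Proof.
move=> km; rewrite /sqn; transitivity (\sum_(j < m.*2) rcoord x j ^+ 2).
  by rewrite -km.
rewrite (sum_double (fun j => rcoord x j ^+ 2)).
by apply: eq_bigr => j _; rewrite sqr_cabs.
Qed.

Lemma measurable_rcoord k j : measurable_fun setT (fun x : ms_car (RnM R k) => rcoord x j).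
Proof.
elim: k => [|k IH] /=; first exact: measurable_cst.
case: eqP => _; first exact: measurable_snd.
exact: measurableT_comp IH measurable_fst.
Qed.

Lemma cmeas_zk k j : cmeas (fun x : ms_car (RnM R k) => zk x j).
Proof. by apply: cmeas_complex; exact: measurable_rcoord. Qed.

Lemma measurable_sqn k : measurable_fun setT (@sqn k).
Proof.
by apply: measurable_sum => j; apply: measurable_funX; exact: measurable_rcoord.
Qed.

End Coordinates.

(** * Lebesgue measure in higher dimension *)

Section EuclideanMeasure.
Context (R : realType).
Local Notation leb := (lebR R).
Local Notation pl := (lebR R \x lebR R)%E.

Lemma sigma_finite_RnM k : sigma_finite setT (ms_mes (RnM R k)).
Proof.
elim: k => [|k IH] /=.
  exists (fun=> setT); first by rewrite bigcup_const.
  by move=> _; split => //; rewrite diracT ltry.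
by have [m e] := sigma_finite_pack IH; rewrite e; exact: sigma_finite_prod.
Qed.

Lemma box_pos k (lo hi : nat -> R) : (forall j, lo j < hi j) ->
  measurable [set x : ms_car (RnM R k) | forall j, (j < k)%N -> lo j < rcoord x j < hi j]%classic /\
  (0 < ms_mes (RnM R k) [set x | forall j, (j < k)%N -> (lo j < rcoord x j < hi j)%R]%classic)%E.
Proof.
move=> h; elim: k => [|k [IH1 IH2]] /=.
  rewrite (_ : [set _ | _]%classic = setT); last by apply/seteqP; split => // x _ j.
  by split; [exact: measurableT|rewrite diracT].
set B := [set x : ms_car (RnM R k) | _]%classic in IH1 IH2.
have -> : [set x : ms_car (RnM R k.+1) | forall j, (j < k.+1)%N -> lo j < rcoord x j < hi j]%classic
   = (B `*` (`]lo k, hi k[%classic : set R))%classic.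
  apply/seteqP; split => -[x v] /=.
    move=> hx; split; last by have := hx k (ltnSn k); rewrite eqxx in_itv.
    by move=> j jk; have := hx j (ltnW jk); rewrite ltn_eqF.
  move=> [hx]; rewrite in_itv /= => hv j; rewrite ltnS leq_eqVlt.
  case: eqVneq => [->//|jk] /=; exact: hx.
have mI : measurable (`]lo k, hi k[%classic : set (measurableTypeR R)) by exact: measurable_itv.
split; first exact: measurableX.
have := @product_measure1E _ _ _ _ R (ms_mes (RnM R k)) leb _ _ IH1 mI.
move=> /= ->; apply: mule_gt0 => //.
have := @lebesgue_measure_itv R `]lo k, hi k[; rewrite /= lte_fin h.
by move=> ->; rewrite -EFinB lte_fin subr_gt0.
Qed.

(** If f exceeds M at x, lower semicontinuity makes it exceed M on an open box around x, and such a
    box has positive measure. *)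
Lemma ae_le_everywhere k (f : ms_car (RnM R k) -> R) (M : R) :
  (forall x e, 0 < e -> exists2 r, 0 < r & forall y,
    (forall j, (j < k)%N -> `|rcoord y j - rcoord x j| < r) -> f x - e < f y) ->
  {ae ms_mes (RnM R k), forall x, f x <= M} -> forall x, f x <= M.
Proof.
move=> cf [N [mN N0 subN]] x; rewrite leNgt; apply/negP => Mx.
have e0 : 0 < f x - M by rewrite subr_gt0.
have [r r0 hr] := cf x _ e0.
have [|mB B0] := @box_pos k (fun j => rcoord x j - r) (fun j => rcoord x j + r).
  by move=> j; lra.
set B := [set y : ms_car (RnM R k) | _]%classic in mB B0.
have BN : (B `<=` N)%classic.
  move=> y hy; apply: subN => /= le.
  have := hr y; rewrite opprB addrC subrK => /(_ _) h.
  have : M < f y; last by rewrite ltNge le.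
  by apply: h => j /hy /andP[? ?]; rewrite ltr_norml; apply/andP; split; lra.
have : (ms_mes (RnM R k) B <= ms_mes (RnM R k) N)%E by apply: le_measure; rewrite ?inE.
by apply/negP; rewrite -ltNge N0.
Qed.

Lemma integral_gauss_RnM k (a : R) (b : nat -> R) : 0 < a ->
  (\int[ms_mes (RnM R k)]_x (expR (\sum_(j < k) (- a * rcoord x j ^+ 2 + b j * rcoord x j)))%:E =
  (gauss_mass a ^+ k * expR (\sum_(j < k) b j ^+ 2 / (4 * a)))%:E)%E.
Proof.
move=> a0; elim: k => [|k IH] /=.
  rewrite (eq_integral (cst 1%E)); last by move=> x _; rewrite big_ord0 expR0.
  rewrite integral_cst// big_ord0 expR0 expr0 mulr1 mul1e.
  by rewrite -[LHS]/(\d_tt setT)%E diracT.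
pose u (x : ms_car (RnM R k)) :=
  expR (\sum_(j < k) (- a * rcoord x j ^+ 2 + b j * rcoord x j)).
pose v (y : measurableTypeR R) := expR (- a * y ^+ 2 + b k * y).
have [m e] := sigma_finite_pack (sigma_finite_RnM k).
have mu : measurable_fun setT u.
  apply: measurableT_comp => //; apply: measurable_sum => j.
  apply: measurable_funD; apply: measurable_funM => //; last exact: measurable_rcoord.
  by apply: measurable_funX; exact: measurable_rcoord.
transitivity (\int[ms_mes (RnM R k) \x leb]_p (u p.1 * v p.2)%:E)%E.
  apply: eq_integral => -[x y] _; congr EFin; rewrite -expRD; congr expR.
  rewrite big_ord_recr /= eqxx; congr (_ + _); apply: eq_bigr => j _.
  by rewrite !ltn_eqF.
move: IH; rewrite e => IH.
rewrite (ge0_integral_prod mu (measurable_gauss a (b k)) _ _ IH (integral_gauss (b k) a0)).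
- by rewrite big_ord_recr /= expRD [gauss_mass a ^+ _.+1]exprS; congr EFin; ring.
- by move=> x; exact: expR_ge0.
- by move=> x; exact: expR_ge0.
Qed.

Lemma rescales_inv d d' (T : measurableType d) (T' : measurableType d')
  (mu : {measure set T -> \bar R}) (mu' : {measure set T' -> \bar R})
  (phi : T -> T') (psi : T' -> T) A :
  measurable_fun setT psi -> cancel phi psi ->
  rescales mu mu' phi A -> rescales mu' mu psi A^-1.
Proof.
move=> mpsi c [A0 mphi h]; split => //; first by rewrite invr_gt0.
move=> g mg g0; have := h (g \o psi) (measurableT_comp mg mpsi) (fun x => g0 (psi x)).
under eq_integral do rewrite /= c.
by move=> ->; rewrite muleA -EFinM mulVf ?mul1e// gt_eqF.
Qed.

Lemma rescales_prod d1 d2 d1' d2' (T1 : measurableType d1) (T2 : measurableType d2)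
  (T1' : measurableType d1') (T2' : measurableType d2')
  (m1 : {sigma_finite_measure set T1 -> \bar R}) (m2 : {sigma_finite_measure set T2 -> \bar R})
  (m1' : {sigma_finite_measure set T1' -> \bar R}) (m2' : {sigma_finite_measure set T2' -> \bar R})
  phi psi A B : rescales m1 m1' phi A -> rescales m2 m2' psi B ->
  rescales (m1 \x m2)%E (m1' \x m2')%E (fun p => (phi p.1, psi p.2)) (A * B).
Proof.
move=> [A0 mphi hA] [B0 mpsi hB].
have m : measurable_fun setT (fun p : T1 * T2 => (phi p.1, psi p.2)).
  apply: measurable_fun_pair.
    exact: measurableT_comp mphi measurable_fst.
  exact: measurableT_comp mpsi measurable_snd.
split; [exact: mulr_gt0|exact: m|move=> g mg g0].
rewrite (fubini_tonelli1 (fun p => g (phi p.1, psi p.2)))//; last exact: (measurableT_comp mg m).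
rewrite (fubini_tonelli1 g)// EFinM -muleA.
have mG := measurable_fun_fubini_tonelli_F g mg g0 (m2 := m2').
have G0 x : (0 <= fubini_F m2' g x)%E by apply: integral_ge0 => y _.
rewrite (_ : (B%:E * _)%E = \int[m1']_x (B%:E * fubini_F m2' g x))%E; last first.
  by rewrite ge0_integralZl_EFin// ltW.
rewrite -hA.
- by apply: eq_integral => x _; rewrite /fubini_F -hB//; exact: measurableT_comp.
- exact: emeasurable_funM.
- by move=> x; rewrite mule_ge0// lee_fin ltW.
Qed.

(** Groups the last two real coordinates into a plane, splitting off the last complex variable. *)
Definition assoc k (p : ms_car (RnM R k.+2)) :
  ms_car (RnM R k) * (measurableTypeR R * measurableTypeR R) := (p.1.1, (p.1.2, p.2)).
Definition unassoc k (q : ms_car (RnM R k) * (measurableTypeR R * measurableTypeR R)) :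
  ms_car (RnM R k.+2) := ((q.1, q.2.1), q.2.2).

Lemma measurable_assoc k : measurable_fun setT (@assoc k).
Proof.
apply: measurable_fun_pair; first exact: (measurableT_comp measurable_fst measurable_fst).
apply: measurable_fun_pair; last exact: measurable_snd.
exact: (measurableT_comp measurable_snd measurable_fst).
Qed.

Lemma measurable_unassoc k : measurable_fun setT (@unassoc k).
Proof.
apply: measurable_fun_pair; last exact: (measurableT_comp measurable_snd measurable_snd).
apply: measurable_fun_pair; first exact: measurable_fst.
exact: (measurableT_comp measurable_fst measurable_snd).
Qed.

(** Both sides unfold by Tonelli into the same threefold iterated integral. *)
Lemma rescales_assoc k (m : {sigma_finite_measure set (ms_car (RnM R k)) -> \bar R})
  (pm : {sigma_finite_measure set (measurableTypeR R * measurableTypeR R)%type -> \bar R}) :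
  ms_mes (RnM R k) = m -> pl = pm :> {measure set _ -> \bar R} ->
  rescales (ms_mes (RnM R k.+2)) (m \x pm)%E (@assoc k) 1.
Proof.
move=> em epm; split => //; first exact: measurable_assoc.
move=> g mg g0; rewrite mul1e.
have [m' em'] := sigma_finite_pack (sigma_finite_prod m leb).
have {}em' : (m \x leb)%E = (m' : set _ -> \bar R).
  exact: (congr1 (fun M : {measure set _ -> \bar R} => (M : set _ -> \bar R)) em').
have mga := measurableT_comp mg (@measurable_assoc k).
rewrite (fubini_tonelli1 g)// /fubini_F.
transitivity (\int[(m \x leb) \x leb]_p g (assoc p))%E; first by rewrite /= em.
rewrite em' (fubini_tonelli1 (fun p => g (assoc p)))// -em'.
rewrite (fubini_tonelli1 (fubini_F leb (fun p => g (assoc p)))).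
- apply: eq_integral => x _; rewrite -epm.
  by rewrite (fubini_tonelli1 (fun y => g (x, y)))//; exact: measurableT_comp.
- exact: measurable_fun_fubini_tonelli_F.
- by move=> x; apply: integral_ge0.
Qed.

End EuclideanMeasure.

(** * The reproducing property in several variables; bounded quadratic polynomials *)

Section ReproducingKernel.
Context (R : realType).
Local Notation leb := (lebR R).
Local Notation pl := (lebR R \x lebR R)%E.
Local Notation car k := (ms_car (RnM R k)).
Local Notation mes k := (ms_mes (RnM R k)).

Lemma ae_cintble d (T : measurableType d) (mu : {measure set T -> \bar R})
  (f g : T -> R[i]) : cintble mu f -> cmeas g ->
  {ae mu, forall x, f x = g x} -> cintble mu g.
Proof.
move=> fi mg fg; have mf := cintble_meas fi; apply/(cintbleP _ mg).
rewrite -(@ge0_ae_eq_integral _ _ _ mu setT (fun x => (cabs (f x))%:E)) //.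
- exact: (cintbleP _ mf).1.
- exact/measurable_EFinP/measurable_cabs.
- exact/measurable_EFinP/measurable_cabs.
- by move=> x _; rewrite lee_fin cabs_ge0.
- by move=> x _; rewrite lee_fin cabs_ge0.
- by apply: filterS fg => x /= -> _.
Qed.

Section Unassoc.
Variables (k m : nat).
Hypothesis km : k = m.*2.
Implicit Types (q : car k * (measurableTypeR R * measurableTypeR R)).

Let kmS : k.+2 = m.+1.*2. Proof. by rewrite km doubleS. Qed.

Lemma zk_unassoc_lt q j : (j < m)%N -> zk (unassoc q) j = zk q.1 j.
Proof.
move=> jm; have [h1 h2] := double_lt km jm.
by rewrite /zk /= !ltn_eqF// ltnW.
Qed.

Lemma zk_unassoc q : zk (unassoc q) m = toC q.2.
Proof. by rewrite /zk /toC -km /= !eqxx ltn_eqF. Qed.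

Lemma sqn_unassoc q : sqn (unassoc q) = sqn q.1 + cabs (toC q.2) ^+ 2.
Proof.
rewrite (sum_zk _ kmS) big_ord_recr /= zk_unassoc (sum_zk _ km); congr (_ + _).
by apply: eq_bigr => j _; rewrite zk_unassoc_lt.
Qed.

Lemma eq_zkS (x y : car k.+2) : (forall j, (j < m)%N -> zk x j = zk y j) ->
  zk x m = zk y m -> x = y.
Proof.
move=> h hm; apply: (eq_zk kmS) => j; rewrite ltnS leq_eqVlt.
by case: eqVneq => [->//|_] /=; exact: h.
Qed.

Lemma zup_unassoc_lt q j w : (j < m)%N ->
  zup (unassoc q) j w = unassoc (zup q.1 j w, q.2).
Proof.
move=> jm; apply: eq_zkS => [i im|].
  by rewrite (zk_zup _ _ _ kmS (ltnW im)) !zk_unassoc_lt//= (zk_zup _ _ _ km im).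
by rewrite (zk_zup _ _ _ kmS (ltnSn m)) gtn_eqF// !zk_unassoc.
Qed.

Lemma zup_unassoc q w :
  zup (unassoc q) m w = unassoc (q.1, (Re w, Im w)).
Proof.
apply: eq_zkS => [i im|].
  by rewrite (zk_zup _ _ _ kmS (ltnW im)) ltn_eqF// !zk_unassoc_lt.
by rewrite (zk_zup _ _ _ kmS (ltnSn m)) eqxx zk_unassoc /toC; case: w.
Qed.

Lemma ptcS (w : nat -> R[i]) :
  ptc k.+2 w = unassoc (ptc k w, (Re (w m), Im (w m))).
Proof.
apply: eq_zkS => [i im|].
  by rewrite zk_unassoc_lt// (zk_ptc _ kmS (ltnW im)) (zk_ptc _ km im).
by rewrite zk_unassoc (zk_ptc _ kmS (ltnSn m)) /toC; case: (w m).
Qed.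

End Unassoc.

Definition kerm k (m : nat) (al : R[i]) (b : nat -> R[i]) (x : car k) : R[i] :=
  cexp (- al * (sqn x)%:C%C + \sum_(j < m) b j * conjc (zk x j)).

Lemma kerm_unassoc k m al b (q : car k * (measurableTypeR R * measurableTypeR R)) :
  k = m.*2 -> kerm m.+1 al b (unassoc q) = kerm m al b q.1 * ker1 al (b m) (toC q.2).
Proof.
move=> km; rewrite /kerm /ker1 -cexpD; congr cexp.
have -> : \sum_(j < m.+1) b j * conjc (zk (unassoc q) j) =
    \sum_(j < m) b j * conjc (zk q.1 j) + b m * conjc (toC q.2).
  rewrite big_ord_recr -(zk_unassoc km); congr (_ + _); apply: eq_bigr => j _.
  by rewrite -(zk_unassoc_lt km q (ltn_ord j)).
by rewrite (sqn_unassoc km) rmorphD mulJ; ring.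
Qed.

Lemma cmeas_kerm k m al b : cmeas (@kerm k m al b).
Proof.
apply: cmeas_cexp; apply: cmeasD.
  by apply: cmeasM; [exact: cmeas_cst|apply: cmeasR; exact: measurable_sqn].
apply: cmeas_sum => j; apply: cmeasM; first exact: cmeas_cst.
by apply: cmeasJ; exact: cmeas_zk.
Qed.

Lemma integral_cabs_kerm k m al b : k = m.*2 -> 0 < Re al ->
  (\int[mes k]_x (cabs (kerm m al b x))%:E =
   (gauss_mass (Re al) ^+ k * expR (\sum_(j < m) cabs (b j) ^+ 2 / (4 * Re al)))%:E)%E.
Proof.
move=> km al0; pose be i : R := if odd i then Im (b i./2) else Re (b i./2).
transitivity (\int[mes k]_x
  (expR (\sum_(j < k) (- Re al * rcoord x j ^+ 2 + be j * rcoord x j)))%:E)%E.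
  apply: eq_integral => x _; rewrite cabs_cexp; congr (expR _)%:E.
  rewrite ReDc big_split /=; congr (_ + _).
    by rewrite -mulr_sumr -/(sqn x) ReMc ReNc /= mulr0 subr0.
  transitivity (\sum_(j < m.*2) be j * rcoord x j); last by rewrite -km.
  rewrite (sum_double (fun j => be j * rcoord x j)).
  elim: (m) => [|m' IH]; first by rewrite !big_ord0.
  rewrite !big_ord_recr /= ReDc IH; congr (_ + _).
  rewrite /be /= odd_double /= doubleK uphalf_double.
  by rewrite ReMc /= mulrN opprK.
rewrite integral_gauss_RnM//; congr ((_ * expR _)%:E).
transitivity (\sum_(j < m.*2) be j ^+ 2 / (4 * Re al)); first by rewrite -km.
rewrite (sum_double (fun j => be j ^+ 2 / (4 * Re al))); apply: eq_bigr => j _.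
by rewrite /be /= odd_double /= doubleK uphalf_double -mulrDl -sqr_cabs.
Qed.

Lemma cintble_kerm k m al b : k = m.*2 -> 0 < Re al -> cintble (mes k) (kerm m al b).
Proof.
move=> km al0; apply/(cintbleP _ (cmeas_kerm _ _ _ _)).
by rewrite integral_cabs_kerm// ltry.
Qed.

(** Fubini splits off the last complex variable. Its integral evaluates f at [b m / al] in that
    variable, and the induction hypothesis applies to the remaining function [h]. *)
Lemma reproducing_RnM m : forall k, k = m.*2 ->
  forall (f : car k -> R[i]) (al : R[i]) (b : nat -> R[i]), 0 < Re al ->
  sep_entire m f -> cmeas f -> cintble (mes k) (fun x => f x * kerm m al b x) ->
  cint (mes k) (fun x => f x * kerm m al b x) =
  kappa al ^+ m * f (ptc k (fun j => b j / al)).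
Proof.
elim: m => [k|m IH k' km'].
  rewrite (_ : 0.*2 = 0%N)// => -> f al b al0 ef mf fi.
  have kE (x : car 0) : kerm 0 al b x = 1 :> R[i].
    by rewrite /kerm (sum_zk (m := 0) x erefl) !big_ord0 rmorph0 mulr0 addr0 cexp0.
  have int1 (u : car 0 -> R) : Rintegral (mes 0) setT u = u tt.
    rewrite /Rintegral (eq_integral (fun=> (u tt)%:E)); last by move=> [].
    rewrite integral_cst//; transitivity (fine ((u tt)%:E * (\d_tt setT))%E); first by [].
    by rewrite diracT mule1.
  by rewrite expr0 mul1r /cint !int1 kE mulr1 /=; case: (f tt).
rewrite doubleS in km'; move: km'; move km : (m.*2) => k km'; subst k'.
move/esym in km.
move=> f al b al0 ef mf fi; have kn := kappa_neq0 al0.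
have [mX eX] := sigma_finite_pack (sigma_finite_RnM R k).
have [pm epm] := sigma_finite_pack (sigma_finite_prod leb leb).
have sc := rescales_assoc eX epm.
pose g q := f (unassoc q); pose bt := b m / al.
have munassoc := @measurable_unassoc R k.
have mg : cmeas g := cmeas_comp munassoc mf.
pose G q := g q * (kerm m al b q.1 * ker1 al (b m) (toC q.2)).
have mG : cmeas G.
  apply: cmeasM => //; apply: cmeasM.
    exact: cmeas_comp measurable_fst (cmeas_kerm _ _ _ _).
  exact: cmeas_comp measurable_snd (cmeas_ker1 _ _).
have GE x : f x * kerm m.+1 al b x = G (assoc x).
  by rewrite /G -kerm_unassoc// /g; case: x => -[].
have Gi : cintble (mX \x pm)%E G.
  apply/(rescales_cintble sc mG); rewrite (_ : (fun x => _) =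
    (fun x => f x * kerm m.+1 al b x)) //; apply/funext => x; by rewrite GE.
under eq_cint do rewrite GE.
rewrite (rescales_cint sc Gi) mul1r (cint_fubini1 Gi).2.
have [Gi1 _] := cint_fubini1 Gi.
pose h (x : car k) := f (unassoc (x, (Re bt, Im bt))).
have mins : measurable_fun setT (fun x : car k => unassoc (x, (Re bt, Im bt))).
  apply: (measurableT_comp munassoc); apply: measurable_fun_pair => //.
have mh : cmeas h := cmeas_comp mins mf.
have hk : cmeas (fun x => h x * kerm m al b x).
  by apply: cmeasM => //; exact: cmeas_kerm.
(* Fubini provides integrable slices only for almost every x, so the one-variable formula holds only
   almost everywhere. *)
have slice : {ae mX, forall x, cint pm (fun y => G (x, y)) = kappa al * (h x * kerm m al b x)}.
  have := ae_cintble1 Gi; apply: filterS => x /= ix.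
  pose F z := g (x, (Re z, Im z)).
  have FE y : g (x, y) = F (toC y) by case: y.
  have eF : entire F.
    move=> z; have := ef (unassoc (x, (0, 0))) m (ltnSn m) z.
    rewrite (_ : (fun w => _) = F) //; apply/funext => w.
    by rewrite (zup_unassoc km).
  have W0 : kerm m al b x != 0 := cexp_neq0 _.
  have mF : cmeas (fun p => F (toC p)).
    rewrite (_ : (fun p => _) = (fun p => g (x, p))).
      exact: cmeas_comp (pair1_measurable x) mg.
    by apply/funext => p; rewrite -FE.
  have iF : cintble pl (fun p => F (toC p) * ker1 al (b m) (toC p)).
    (* Integrability of the slice passes to the one-variable integrand on division by the nonzero
       factor [kerm m al b x]. *)
    rewrite epm; have := cintbleZ (kerm m al b x)^-1 ix.
    rewrite (_ : (fun y => _) = (fun p => F (toC p) * ker1 al (b m) (toC p))) //.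
    apply/funext => p; rewrite /G FE /=; field; exact: W0.
  under eq_cint do rewrite /G FE /= mulrCA.
  rewrite cintZ; last by rewrite -epm.
  by rewrite -epm (reproducing1 al0 eF mF iF) /F -/bt /h /g; ring.
have khm : cmeas (fun x => kappa al * (h x * kerm m al b x)).
  by apply: cmeasM => //; exact: cmeas_cst.
rewrite (ae_eq_cint (cintble_meas Gi1) khm slice).
have khi := ae_cintble Gi1 khm slice.
(* The partial integral is integrable; dividing by kappa(al), which is nonzero, gives the
   integrability that the induction hypothesis requires. *)
have hi : cintble mX (fun x => h x * kerm m al b x).
  have := cintbleZ (kappa al)^-1 khi.
  by rewrite (_ : (fun x => _) = (fun x => h x * kerm m al b x)) //;
    apply/funext => x; rewrite mulKf.
rewrite cintZ// -eX (IH _ km h al b al0 _ mh).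
- by rewrite exprS -mulrA /h (ptcS km).
- move=> x j jm z; have := ef (unassoc (x, (Re bt, Im bt))) j (ltnW jm) z.
  rewrite (_ : (fun w => _) = (fun w => h (zup x j w))) //; apply/funext => w.
  by rewrite (zup_unassoc_lt km).
- by rewrite eX.
Qed.

(** Induction through [assoc]; each complex variable contributes the real Jacobian |ga|^2. *)
Lemma rescales_affine m : forall k, k = m.*2 ->
  forall (ga : R[i]) (de : nat -> R[i]), ga != 0 ->
  rescales (mes k) (mes k) (fun x => ptc k (fun j => ga * zk x j + de j)) ((cabs ga ^- 2) ^+ m).
Proof.
elim: m => [k|m IH k' km' ga de ga0].
  rewrite (_ : 0.*2 = 0%N)// => -> ga de ga0; split; [by rewrite expr0|exact: measurable_cst|].
  by move=> g mg g0; rewrite expr0 mul1e; apply: eq_integral => -[].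
rewrite doubleS in km'; move: km'; move km : (m.*2) => k km'; subst k'.
move/esym in km.
have [mX eX] := sigma_finite_pack (sigma_finite_RnM R k).
have [pm epm] := sigma_finite_pack (sigma_finite_prod leb leb).
have sc := rescales_assoc eX epm.
have assocK : cancel (@assoc R k) (@unassoc R k) by case=> -[].
have sc' := rescales_inv (@measurable_unassoc R k) assocK sc.
have IH' := IH _ km ga de ga0; rewrite eX in IH'.
have ca := rescales_caff (de m) ga0; rewrite epm in ca.
apply: eq_rescales (rescales_comp (rescales_comp sc (rescales_prod IH' ca)) sc').
  move=> x /=; rewrite (ptcS km) /=; congr unassoc; congr pair.
    have -> : x = unassoc (assoc x) by case: x => -[].
    apply: (eq_zk km) => j jm; rewrite !(zk_ptc _ km jm) (zk_unassoc_lt km)//.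
  have -> : zk x m = toC (assoc x).2.
    by rewrite -(zk_unassoc km); case: x => -[].
  by [].
by rewrite mul1r invr1 mulr1 [RHS]exprSr.
Qed.

(** The variables are decoupled: points with a single nonzero coordinate test one summand at a time,
    and conversely each summand is bounded by completing the square. *)
Lemma quadratic_bounded k m (A : R) (B : nat -> R[i]) : k = m.*2 ->
  (exists M, forall x : car k,
     \sum_(j < m) (A * cabs (zk x j) ^+ 2 + Re (B j * zk x j)) <= M) <->
  (forall j, (j < m)%N -> A < 0 \/ (A = 0 /\ B j = 0)).
Proof.
move=> km; split=> [[M hM] j jm|h].
  have test (w : R[i]) : A * cabs w ^+ 2 + Re (B j * w) <= M.
    have := hM (ptc k (fun i => if i == j then w else 0)).
    rewrite (bigD1 (Ordinal jm)) //= (zk_ptc _ km jm) eqxx big1 ?addr0// => i ij.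
    rewrite (zk_ptc _ km (ltn_ord i)) ifF; last by apply/negbTE; exact: ij.
    by rewrite cabs0 expr0n /= !mulr0 addr0.
  have [A0|A0|A0] := ltrgtP A 0; [by left| |].
    (* Adding the tests at t and - t cancels the linear term and leaves A t^2 <= M; but t >= 1 and t
       A = |M| + 1 + A force A t^2 > M. *)
    exfalso; pose t := (`|M| + 1) / A + 1.
    have tA : t * A = `|M| + 1 + A by rewrite mulrDl mul1r divfK// gt_eqF.
    have t1 : 1 <= t by rewrite lerDr divr_ge0 ?addr_ge0// ltW.
    have := test t%:C%C; have := test (- t%:C%C).
    rewrite mulrN ReNc cabsN cabsR ger0_norm; last by lra.
    have := ler_norm M; have : t ^+ 2 * A = t * (`|M| + 1 + A) by rewrite -tA; ring.
    nra.
  right; split => //; apply/eqP; apply: contraT => B0.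
  have b0 : 0 < cabs (B j) ^+ 2 by rewrite exprn_gt0// cabs_gt0.
  (* Along conj B the linear form is real; the scaling makes its value |M| + 1. *)
  have := test (((`|M| + 1) / cabs (B j) ^+ 2)%:C%C * conjc (B j)).
  rewrite A0 mul0r add0r mulrCA mulJ -rmorphM /= divfK ?gt_eqF//.
  by have := ler_norm M; lra.
(* The maximum of A r^2 + |B| r for A < 0; when A = 0 the numerator vanishes and the term is 0. *)
exists (\sum_(j < m) cabs (B j) ^+ 2 / (4 * - A)) => x; apply: ler_sum => j _.
have hRe : Re (B j * zk x j) <= cabs (B j) * cabs (zk x j).
  by rewrite -cabsM (le_trans (ler_norm _)) ?Re_le_cabs.
have [A0|[A0 B0]] := h j (ltn_ord j).
  rewrite ler_pdivlMr; last by rewrite mulr_gt0// oppr_gt0.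
  have := sqr_ge0 (2 * A * cabs (zk x j) + cabs (B j)); nra.
by rewrite A0 B0 mul0r mul0r /= cabs0 expr0n /= mul0r addr0.
Qed.

End ReproducingKernel.

(** * Continuity, holomorphy and the exponent Q *)

Section Functions.
Context (R : realType) (n : nat).
Local Notation car := (Cn R n).
Implicit Types (x y : car) (a b c d : nat -> R[i]) (f g : car -> R[i]).

Let km : (n + n)%N = n.*2 := addnn n.

(** Continuity with boxes instead of balls, matching [ae_le_everywhere]; it implies [ccontinuous]
    because a coordinate difference is at most the distance. *)
Definition bcont f := forall x (e : R), 0 < e -> exists2 r, 0 < r & forall y,
  (forall j, (j < n + n)%N -> `|rcoord y j - rcoord x j| < r) -> cabs (f y - f x) < e.

Lemma bcont_cst (z : R[i]) : bcont (fun=> z).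
Proof. by move=> x e e0; exists 1 => // y _; rewrite subrr cabs0. Qed.

Lemma bcontD f g : bcont f -> bcont g -> bcont (fun x => f x + g x).
Proof.
move=> hf hg x e e0; have e2 : 0 < e / 2 by rewrite divr_gt0.
have [r r0 hr] := hf x _ e2; have [s s0 hs] := hg x _ e2.
exists (Num.min r s); first by rewrite lt_min r0.
move=> y hy; have h1 : cabs (f y - f x) < e / 2.
  by apply: hr => j /hy; rewrite lt_min => /andP[].
have h2 : cabs (g y - g x) < e / 2.
  by apply: hs => j /hy; rewrite lt_min => /andP[].
have -> : f y + g y - (f x + g x) = (f y - f x) + (g y - g x) by ring.
by apply: (le_lt_trans (cabsD _ _)); lra.
Qed.

Lemma bcont_comp (F : R[i] -> R[i]) f : (forall z, ccont F z) -> bcont f ->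
  bcont (fun x => F (f x)).
Proof.
move=> hF hf x e e0; have [r r0 hr] := hF (f x) _ e0; have [s s0 hs] := hf x _ r0.
by exists s => // y /hs/hr.
Qed.

(** By polarization, 2 f g = (f + g)^2 - f^2 - g^2, products reduce to sums and to composition with
    one-variable maps. *)
Lemma bcontM f g : bcont f -> bcont g -> bcont (fun x => f x * g x).
Proof.
move=> hf hg.
have sq h : bcont h -> bcont (fun x => h x * h x).
  move=> hh; apply: (@bcont_comp (fun z => z * z)) => // z.
  by apply: ccontM; exact: ccont_id.
have half (z : R[i]) h : bcont h -> bcont (fun x => z * h x).
  move=> hh; apply: (@bcont_comp (fun w => z * w)) => // w.
  by apply: ccontM; [exact: ccont_cst|exact: ccont_id].
have -> : (fun x => f x * g x) = (fun x => 2^-1 * ((f x + g x) * (f x + g x)) +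
    ((- 2^-1) * (f x * f x) + (- 2^-1) * (g x * g x))).
  by apply/funext => x; field.
apply: bcontD; first by apply/half/sq/bcontD.
by apply: bcontD; apply: half; exact: sq.
Qed.

Lemma bcont_zk j : (j < n)%N -> bcont (fun x => zk x j).
Proof.
move=> jn x e e0; have [h1 h2] := double_lt km jn.
exists (e / 2); first by rewrite divr_gt0.
move=> y hy; apply: (le_lt_trans (cabs_le_ReIm _)) => /=.
by rewrite [e]splitr; apply: ltrD; exact: hy.
Qed.

Lemma bcontJ f : bcont f -> bcont (fun x => conjc (f x)).
Proof.
move=> hf x e e0; have [r r0 hr] := hf x _ e0; exists r => // y /hr.
by rewrite -conjN -conjD cabsJ.
Qed.

Lemma bcont_sum (F : nat -> car -> R[i]) m : (forall j, (j < m)%N -> bcont (F j)) ->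
  bcont (fun x => \sum_(j < m) F j x).
Proof.
elim: m => [|m IH] h.
  by under eq_fun do rewrite big_ord0; exact: bcont_cst.
under eq_fun do rewrite big_ord_recr /=; apply: bcontD; last exact: h.
by apply: IH => j jm; apply: h; exact: ltnW.
Qed.

Lemma bcont_ccontinuous f : bcont f -> ccontinuous f.
Proof.
move=> hf x e e0; have [r r0 hr] := hf x _ e0; exists r => // y hxy.
apply: hr => j jn.
rewrite -(@ltr_pXn2r _ 2)// ?nnegrE ?normr_ge0 ?(ltW r0)// real_normK ?num_real//.
apply: le_lt_trans hxy; rewrite /sqdist (bigD1 (Ordinal jn)) //=.
rewrite -sqrrN opprB lerDl; apply: sumr_ge0 => i _; exact: sqr_ge0.
Qed.

Lemma holomorphic_sep_entire f : holomorphic f -> sep_entire n f.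
Proof.
move=> [_ hf] x j jn w; have [L hL] := hf (zup x j w) j jn.
have zE v : zup (zup x j w) j v = zup x j v.
  by apply: (eq_zk km) => i im; rewrite !(zk_zup _ _ _ km im); case: eqP.
have wE : zk (zup x j w) j = w by rewrite (zk_zup _ _ _ km jn) eqxx.
apply/cdiffP; exists L => e /hL[r r0 hr]; exists r => // h h0 hh.
have := hr h h0 hh.
by rewrite -[zupd _ _ _]/(zup (zup x j w) j (zk (zup x j w) j + h)) zE wE.
Qed.

Lemma sep_entire_holomorphic f : ccontinuous f -> sep_entire n f -> holomorphic f.
Proof.
move=> cf ef; split => // x j jn.
have xE : zup x j (zk x j) = x.
  by apply: (eq_zk km) => i im; rewrite (zk_zup _ _ _ km im); case: eqP => [->|].
by have /cdiffP := ef x j jn (zk x j); rewrite xE.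
Qed.

Lemma sep_entireM f g : sep_entire n f -> sep_entire n g ->
  sep_entire n (fun x => f x * g x).
Proof. by move=> hf hg x j jn z; apply: cdiffM; [exact: hf|exact: hg]. Qed.

Lemma sep_entire_cst z : sep_entire n (fun _ : car => z).
Proof. by move=> x j jn w; exact: cdiff_cst. Qed.

Definition elin a x : R[i] := cexp (\sum_(j < n) a j * zk x j).

Lemma sep_entire_elin a : sep_entire n (elin a).
Proof.
move=> x j jn z; rewrite /elin; apply: (@cdiff_comp _ (@cexp R)); last exact: cdiff_cexp.
have : forall i : 'I_n, cdiff (fun w => a i * zk (zup x j w) i) z.
  move=> i; apply: cdiffM; first exact: cdiff_cst.
  rewrite (_ : (fun w => _) = (fun w => if val i == j then w else zk x i)).
    by case: eqP => _; [exact: cdiff_id|exact: cdiff_cst].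
  by apply/funext => w; rewrite (zk_zup _ _ _ km (ltn_ord i)).
move=> h; elim: (index_enum _) => [|i s IH].
  by under eq_fun do rewrite big_nil; exact: cdiff_cst.
by under eq_fun do rewrite big_cons; exact: cdiffD.
Qed.

Lemma bcont_elin a : bcont (elin a).
Proof.
apply: bcont_comp; first by move=> z; exact: cdiff_ccont (cdiff_cexp z).
apply: (@bcont_sum (fun j x => a j * zk x j)) => j jn.
by apply: bcontM; [exact: bcont_cst|exact: bcont_zk].
Qed.

Lemma cmeas_elin a : cmeas (elin a).
Proof.
apply: cmeas_cexp; apply: cmeas_sum => j.
by apply: cmeasM; [exact: cmeas_cst|exact: cmeas_zk].
Qed.

Lemma holomorphic_elin (z : R[i]) a : holomorphic (fun x => z * elin a x).
Proof.
apply: sep_entire_holomorphic.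
  by apply: bcont_ccontinuous; apply: bcontM; [exact: bcont_cst|exact: bcont_elin].
by apply: sep_entireM; [exact: sep_entire_cst|exact: sep_entire_elin].
Qed.

Lemma Re_sumJ a x : Re (\sum_(j < n) a j * zk x j) =
  Re (\sum_(j < n) conjc (a j) * conjc (zk x j)).
Proof. by rewrite -ReJ rmorph_sum /=; under eq_bigr do rewrite conjM. Qed.

Lemma weightE x : weight x = expR (- (sqn x / 2)).
Proof. by rewrite /weight /Phi0; congr expR; rewrite -[sqnorm x]/(sqn x); field. Qed.

Lemma measurable_weight : measurable_fun setT (@weight R n).
Proof.
apply: measurableT_comp => //; apply: measurableT_comp => //.
apply: measurable_funM => //; apply: measurable_funM => //; exact: measurable_sqn.
Qed.

(** [Qsymb] with coefficients indexed by all integers, as in [kerm] and [elin], and with the halves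
    moved inside the sums. *)
Definition Qs (lam : R[i]) c d x : R[i] := lam * (sqn x)%:C%C +
  \sum_(j < n) (2^-1 * conjc (c j)) * zk x j - \sum_(j < n) (2^-1 * d j) * conjc (zk x j).

Lemma cmeas_Qs lam c d : cmeas (Qs lam c d).
Proof.
apply: cmeasD.
  apply: cmeasD.
    by apply: cmeasM; [exact: cmeas_cst|apply: cmeasR; exact: measurable_sqn].
  by apply: cmeas_sum => j; apply: cmeasM; [exact: cmeas_cst|exact: cmeas_zk].
apply: cmeasN; apply: cmeas_sum => j; apply: cmeasM; first exact: cmeas_cst.
by apply: cmeasJ; exact: cmeas_zk.
Qed.

(** The adjoint of multiplication by e^Q is multiplication by the exponential of conj Q; as that has
    the same shape, [pairing] also serves when e^Q multiplies the kernel. *)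
Lemma conj_Qs lam c d x :
  conjc (Qs lam c d x) = Qs (conjc lam) (fun j => - d j) (fun j => - c j) x.
Proof.
have e1 : conjc (\sum_(j < n) (2^-1 * conjc (c j)) * zk x j) =
    - \sum_(j < n) (2^-1 * - c j) * conjc (zk x j).
  rewrite rmorph_sum -sumrN; apply: eq_bigr => j _.
  by rewrite -[LHS]/(conjc _) !conjM conjJ conj2V; ring.
have e2 : conjc (\sum_(j < n) (2^-1 * d j) * conjc (zk x j)) =
    - \sum_(j < n) (2^-1 * conjc (- d j)) * zk x j.
  rewrite rmorph_sum -sumrN; apply: eq_bigr => j _.
  by rewrite -[LHS]/(conjc _) !conjM conjJ conj2V conjN; ring.
by rewrite /Qs !conjD conjN conjM conjc_real e1 e2; ring.
Qed.

Lemma sumDM a b (h : nat -> R[i]) :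
  \sum_(j < n) (a j + b j) * h j = \sum_(j < n) a j * h j + \sum_(j < n) b j * h j.
Proof. by rewrite -big_split; apply: eq_bigr => j _; rewrite mulrDl. Qed.

Lemma sumBM a b (h : nat -> R[i]) :
  \sum_(j < n) (a j - b j) * h j = \sum_(j < n) a j * h j - \sum_(j < n) b j * h j.
Proof. by rewrite -sumrB; apply: eq_bigr => j _; rewrite mulrBl. Qed.

Lemma sumZM (z : R[i]) a (h : nat -> R[i]) :
  \sum_(j < n) (z * a j) * h j = z * \sum_(j < n) a j * h j.
Proof. by rewrite mulr_sumr; apply: eq_bigr => j _; rewrite mulrA. Qed.

Lemma Re_half (z : R[i]) : Re (2^-1 * z) = Re z / 2.
Proof.
have -> : (2^-1 : R[i]) = (2^-1)%:C%C by rewrite fmorphV rmorph_nat.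
by case: z => x y /=; rewrite mul0r subr0 mulrC.
Qed.

Lemma Re_2 (z : R[i]) : Re (2 * z) = 2 * Re z.
Proof. by rewrite mulr_natl mulr2n ReDc; ring. Qed.

End Functions.

(** * The weighted space and its reproducing kernels *)

Section BargmannSpace.
Context (R : realType) (n : nat).
Local Notation car := (Cn R n).
Implicit Types (x y : car) (a b c d : nat -> R[i]) (f g u v : car -> R[i]).

Let km : (n + n)%N = n.*2 := addnn n.

Lemma weight_ge0 x : 0 <= weight x. Proof. exact: expR_ge0. Qed.

Lemma wnorm2_integrable f : inL2 f ->
  (lebC R n).-integrable setT (EFin \o (fun x => cabs (f x) ^+ 2 * weight x)).
Proof.
move=> [mf hf]; apply/integrableP; split.
  apply/measurable_EFinP; apply: measurable_funM; last exact: measurable_weight.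
  by apply: measurable_funX; exact: measurable_cabs.
apply: le_lt_trans hf; rewrite le_eqVlt; apply/orP; left; apply/eqP.
apply: eq_integral => x _; congr EFin; apply: ger0_norm.
by rewrite mulr_ge0 ?sqr_ge0 ?weight_ge0.
Qed.

Lemma cintble_winner f g : inL2 f -> inL2 g ->
  cintble (lebC R n) (fun x => f x * conjc (g x) * (weight x)%:C%C).
Proof.
move=> hf hg; have i1 := wnorm2_integrable hf; have i2 := wnorm2_integrable hg.
apply: (@cintble_le _ _ _ _ _
  (fun x => cabs (f x) ^+ 2 * weight x + cabs (g x) ^+ 2 * weight x)).
- apply: cmeasM; last by apply: cmeasR; exact: measurable_weight.
  by apply: cmeasM; [case: hf|apply: cmeasJ; case: hg].
- rewrite (_ : EFin \o _ = ((EFin \o (fun x => cabs (f x) ^+ 2 * weight x)%R) \+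
    (EFin \o (fun x => cabs (g x) ^+ 2 * weight x)%R))%E)//.
  exact: integrableD.
- move=> x; rewrite !cabsM cabsJ cabsR ger0_norm ?weight_ge0// -mulrDl.
  rewrite ler_wpM2r ?weight_ge0//.
  have := sqr_ge0 (cabs (f x) - cabs (g x)).
  have := sqr_ge0 (cabs (f x)); have := sqr_ge0 (cabs (g x)); nra.
Qed.

Lemma winnerE f g : winner f g =
  cint (lebC R n) (fun x => f x * conjc (g x) * (weight x)%:C%C).
Proof. by []. Qed.

Lemma winnerB f g v : inL2 f -> inL2 g -> inL2 v ->
  winner (fun x => f x - g x) v = winner f v - winner g v.
Proof.
move=> hf hg hv; rewrite !winnerE -cintB;
  [|exact: cintble_winner|exact: cintble_winner].
by apply: eq_cint => x; ring.
Qed.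

Lemma winnerZ (z : R[i]) f v : inL2 f -> inL2 v ->
  winner (fun x => z * f x) v = z * winner f v.
Proof.
move=> hf hv; rewrite !winnerE -cintZ;
  last exact: cintble_winner.
by apply: eq_cint => x; ring.
Qed.

Lemma winner_conj f g : inL2 f -> inL2 g -> winner f g = conjc (winner g f).
Proof.
move=> hf hg; rewrite !winnerE -cint_conj;
  last exact: cintble_winner.
by apply: eq_cint => x; rewrite !conjM conjJ conjc_real; ring.
Qed.

(* Up to a constant, the reproducing kernel of H_Phi0 at the point a. *)
Definition kw a x : R[i] := elin (fun j => 2^-1 * conjc (a j)) x.

Lemma cexp_Qs_kerm lam c d a x :
  cexp (Qs lam c d x) * conjc (kw a x) * (weight x)%:C%C =
  elin (fun j => 2^-1 * conjc (c j)) x *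
  kerm n (2^-1 - lam) (fun j => 2^-1 * a j - 2^-1 * d j) x.
Proof.
rewrite /kw /elin conj_cexp weightE -cexpR /kerm -!cexpD; congr cexp.
have -> : conjc (\sum_(j < n) (2^-1 * conjc (a j)) * zk x j) =
    \sum_(j < n) (2^-1 * a j) * conjc (zk x j).
  rewrite rmorph_sum; apply: eq_bigr => j _.
  by rewrite -[LHS]/(conjc _) !conjM conjJ conj2V.
rewrite (sumBM n (fun j => 2^-1 * a j) (fun j => 2^-1 * d j) (fun j => conjc (zk x j))).
rewrite /Qs (_ : (- (sqn x / 2))%:C%C = - (sqn x)%:C%C * 2^-1); first by ring.
by rewrite rmorphN rmorphM /= fmorphV rmorph_nat mulNr.
Qed.

(** The weight exp(- |x|^2 / 2), e^Q and the conjugate kernel combine into a holomorphic exponential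
    times [kerm] with al = 1/2 - lam = mu / 2, so the reproducing property evaluates u at y = (a -
    d) / mu. *)
Lemma pairing lam c d a u : 0 < Re (2^-1 - lam) -> sep_entire n u -> cmeas u ->
  cintble (lebC R n)
    (fun x => cexp (Qs lam c d x) * u x * conjc (kw a x) * (weight x)%:C%C) ->
  let y := ptc (n + n) (fun j => (2^-1 * a j - 2^-1 * d j) / (2^-1 - lam)) in
  winner (fun x => cexp (Qs lam c d x) * u x) (kw a) =
  kappa (2^-1 - lam) ^+ n * (u y * elin (fun j => 2^-1 * conjc (c j)) y).
Proof.
move=> al0 eu mu ci y.
have E x : cexp (Qs lam c d x) * u x * conjc (kw a x) * (weight x)%:C%C =
    (u x * elin (fun j => 2^-1 * conjc (c j)) x) *
    kerm n (2^-1 - lam) (fun j => 2^-1 * a j - 2^-1 * d j) x.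
  rewrite [cexp _ * u x]mulrC -!mulrA; congr (u x * _).
  by rewrite mulrA (cexp_Qs_kerm lam c d a x).
rewrite (funext E) in ci.
transitivity (cint (lebC R n) (fun x => (u x * elin (fun j => 2^-1 * conjc (c j)) x) *
    kerm n (2^-1 - lam) (fun j => 2^-1 * a j - 2^-1 * d j) x)).
  by apply: eq_cint => x; exact: E.
rewrite (reproducing_RnM km al0)//.
  by apply: sep_entireM => //; exact: sep_entire_elin.
by apply: cmeasM => //; exact: cmeas_elin.
Qed.

(** Only the real part of the exponent counts, and Re (a z) = Re (conj a conj z), so every linear
    term can be made antiholomorphic. Squaring doubles lam, which is where Re lam < 1/4 comes
    from. *)
Lemma sqr_cabs_Qs_elin lam c d a x :
  cabs (cexp (Qs lam c d x) * elin a x) ^+ 2 * weight x =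
  cabs (kerm n (2^-1 - 2 * lam) (fun j => 2 * conjc (a j) + c j - d j) x).
Proof.
rewrite /elin -cexpD /kerm !cabs_cexp weightE expr2 -!expRD; congr expR.
have ec : Re (\sum_(j < n) conjc (c j) * zk x j) = Re (\sum_(j < n) c j * conjc (zk x j)).
  by rewrite (Re_sumJ (fun j => conjc (c j))); congr Re; apply: eq_bigr => j _; rewrite conjJ.
rewrite (sumBM n (fun j => 2 * conjc (a j) + c j) d (fun j => conjc (zk x j))).
rewrite (sumDM n (fun j => 2 * conjc (a j)) c (fun j => conjc (zk x j))).
rewrite (sumZM n 2 (fun j => conjc (a j)) (fun j => conjc (zk x j))).
rewrite /Qs (sumZM n 2^-1 (fun j => conjc (c j)) (zk x)).
rewrite (sumZM n 2^-1 d (fun j => conjc (zk x j))).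
rewrite !(ReDc, ReNc) !Re_half Re_2 (Re_sumJ a) ec.
rewrite (_ : - (2^-1 - 2 * lam) * (sqn x)%:C%C =
   2 * (lam * (sqn x)%:C%C) - 2^-1 * (sqn x)%:C%C); last by ring.
have es : Re ((sqn x)%:C%C : R[i]) = sqn x by [].
rewrite !(ReDc, ReNc) !Re_2 !Re_half es; lra.
Qed.

Lemma wnorm2_Qs_elin lam c d a : 0 < Re (2^-1 - 2 * lam) ->
  wnorm2 (fun x => cexp (Qs lam c d x) * elin a x) =
  (gauss_mass (Re (2^-1 - 2 * lam)) ^+ (n + n) * expR (\sum_(j < n)
     cabs (2 * conjc (a j) + c j - d j) ^+ 2 / (4 * Re (2^-1 - 2 * lam))))%:E.
Proof.
move=> al0; rewrite /wnorm2; under eq_integral do rewrite sqr_cabs_Qs_elin.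
exact: (integral_cabs_kerm (fun j => 2 * conjc (a j) + c j - d j) km al0).
Qed.

Lemma inL2_Qs_elin lam c d a : 0 < Re (2^-1 - 2 * lam) ->
  inL2 (fun x => cexp (Qs lam c d x) * elin a x).
Proof.
move=> al0; split; last by rewrite wnorm2_Qs_elin// ltry.
by apply: cmeasM; [apply: cmeas_cexp; exact: cmeas_Qs|exact: cmeas_elin].
Qed.

(** With Q = 0 the general formulas specialize to the norms of the kernels and to the reproducing
    property of the space. *)
Lemma Qs0 x : Qs 0 (fun=> 0) (fun=> 0) x = 0.
Proof.
rewrite /Qs mul0r !big1 ?addr0 ?subr0// => j _.
  by rewrite mulr0 mul0r.
by rewrite conjc0 mulr0 mul0r.
Qed.

Lemma cexp_Qs0 u : (fun x => cexp (Qs 0 (fun=> 0) (fun=> 0) x) * u x) = u.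
Proof. by apply/funext => x; rewrite Qs0 cexp0 mul1r. Qed.

Lemma Re2V : 0 < Re (2^-1 - 2 * 0 : R[i]).
Proof.
by rewrite mulr0 subr0 -[2^-1]mulr1 Re_half /= divr_gt0.
Qed.

Lemma inL2_elin a : inL2 (elin a : car -> R[i]).
Proof.
by have := inL2_Qs_elin (fun=> 0) (fun=> 0) a Re2V; rewrite cexp_Qs0.
Qed.

Lemma wnorm2_kw : exists2 N : R, 0 < N & forall a,
  wnorm2 (kw a) = (N * expR (\sum_(j < n) cabs (a j) ^+ 2 / 2))%:E.
Proof.
exists (gauss_mass (Re (2^-1 - 2 * 0 : R[i])) ^+ (n + n)).
  by rewrite exprn_gt0// gauss_mass_gt0// Re2V.
move=> a; have := wnorm2_Qs_elin (fun=> 0) (fun=> 0)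
  (fun j => 2^-1 * conjc (a j)) Re2V.
rewrite cexp_Qs0 -/(kw a) => ->; congr ((_ * expR _)%:E); apply: eq_bigr => j _.
rewrite addr0 subr0 conjM conjJ conj2V mulrA divff ?mul1r ?pnatr_eq0//.
by rewrite mulr0 subr0 -[2^-1 in LHS]mulr1 Re_half /=; congr (_ / _); field.
Qed.

Lemma inL2Z (z : R[i]) f : inL2 f -> inL2 (fun x => z * f x) /\
  (wnorm2 (fun x => z * f x)%R = (cabs z ^+ 2)%:E * wnorm2 f)%E.
Proof.
move=> [mf hf].
have e : (wnorm2 (fun x => z * f x)%R = (cabs z ^+ 2)%:E * wnorm2 f)%E.
  rewrite /wnorm2 -ge0_integralZl_EFin ?sqr_ge0//.
  - by apply: eq_integral => x _; rewrite cabsM exprMn -mulrA.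
  - by move=> x _; rewrite lee_fin mulr_ge0 ?sqr_ge0 ?weight_ge0.
  - apply/measurable_EFinP; apply: measurable_funM; last exact: measurable_weight.
    by apply: measurable_funX; exact: measurable_cabs.
split => //; split; first by apply: cmeasM => //; exact: cmeas_cst.
by rewrite e lte_mul_pinfty// lee_fin sqr_ge0.
Qed.

Lemma inH_Zelin (z : R[i]) a : inH (fun x : car => z * elin a x).
Proof.
by split; [exact: holomorphic_elin|exact: (inL2Z z (inL2_elin a)).1].
Qed.

Lemma inH_kw a : inH (kw a).
Proof.
have := inH_Zelin 1 (fun j => 2^-1 * conjc (a j)).
by rewrite (_ : (fun x => _) = kw a)//; apply/funext => x; rewrite mul1r.
Qed.

Lemma winner_kw f a : inH f -> winner f (kw a) = kappa 2^-1 ^+ n * f (ptc (n + n) a).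
Proof.
move=> [hf Lf]; have al0 : 0 < Re (2^-1 - 0 : R[i]).
  by have := Re2V; rewrite mulr0.
have := @pairing 0 (fun=> 0) (fun=> 0) a f al0 (holomorphic_sep_entire hf) Lf.1.
have ci := cintble_winner Lf (inH_kw a).2.
rewrite (_ : (fun x => f x * _ * _) = (fun x => cexp (Qs 0 (fun=> 0) (fun=> 0) x) * f x *
  conjc (kw a x) * (weight x)%:C%C)) in ci; last first.
  by apply/funext => x; rewrite Qs0 cexp0 mul1r.
move=> /(_ ci); rewrite cexp_Qs0 /= => ->; rewrite subr0.
have -> : elin (fun j => 2^-1 * conjc 0) = (fun=> 1 : R[i]) :> (car -> R[i]).
  apply/funext => x; rewrite /elin big1 ?cexp0// => j _.
  by rewrite conjc0 mulr0 mul0r.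
rewrite mulr1; congr (_ * f (ptc _ _)); apply/funext => j.
by rewrite mulr0 subr0 mulrAC divff ?mul1r// invr_eq0 pnatr_eq0.
Qed.

Lemma wnorm_sqr f : wnorm f ^+ 2 = fine (wnorm2 f).
Proof.
rewrite sqr_sqrtr// fine_ge0//; apply: integral_ge0 => x _.
by rewrite lee_fin mulr_ge0 ?sqr_ge0 ?weight_ge0.
Qed.

End BargmannSpace.

(** * Boundedness of the Toeplitz operator *)

Section ToeplitzBoundedness.
Context (R : realType) (n : nat).
Local Notation car := (Cn R n).
Implicit Types (x y : car) (c d a : nat -> R[i]) (lam : R[i]).

Let km : (n + n)%N = n.*2 := addnn n.

Lemma Re_sum (F : 'I_n -> R[i]) : Re (\sum_(j < n) F j) = \sum_(j < n) Re (F j).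
Proof. exact: (big_morph _ (@ReDc R) erefl). Qed.

Lemma half_real : (2^-1 : R[i]) = (2^-1)%:C%C.
Proof. by rewrite fmorphV rmorph_nat. Qed.

Lemma ptc_zk x : ptc (n + n) (zk x) = x.
Proof. by apply: (eq_zk km) => j jn; rewrite (zk_ptc _ km jn). Qed.

Lemma Re_param lam : Re lam < 4^-1 ->
  [/\ 0 < Re (2^-1 - lam), 0 < Re (2^-1 - 2 * lam), 0 < Re (1 - 2 * lam) & 0 < Re (1 - lam)].
Proof.
move=> h; rewrite half_real !ReDc !ReNc Re_2 /=; split; lra.
Qed.

Lemma Re_half_gt0 : 0 < Re (2^-1 : R[i]).
Proof. by rewrite half_real /= invr_gt0. Qed.

(** The operator sends one kernel to a multiple of another. Comparing the two norms for every x
    bounds the exponential of a quadratic polynomial in x. *)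
Lemma top_bounded_cond lam c d : Re lam < 4^-1 -> Top_bounded (Qs (n := n) lam c d) ->
  let mu := 1 - 2 * lam in forall j, (j < n)%N ->
  (1 - cabs mu ^+ 2) / 2 < 0 \/
  ((1 - cabs mu ^+ 2) / 2 = 0 /\ conjc (c j * mu - d j) = 0).
Proof.
move=> hl [C hC] mu; have [al0 al20 mu0 _] := Re_param hl.
have mun : mu != 0 := Re_gt0_neq0 mu0.
apply/(quadratic_bounded _ (fun j => conjc (c j * mu - d j)) km).
have [N N0 hN] := @wnorm2_kw R n.
pose lam' := conjc lam; pose al' : R[i] := 2^-1 - lam'.
have al'0 : 0 < Re al' by rewrite /al' ReDc ReNc ReJ -ReNc -ReDc.
have al'E : al' = conjc mu / 2.
  by rewrite /al' /mu /lam' conjD conjN conjM conjc1 conjc_nat; field.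
pose K0 := cabs (kappa al' ^+ n / kappa 2^-1 ^+ n).
have kh : kappa (2^-1 : R[i]) ^+ n != 0 by rewrite expf_neq0// kappa_neq0// Re_half_gt0.
have K00 : 0 < K0.
  by rewrite cabs_gt0 mulf_neq0 ?invr_eq0// expf_neq0// kappa_neq0.
exists (C ^+ 2 / K0 ^+ 2 + \sum_(j < n) cabs (c j) ^+ 2 / 2) => x.
(* Solves (w + c) / conj mu = x, so that [pairing] for conj Q evaluates at x. *)
pose w j := conjc mu * zk x j - c j.
pose e j : R[i] := 2^-1 * conjc (- d j).
(* The conjugate of the factor that [pairing] puts before v(x), divided by the constant of
   [winner_kw]. *)
pose P := conjc (kappa al' ^+ n * elin e x / kappa 2^-1 ^+ n).
pose p y := P * kw (zk x) y.
have Hu : inH (kw w : car -> R[i]) := inH_kw n w.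
have LQu : inL2 (fun y : car => cexp (Qs lam c d y) * kw w y) by exact: inL2_Qs_elin.
have Hk : inH (kw (zk x) : car -> R[i]) := inH_kw n _.
have Hp : inH p := inH_Zelin n P _.
have pr : is_proj (fun y => cexp (Qs lam c d y) * kw w y) p.
  split=> // v Hv; rewrite winnerB//; [|exact: Hp.2|exact: Hv.2].
  have ci := cintble_winner LQu Hv.2.
  (* The product of e^Q [kw w] with v is the conjugate of the product of exp(conj Q) v with [kw w],
     and the latter is a pairing with a kernel. *)
  have E y : cexp (Qs lam' (fun j => - d j) (fun j => - c j) y) * v y *
      conjc (kw w y) * (weight y)%:C%C =
      conjc (cexp (Qs lam c d y) * kw w y * conjc (v y) * (weight y)%:C%C).
    by rewrite !conjM conjJ conj_cexp conj_Qs conjc_real; ring.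
  have ci' := cintbleJ ci; rewrite -(funext E) in ci'.
  have := pairing al'0 (holomorphic_sep_entire Hv.1) Hv.2.1 ci'.
  have -> : ptc (n + n) (fun j => (2^-1 * w j - 2^-1 * - c j) / (2^-1 - lam')) = x.
    rewrite -[RHS]ptc_zk; congr ptc; apply/funext => j.
    rewrite -/al' al'E /w; field.
    by rewrite conjc_eq0.
  rewrite /= winnerE (funext E) cint_conj// -winnerE => /(congr1 conjc).
  rewrite conjJ => ->.
  rewrite (winnerZ P Hk.2 Hv.2) (winner_conj Hk.2 Hv.2) (winner_kw _ Hv) ptc_zk.
  apply/eqP; rewrite subr_eq0; apply/eqP.
  rewrite /P -[RHS]conjM -/al' -/e; congr conjc.
  by field; exact: kh.
have := hC _ Hu LQu _ pr => hle.
have wp0 : 0 <= wnorm p := sqrtr_ge0 _.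
have hsq : wnorm p ^+ 2 <= (C * wnorm (kw w : car -> R[i])) ^+ 2.
  by rewrite ler_pXn2r// nnegrE// (le_trans wp0).
move: hsq; rewrite exprMn !wnorm_sqr hN.
have [_ ->] := inL2Z P Hk.2.
rewrite hN -EFinM /= {hle pr Hp Hk LQu Hu}.
set t1 := \sum_(j < n) cabs (zk x j) ^+ 2 / 2; set t2 := \sum_(j < n) cabs (w j) ^+ 2 / 2.
pose s := \sum_(j < n) Re (e j * zk x j).
have -> : cabs P = K0 * expR s.
  rewrite cabsJ -mulrA [elin e x * _]mulrC mulrA cabsM -/K0; congr (_ * _).
  by rewrite /elin cabs_cexp Re_sum.
move=> h1.
have h2 : K0 ^+ 2 * expR (s + s + t1 - t2) <= C ^+ 2.
  have hE : expR (s + s + t1 - t2) * expR t2 = expR s * expR s * expR t1.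
    by rewrite -!expRD; congr expR; ring.
  rewrite -(ler_pM2l N0) -(ler_pM2r (expR_gt0 t2)).
  rewrite (_ : _ * expR t2 = (K0 * expR s) ^+ 2 * (N * expR t1)).
    by rewrite (_ : N * C ^+ 2 * expR t2 = C ^+ 2 * (N * expR t2)) //; ring.
  by rewrite -mulrA -[_ * _ * expR t2]mulrA hE; ring.
have K2 : 0 < K0 ^+ 2 by rewrite exprn_gt0.
(* From e^T >= T: a bound on the exponential bounds its exponent. *)
have h3 : s + s + t1 - t2 <= C ^+ 2 / K0 ^+ 2.
  rewrite ler_pdivlMr// mulrC; apply: le_trans h2; rewrite ler_pM2l//.
  by have := expR_ge1Dx (s + s + t1 - t2); lra.
have -> : \sum_(j < n) ((1 - cabs mu ^+ 2) / 2 * cabs (zk x j) ^+ 2 +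
    Re (conjc (c j * mu - d j) * zk x j)) =
    s + s + t1 - t2 + \sum_(j < n) cabs (c j) ^+ 2 / 2.
  rewrite /s /t1 /t2 -sumrN -!big_split /=; apply: eq_bigr => j _.
  rewrite /w /e half_real !sqr_cabs.
  case: (zk x j) => z1 z2; case: (c j) => c1 c2; case: (d j) => d1 d2.
  by case: (mu) => m1 m2 /=; field.
by rewrite lerD2r.
Qed.

(** Here the polynomial is written in y = (x - d) / mu, hence the linear coefficient conj c - mu
    conj d, which for |mu| = 1 vanishes together with c mu - d. *)
Lemma cond_top_bounded lam c d : Re lam < 4^-1 ->
  let mu := 1 - 2 * lam in
  (forall j, (j < n)%N -> (1 - cabs mu ^+ 2) / 2 < 0 \/
    ((1 - cabs mu ^+ 2) / 2 = 0 /\ conjc (c j) - mu * conjc (d j) = 0)) ->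
  Top_bounded (Qs (n := n) lam c d).
Proof.
move=> hl mu; have [al0 al20 mu0 _] := Re_param hl.
have mun : mu != 0 := Re_gt0_neq0 mu0.
move/(quadratic_bounded _ (fun j => conjc (c j) - mu * conjc (d j)) km) => [M hM].
have kh : kappa (2^-1 : R[i]) ^+ n != 0 by rewrite expf_neq0// kappa_neq0// Re_half_gt0.
pose C0 := kappa (2^-1 - lam) ^+ n / kappa 2^-1 ^+ n.
have gan : mu^-1 != 0 by rewrite invr_eq0.
pose psi x : car := ptc (n + n) (fun j => mu^-1 * zk x j + - d j / mu).
have sc : rescales (lebC R n) (lebC R n) psi ((cabs mu^-1 ^- 2) ^+ n).
  exact: (rescales_affine km (fun j => - d j / mu) gan).
set A0 := (cabs mu^-1 ^- 2) ^+ n in sc.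
pose K := cabs C0 ^+ 2 * expR M.
have K0 : 0 <= K by rewrite mulr_ge0 ?sqr_ge0 ?expR_ge0.
have zpsi x j : (j < n)%N -> zk x j = mu * zk (psi x) j + d j.
  by move=> jn; rewrite /psi (zk_ptc _ km jn); field.
exists (Num.sqrt (A0 * K)) => u Hu LQu p [Hp hp].
(* Pairing p with the kernel at x gives p(x), and pairing e^Q u with it gives the closed form; by
   [is_proj] the two agree. *)
have pE x : p x = C0 * (u (psi x) * elin (fun j => 2^-1 * conjc (c j)) (psi x)).
  have Hk : inH (kw (zk x) : car -> R[i]) := inH_kw n _.
  have := hp _ Hk; rewrite (winnerB LQu Hp.2 Hk.2) => /eqP; rewrite subr_eq0 => /eqP.
  rewrite (winner_kw _ Hp) ptc_zk.
  rewrite (pairing al0 (holomorphic_sep_entire Hu.1) Hu.2.1 (cintble_winner LQu Hk.2)) /=.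
  have -> : ptc (n + n) (fun j => (2^-1 * zk x j - 2^-1 * d j) / (2^-1 - lam)) = psi x.
    rewrite /psi; congr ptc; apply/funext => j.
    have -> : 2^-1 - lam = mu / 2 by rewrite /mu; field.
    by field.
  by move=> h; apply: (mulfI kh); rewrite -h /C0; field.
have [_ mpsi hsc] := sc.
pose g y := (K * (cabs (u y) ^+ 2 * weight y))%:E.
have mu2 : measurable_fun setT (fun y => cabs (u y) ^+ 2 * weight y).
  apply: measurable_funM; last exact: measurable_weight.
  by apply: measurable_funX; apply: measurable_cabs; exact: Hu.2.1.
have mg : measurable_fun setT g by apply/measurable_EFinP; exact: measurable_funM.
have w0 (f : car -> R[i]) y : 0 <= cabs (f y) ^+ 2 * weight y.
  by apply: mulr_ge0; [exact: sqr_ge0|exact: weight_ge0].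
have g0 y : (0 <= g y)%E by rewrite lee_fin; exact: (mulr_ge0 K0 (w0 u y)).
have ptw x : cabs (p x) ^+ 2 * weight x <= K * (cabs (u (psi x)) ^+ 2 * weight (psi x)).
  rewrite pE cabsM [cabs (u _ * _)]cabsM exprMn [(cabs (u _) * _) ^+ 2]exprMn.
  rewrite !weightE /elin cabs_cexp Re_sum; set y := psi x.
  set s := \sum_(j < n) Re _.
  (* Substituting x = mu y + d leaves the bounded polynomial in y, the weight exponent at y and the
     nonpositive term - |d|^2 / 2. *)
  have ex : - (sqn x / 2) + (s + s) <= M - sqn y / 2.
    have := hM y.
    have D0 : 0 <= \sum_(j < n) cabs (d j) ^+ 2 / 2.
      by apply: sumr_ge0 => j _; rewrite divr_ge0// sqr_ge0.
    suff : - (sqn x / 2) + (s + s) = \sum_(j < n) ((1 - cabs mu ^+ 2) / 2 * cabs (zk y j) ^+ 2 +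
      Re ((conjc (c j) - mu * conjc (d j)) * zk y j)) - sqn y / 2 -
      \sum_(j < n) cabs (d j) ^+ 2 / 2 by lra.
    rewrite (sum_zk x km) (sum_zk y km) !mulr_suml /s -!sumrN -!big_split /=.
    apply: eq_bigr => j _; rewrite (zpsi x j (ltn_ord j)) -/y half_real !sqr_cabs.
    case: (zk y j) => z1 z2; case: (c j) => c1 c2; case: (d j) => d1 d2.
    by case: (mu) => m1 m2 /=; field.
  have -> : cabs C0 ^+ 2 * (cabs (u y) ^+ 2 * expR s ^+ 2) * expR (- (sqn x / 2)) =
    cabs C0 ^+ 2 * cabs (u y) ^+ 2 * expR (- (sqn x / 2) + (s + s)).
    by rewrite !expRD expr2; ring.
  have -> : K * (cabs (u y) ^+ 2 * expR (- (sqn y / 2))) =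
    cabs C0 ^+ 2 * cabs (u y) ^+ 2 * expR (M - sqn y / 2).
    by rewrite expRD /K; ring.
  by apply: ler_wpM2l; [apply: mulr_ge0; exact: sqr_ge0|rewrite ler_expR].
have A00 : 0 < A0 by case: sc.
have le2 : (wnorm2 p <= (A0 * K)%:E * wnorm2 u)%E.
  apply: (@le_trans _ _ (\int[lebC R n]_x g (psi x))%E).
    apply: ge0_le_integral => //.
    - by move=> x _; rewrite lee_fin; exact: w0.
    - apply/measurable_EFinP; apply: measurable_funM; last exact: measurable_weight.
      by apply: measurable_funX; apply: measurable_cabs; exact: Hp.2.1.
    - exact: measurableT_comp mg mpsi.
    - by move=> x _; rewrite lee_fin; exact: ptw.
  have eg : (\int[lebC R n]_x g x = K%:E * wnorm2 u)%E.
    rewrite /wnorm2 -ge0_integralZl_EFin//.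
    - by move=> x _; rewrite lee_fin; exact: w0.
    - exact/measurable_EFinP.
  by rewrite (hsc g mg g0) eg EFinM muleA.
have nonneg2 (f : car -> R[i]) : (0 <= wnorm2 f)%E.
  by apply: integral_ge0 => x _; rewrite lee_fin; exact: w0.
have AK0 : 0 <= A0 * K := mulr_ge0 (ltW A00) K0.
have sw0 : 0 <= Num.sqrt (A0 * K) * wnorm u by apply: mulr_ge0; exact: sqrtr_ge0.
have wp0 : 0 <= wnorm p := sqrtr_ge0 _.
suff : wnorm p ^+ 2 <= (Num.sqrt (A0 * K) * wnorm u) ^+ 2 by rewrite ler_pXn2r// nnegrE.
rewrite exprMn (sqr_sqrtr AK0) !wnorm_sqr.
have fu : wnorm2 u \is a fin_num by rewrite ge0_fin_numE//; exact: Hu.2.2.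
have fp : wnorm2 p \is a fin_num by rewrite ge0_fin_numE//; exact: Hp.2.2.
by rewrite -lee_fin EFinM !fineK.
Qed.

End ToeplitzBoundedness.

(** * The Weyl symbol *)

Section WeylSymbol.
Context (R : realType) (n : nat).
Local Notation car := (Cn R n).
Implicit Types (x y : car) (c d : nat -> R[i]) (lam : R[i]).

Let km : (n + n)%N = n.*2 := addnn n.

Lemma sqdistE x y : sqdist x y = \sum_(j < n) cabs (zk x j - zk y j) ^+ 2.
Proof.
transitivity (\sum_(j < n.*2) (rcoord x j - rcoord y j) ^+ 2); first by rewrite -km.
rewrite (sum_double (fun j => (rcoord x j - rcoord y j) ^+ 2)).
by apply: eq_bigr => j _; rewrite sqr_cabs.
Qed.

Lemma sqnC x : (sqn x)%:C%C = \sum_(j < n) zk x j * conjc (zk x j) :> R[i].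
Proof.
by rewrite (sum_zk x km) rmorph_sum; apply: eq_bigr => j _; rewrite mulJ.
Qed.

Lemma sqdistC x y : (sqdist x y)%:C%C = (sqn x)%:C%C + (sqn y)%:C%C -
  \sum_(j < n) conjc (zk x j) * zk y j - \sum_(j < n) zk x j * conjc (zk y j) :> R[i].
Proof.
rewrite sqdistE rmorph_sum.
transitivity (\sum_(j < n) (zk x j * conjc (zk x j) + zk y j * conjc (zk y j)
    - conjc (zk x j) * zk y j - zk x j * conjc (zk y j))).
  apply: eq_bigr => j _; rewrite -[LHS]/((cabs (zk x j - zk y j) ^+ 2)%:C%C) -mulJ.
  by rewrite conjD conjN; ring.
by rewrite !big_split /= !sumrN -!sqnC.
Qed.

Definition weyl_exponent lam c d x : R[i] := \sum_(j < n) (- (zk x j * conjc (zk x j)) +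
  (conjc (zk x j) + 2^-1 * conjc (c j)) * ((zk x j - 2^-1 * d j) * (1 - lam)^-1)).

(** Expanding |x - y|^2 leaves, as a function of y, a holomorphic exponential times [kerm] with nu =
    1 - lam, to which the reproducing property applies. *)
Lemma weyl_symbol_Qs lam c d x : 0 < Re (1 - lam) ->
  weyl_symbol (Qs lam c d) x =
  ((pi ^- n)%:C%C * kappa (1 - lam) ^+ n) * cexp (weyl_exponent lam c d x).
Proof.
set nu := 1 - lam => nu0.
pose a j := conjc (zk x j) + 2^-1 * conjc (c j).
pose b j := zk x j - 2^-1 * d j.
have E y : (expR (- sqdist x y))%:C%C * cexp (Qs lam c d y) =
    cexp (- (sqn x)%:C%C) * (elin a y * kerm n nu b y).
  rewrite -cexpR /elin /kerm -!cexpD; congr cexp.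
  rewrite rmorphN -[X in - X]/((sqdist x y)%:C%C) sqdistC /Qs.
  rewrite (sumDM n (fun j => conjc (zk x j)) (fun j => 2^-1 * conjc (c j)) (zk y)).
  rewrite (sumBM n (zk x) (fun j => 2^-1 * d j) (fun j => conjc (zk y j))).
  by rewrite /nu; ring.
have mek : cmeas (fun y : car => elin a y * kerm n nu b y).
  by apply: cmeasM; [exact: cmeas_elin|exact: cmeas_kerm].
have iek : cintble (lebC R n) (fun y => elin a y * kerm n nu b y).
  (* In modulus the holomorphic exponential equals its conjugate, so the integrand has the modulus
     of a single [kerm]. *)
  apply: cintble_le_cabs mek (cintble_kerm (fun j => b j + conjc (a j)) km nu0) _ => y.
  rewrite cabsM /elin /kerm !cabs_cexp -expRD ler_expR.
  rewrite (sumDM n b (fun j => conjc (a j)) (fun j => conjc (zk y j))).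
  by rewrite !ReDc (Re_sumJ a); lra.
rewrite /weyl_symbol -mulrA; congr (_ * _).
transitivity (cint (lebC R n) (fun y => cexp (- (sqn x)%:C%C) * (elin a y * kerm n nu b y))).
  by apply: eq_cint => y; exact: E.
rewrite cintZ// (reproducing_RnM km nu0 _ _ iek); [|exact: sep_entire_elin|exact: cmeas_elin].
rewrite mulrCA; congr (_ * _); rewrite /elin -cexpD; congr cexp.
rewrite sqnC -sumrN -big_split; apply: eq_bigr => j _ /=.
by rewrite (zk_ptc _ km (ltn_ord j)).
Qed.

Lemma bcont_weyl_exponent lam c d : bcont (weyl_exponent lam c d).
Proof.
apply: (@bcont_sum _ _ (fun j x => - (zk x j * conjc (zk x j)) +
  (conjc (zk x j) + 2^-1 * conjc (c j)) * ((zk x j - 2^-1 * d j) * (1 - lam)^-1))) => j jn.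
have hz : bcont (fun x : car => zk x j) := bcont_zk jn.
have hzJ := bcontJ hz.
have hc (z : R[i]) : bcont (fun _ : car => z) := bcont_cst z.
apply: bcontD.
  have := bcontM (hc (-1)) (bcontM hz hzJ).
  by rewrite (_ : (fun x => -1 * _) = (fun x => - (zk x j * conjc (zk x j)))) //;
    apply/funext => x; rewrite mulN1r.
apply: bcontM; first exact: (bcontD hzJ (hc _)).
apply: bcontM; last exact: hc.
exact: (bcontD hz (hc (- (2^-1 * d j)))).
Qed.

Lemma cmeas_weyl_exponent lam c d : cmeas (weyl_exponent lam c d).
Proof.
apply: cmeas_sum => j; have hz := @cmeas_zk R (n + n) j; have hzJ := cmeasJ hz.
apply: cmeasD; first by apply: cmeasN; exact: cmeasM.
apply: cmeasM; first by apply: cmeasD => //; exact: cmeas_cst.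
apply: cmeasM; last exact: cmeas_cst.
by apply: cmeasD => //; exact: cmeas_cst.
Qed.

Lemma Re_weyl_exponent lam c d x : let r := (1 - lam)^-1 in
  Re (weyl_exponent lam c d x) =
  \sum_(j < n) ((Re r - 1) * cabs (zk x j) ^+ 2 +
     Re ((2^-1 * (conjc (c j) * r - conjc (d j * r))) * zk x j)) -
  \sum_(j < n) Re (conjc (c j) * d j * r) / 4.
Proof.
move=> r; rewrite /weyl_exponent -/r Re_sum -sumrN -big_split; apply: eq_bigr => j _.
rewrite half_real sqr_cabs.
case: (zk x j) => z1 z2; case: (c j) => c1 c2; case: (d j) => d1 d2.
by case: (r) => r1 r2 /=; field.
Qed.

(** The modulus of the symbol is a positive constant times the exponential of the polynomial plus a
    constant; continuity upgrades the almost everywhere bound to every point. *)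
Lemma in_Linfty_weyl lam c d : 0 < Re (1 - lam) -> let r := (1 - lam)^-1 in
  in_Linfty (weyl_symbol (Qs (n := n) lam c d)) <->
  exists M, forall x, \sum_(j < n) ((Re r - 1) * cabs (zk x j) ^+ 2 +
     Re ((2^-1 * (conjc (c j) * r - conjc (d j * r))) * zk x j)) <= M.
Proof.
move=> nu0 r; pose C1 : R[i] := (pi ^- n)%:C%C * kappa (1 - lam) ^+ n.
have C10 : 0 < cabs C1.
  rewrite cabs_gt0 mulf_neq0 ?expf_neq0 ?kappa_neq0//.
  by rewrite -cabs_gt0 cabsR normr_gt0 invr_eq0 expf_neq0// gt_eqF// pi_gt0.
pose D := \sum_(j < n) Re (conjc (c j) * d j * r) / 4.
have aE x : weyl_symbol (Qs lam c d) x = C1 * cexp (weyl_exponent lam c d x).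
  exact: weyl_symbol_Qs.
have cE x : cabs (weyl_symbol (Qs lam c d) x) =
    cabs C1 * expR (Re (weyl_exponent lam c d x)).
  by rewrite aE cabsM cabs_cexp.
split=> [[_ [M hM]]|[M hM]].
  have hae : {ae lebC R n, forall x, Re (weyl_exponent lam c d x) <= M / cabs C1}.
    apply: filterS hM => x /=; rewrite cE mulrC -ler_pdivlMr// => h.
    by apply: le_trans h; have := expR_ge1Dx (Re (weyl_exponent lam c d x)); lra.
  have h := ae_le_everywhere _ hae.
  exists (M / cabs C1 + D) => x; rewrite -lerBlDr -Re_weyl_exponent; apply: h => {}x e e0.
  have [s s0 hs] := bcont_weyl_exponent lam c d x e0.
  exists s => // y /hs hy; rewrite ltrBlDr -ltrBlDl.
  have := Re_le_cabs (weyl_exponent lam c d y - weyl_exponent lam c d x).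
  by rewrite ReDc ReNc ler_norml => /andP[h1 _]; lra.
split.
  have mw := cmeasM (cmeas_cst _ C1) (cmeas_cexp (cmeas_weyl_exponent lam c d)).
  by rewrite (funext aE).
exists (cabs C1 * expR (M - D)); apply: aeW => x; rewrite cE ler_pM2l// ler_expR.
by rewrite Re_weyl_exponent lerD2r.
Qed.

End WeylSymbol.

(** * Equivalence of the two conditions on the coefficients *)

Section Condition.
Context (R : realType).
Variables (lam c d : R[i]).
Let mu : R[i] := 1 - 2 * lam.
Let nu : R[i] := 1 - lam.
Hypothesis nu0 : 0 < Re nu.

(** Since mu = 2 nu - 1, |nu|^2 (Re (1 / nu) - 1) = Re nu - |nu|^2 = (1 - |mu|^2) / 4, so the
    quadratic coefficients have the same sign. *)
Lemma weyl_cond_equiv :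
  (Re nu^-1 - 1 < 0 \/
    (Re nu^-1 - 1 = 0 /\ 2^-1 * (conjc c * nu^-1 - conjc (d * nu^-1)) = 0)) <->
  ((1 - cabs mu ^+ 2) / 2 < 0 \/ ((1 - cabs mu ^+ 2) / 2 = 0 /\ c * mu = d)).
Proof.
have nun : nu != 0 := Re_gt0_neq0 nu0.
have nuJ : conjc nu != 0 by rewrite conjc_eq0.
have N0 : 0 < cabs nu ^+ 2 by rewrite exprn_gt0// cabs_gt0.
have rN : Re nu^-1 * cabs nu ^+ 2 = Re nu.
  have : nu^-1 * (cabs nu ^+ 2)%:C%C = conjc nu by rewrite -mulJ mulKf.
  by move/(congr1 (@complex.Re R)); rewrite ReMc /= mulr0 subr0 ReJ.
have mnu : cabs mu ^+ 2 = 4 * cabs nu ^+ 2 - 4 * Re nu + 1.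
  rewrite /mu /nu !sqr_cabs; case: lam => l1 l2 /=; ring.
have hA : (Re nu^-1 - 1) * cabs nu ^+ 2 = (1 - cabs mu ^+ 2) / 2 / 2.
  by rewrite mulrBl rN mnu; field.
have lt_iff : Re nu^-1 - 1 < 0 <-> (1 - cabs mu ^+ 2) / 2 < 0.
  have e : (Re nu^-1 - 1 < 0) = ((Re nu^-1 - 1) * cabs nu ^+ 2 < 0).
    by rewrite pmulr_llt0.
  by rewrite e hA; split; lra.
have eq_iff : Re nu^-1 - 1 = 0 <-> (1 - cabs mu ^+ 2) / 2 = 0.
  split=> [h|h]; first by move: hA; rewrite h mul0r; lra.
  by apply/eqP; rewrite -(mulIr_eq0 _ (mulIf (lt0r_neq0 N0))) hA h mul0r.
have eqB : (1 - cabs mu ^+ 2) / 2 = 0 ->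
    2^-1 * (conjc c * nu^-1 - conjc (d * nu^-1)) = 0 <-> c * mu = d.
  move=> h; have mu1 : mu * conjc mu = 1.
    rewrite mulJ (_ : cabs mu ^+ 2 = 1) ?rmorph1//.
    by move: h; lra.
  (* With nu = (1 + mu) / 2 and |mu| = 1, mu conj nu = (mu + 1) / 2. This converts one linear
     condition into the other. *)
  have hm : mu * conjc nu = nu.
    have e1 : conjc nu = 2^-1 * (1 + conjc mu).
      have -> : conjc nu = 1 - conjc lam by rewrite /nu conjD conjN conjc1.
      have -> : conjc mu = 1 - 2 * conjc lam.
        by rewrite /mu conjD conjN conjM conjc1 conjc_nat.
      by field.
    have e2 : nu = 2^-1 * (1 + mu) by rewrite /nu /mu; field.
    by rewrite e1 e2 mulrCA mulrDr mu1; ring.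
  split=> [B0|cd].
    have e1 : conjc c * nu^-1 = conjc d * (conjc nu)^-1.
      apply/eqP; rewrite -subr_eq0; move/eqP: B0.
      by rewrite mulf_eq0 invr_eq0 pnatr_eq0 /= conjM conjc_inv.
    have e2 : conjc (c * nu) = conjc (d * conjc nu).
      rewrite !conjM conjJ; transitivity (conjc c * nu^-1 * (nu * conjc nu)).
        by field.
      by rewrite e1; field.
    have e3 : c * nu = d * conjc nu by rewrite -[LHS]conjJ e2 conjJ.
    by apply: (mulIf nuJ); rewrite -mulrA hm.
  have hm' : conjc mu * nu = conjc nu by rewrite -[in RHS]hm conjM conjJ.
  rewrite -cd !conjM conjc_inv (_ : _ - _ = 0) ?mulr0//.
  have -> : conjc mu = conjc nu / nu by rewrite -hm' mulfK.
  have -> : conjc c * (conjc nu / nu) * (conjc nu)^-1 = conjc c * nu^-1.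
    by rewrite -mulrA; congr (_ * _); rewrite mulrAC mulfV// mul1r.
  exact: subrr.
split=> [[h|[h1 h2]]|[h|[h1 h2]]].
- by left; apply/lt_iff.
- by have h3 := eq_iff.1 h1; right; split => //; apply/(eqB h3).
- by left; apply/lt_iff.
- by right; split; [apply/eq_iff|apply/(eqB h1)].
Qed.

End Condition.

(** * From finite families to sequences of coefficients *)

Section Extension.
Context (R : realType) (n : nat).

(** Extension by 0 beyond n; the sums only read indices below n. *)
Definition ext (c : 'I_n -> R[i]) (j : nat) : R[i] := oapp c 0 (insub j).

Lemma ext_ord (c : 'I_n -> R[i]) (j : 'I_n) : ext c j = c j.
Proof. by rewrite /ext valK. Qed.

Lemma Qsymb_Qs (lam : R[i]) (c d : 'I_n -> R[i]) :
  Qsymb lam c d = Qs lam (ext c) (ext d).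
Proof.
apply/funext => x; rewrite /Qsymb /Qs !mulr_sumr.
congr (_ + _ - _); apply: eq_bigr => j _; rewrite ext_ord mulrA //.
Qed.

End Extension.

Theorem theorem4p2 (R : realType) (n : nat) (lam : R[i]) (c d : 'I_n -> R[i]) :
  complex.Re lam < 4^-1 ->
  (Top_bounded (Qsymb lam c d) <-> in_Linfty (weyl_symbol (Qsymb lam c d))).
Proof.
move=> hl; rewrite Qsymb_Qs.
have [_ _ _ nu0] := Re_param hl.
have bdd := iff_trans (in_Linfty_weyl n (ext c) (ext d) nu0) (quadratic_bounded _
  (fun j => 2^-1 * (conjc (ext c j) * (1 - lam)^-1 - conjc (ext d j * (1 - lam)^-1)))
  (addnn n)).
split=> [hT|/bdd hW].
  apply/bdd => j jn.
  apply/(weyl_cond_equiv _ _ nu0).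
  have [h|[h1 /eqP]] := top_bounded_cond hl hT jn; first by left.
  by rewrite conjc_eq0 subr_eq0 => /eqP h2; right.
apply: cond_top_bounded hl _ => j jn.
have /(weyl_cond_equiv _ _ nu0)[h|[h1 h2]] := hW j jn; [by left|right; split => //].
(* On |mu| = 1 the inverse of mu is its conjugate, so c mu = d gives conj c = mu conj d. *)
have mu1 : (1 - 2 * lam) * conjc (1 - 2 * lam) = 1.
  by rewrite mulJ (_ : cabs _ ^+ 2 = 1) ?rmorph1//; lra.
by rewrite -h2 conjM mulrCA mu1 mulr1 subrr.
Qed.
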